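(* Let $x$ be sufficiently large and let $k\le(\log x)^{1/5}$. Then there is a prime $p_0\gg\log\log x$ such that the following holds. Let $\mathcal{L}=\{L_1,\dots,L_k\}$ be a $\langle P_3\rangle$-admissible set of linear functions whose coefficients $L_i(n)=a_in+b_i$ satisfy $0<a_i\le(\log x)^{1/3}$, $\gcd(2p_0,a_i)=1$ and $0<b_i<x$. Then there is an absolute constant $C>0$ such that \[\#\{n\in[x,2x]:\ \text{at least } k^{1/2}/C \text{ of } L_1(n),\dots,L_k(n)\text{ lie in }\mathcal{S}\}\ge x\exp(-(\log x)^{1/2}).\]
   Context: $\mathcal{S}$ denotes the set of positive integers representable as a sum of two squares. A set $\mathcal{L}=\{L_1,\dots,L_k\}$ of distinct linear functions $L_i(n)=a_in+b_i$ with integer coefficients is called $\langle P_3\rangle$-admissible if for every prime $p\equiv3\pmod4$ there is an integer $n_p$ with $\gcd(\prod_{i=1}^kL_i(n_p),p)=1$, and $a_i,b_i>0$ for all $i$. *)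

(* Defs.v *)
From Stdlib Require Import Reals ZArith Znumtheory List Lra Lia.
Open Scope R_scope.

Definition inS (m : Z) : Prop :=
  (0 < m)%Z /\ exists u v : Z, m = (u * u + v * v)%Z.

Definition evalL (ab : Z * Z) (n : Z) : Z := (fst ab * n + snd ab)%Z.

Definition prodL (L : list (Z * Z)) (n : Z) : Z :=
  fold_right (fun ab acc => (evalL ab n * acc)%Z) 1%Z L.

Definition P3_admissible (L : list (Z * Z)) : Prop :=
  NoDup L /\
  (forall ab, In ab L -> (0 < fst ab)%Z /\ (0 < snd ab)%Z) /\
  (forall p : Z, prime p -> (p mod 4 = 3)%Z ->
     exists np : Z, Z.gcd (prodL L np) p = 1%Z).

Definition at_least_in_S (t : R) (L : list (Z * Z)) (n : Z) : Prop :=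
  exists I : list nat, NoDup I /\
    (forall i, In i I -> (i < length L)%nat /\ inS (evalL (nth i L (0%Z, 0%Z)) n)) /\
    t <= INR (length I).

(* Main.v *)
Require Import Defs.
From Stdlib Require Import Reals ZArith Znumtheory List.
From Stdlib Require Import Lra Lia Psatz Classical ClassicalEpsilon FinFun Zpow_facts.
Import ListNotations.

(* The variable n is sieved directly, without representations u^2 + v^2. An integer m = 1 mod 4 has an even number of prime factors = 3 mod 4, so it is a sum of two squares as soon as it has no such factor up to its square root. Fix n modulo the primes = 3 mod 4 up to w = (log x)^(2/5) so that none of them divides any L_j(n) (admissibility), and modulo 4 so that a quarter of the L_i(n) are 1 mod 4 (the a_i are odd).
   A Brun-Hooley sieve of dimension O(k) up to z = x^(1/O(k)) makes all L_j(n) free of primes = 3 mod 4; continuing it for a single L_i, now in dimension 1/2, up to x^(1/10), and removing the primes between x^(1/10) and x^(0.505) by the union bound, which costs log(5.05)/2 < 1, shows that a proportion >> k^(-1/2) of the survivors up to z have L_i(n) in S. Averaging over i gives >> k^(1/2) indices for many n.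
   The only input on primes is the upper bound sum_{u < p <= v, p = 3 mod 4} 1/p <= log(log v / log u)/2 + O(1/log u), obtained from Chebyshev's bound and the boundedness of sum chi(n) Lambda(n)/n for the character chi mod 4. *)

(** * Sums of two squares *)

Open Scope Z_scope.

(** Two demands pull against each other. The union bound from x^(1/10) to x^0.505 removes a
    proportion of up to 0.8255, so the sieve up to x^(1/10) must be accurate to a few percent: the
    factors 0.936 and 1.064 leave 0.936 - 0.8255 * 1.064 > 0.05. Yet the error of the upper sieve,
    about x^0.455, is multiplied by the length x^0.505 of the union bound, and the result x^0.96 is
    barely below x. Blocks with ratio 3 in ln p, truncated at levels that grow as the primes shrink,
    meet both demands. The other forms are sieved only up to z_J, with 3^J comparable to k. Primes
    that small leave room for the O(k) further truncation steps that dimension O(k) needs. Beyond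
    z_J a single form loses a factor of order 3^(-J/2), the source of k^(-1/2). The proportion
    surviving up to z_J may be tiny, but it enters the upper bound for the survivors and the lower
    bound for each L_i as the same factor, so it cancels in the averaging and only affects how many
    n are found. *)

Section Involution.
Variable A : Type.
Variable eqd : forall a b : A, {a = b} + {a <> b}.

(** Elements that are not fixed pair off with their images. The bound [m] on the length replaces
    structural induction, because such a step removes two elements at once. *)
Lemma involution_parity (f : A -> A) : forall (m : nat) (l : list A), (length l <= m)%nat ->
  NoDup l -> (forall a, In a l -> In (f a) l /\ f (f a) = a) ->
  exists h, length l = (length (filter (fun a => if eqd (f a) a then true else false) l) + 2 * h)%nat.
Proof.
  induction m as [|m IH]; intros l Hm Hnd Hf.
  - destruct l; simpl in *; [exists 0%nat; lia | lia].
  - destruct l as [|a l]; [exists 0%nat; reflexivity|].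
    inversion Hnd as [|? ? Hna Hnd']; subst.
    simpl. destruct (eqd (f a) a) as [E|E].
    + destruct (IH l) as [h Hh]; simpl in Hm; try lia; auto.
      { intros b Hb. destruct (Hf b (or_intror Hb)) as [[Hi|Hi] Hff]; split; auto.
        exfalso. assert (b = a) by congruence. subst b. exact (Hna Hb). }
      exists h. simpl. lia.
    + destruct (Hf a (or_introl eq_refl)) as [[Hi|Hi] Hff]; [congruence|].
      destruct (in_split _ _ Hi) as (l1 & l2 & ->).
      assert (Hnd2 := NoDup_remove_1 _ _ _ Hnd').
      assert (Hni := NoDup_remove_2 _ _ _ Hnd').
      destruct (IH (l1 ++ l2)) as [h Hh]; auto.
      { simpl in Hm. rewrite length_app in *. simpl in Hm. lia. }
      { intros b Hb. assert (Hb' : In b (a :: l1 ++ f a :: l2)).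
        { right. apply in_app_or in Hb. apply in_or_app. simpl. tauto. }
        destruct (Hf b Hb') as [Hi2 Hff2]. split; auto.
        destruct Hi2 as [Hi2|Hi2].
        - exfalso. apply Hni. rewrite Hi2, Hff2. exact Hb.
        - apply in_app_or in Hi2. simpl in Hi2.
          destruct Hi2 as [Hi2|[Hi2|Hi2]]; try (apply in_or_app; tauto).
          exfalso. assert (b = a) by congruence. subst b. apply Hna.
          apply in_app_or in Hb. apply in_or_app. simpl. tauto. }
      exists (S h). rewrite filter_app in *. simpl. rewrite Hff.
      destruct (eqd a (f a)); [congruence|].
      rewrite !length_app in *. simpl. lia.
Qed.
End Involution.

Definition zints (A : Z) (N : nat) : list Z := map (fun i => A + Z.of_nat i) (seq 0 N).

Lemma in_zints A N n : In n (zints A N) <-> A <= n < A + Z.of_nat N.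
Proof.
  unfold zints. rewrite in_map_iff. split.
  - intros (i & <- & Hi). apply in_seq in Hi. lia.
  - intros H. exists (Z.to_nat (n - A)). split; [lia|]. apply in_seq. lia.
Qed.

Lemma NoDup_zints A N : NoDup (zints A N).
Proof. apply Injective_map_NoDup; [intros i j; lia|apply seq_NoDup]. Qed.

Lemma NoDup_list_prod {A B : Type} (l : list A) (l' : list B) :
  NoDup l -> NoDup l' -> NoDup (list_prod l l').
Proof.
  intros Hl Hl'. induction Hl as [|a l Ha Hl IH]; simpl; [constructor|].
  apply NoDup_app; auto.
  - apply Injective_map_NoDup; auto. intros b c E; congruence.
  - intros [c b] H1 H2. apply in_map_iff in H1. destruct H1 as (b' & E & _).
    injection E as -> ->. apply in_prod_iff in H2. tauto.
Qed.

Definition windmill (t : Z * Z * Z) : Z * Z * Z :=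
  let '(x, y, z) := t in
  if x <? y - z then (x + 2 * z, z, y - x - z)
  else if x <? 2 * y then (2 * y - x, y, x - y + z)
  else (x - 2 * y, x - y + z, y).

Lemma triple_dec : forall a b : Z * Z * Z, {a = b} + {a <> b}.
Proof. repeat decide equality. Defined.

(* Zagier: on the solutions of x^2 + 4 y z = p the windmill involution has a unique fixed point, so the involution exchanging y and z has one too. *)
Lemma prime_1_mod_4_two_squares p : prime p -> p mod 4 = 1 -> exists u v, p = u * u + v * v.
Proof.
  intros Hp Hm.
  assert (Hp1 : 1 < p) by (destruct Hp; auto).
  set (sol := fun t : Z * Z * Z => let '(x, y, z) := t in
     x * x + 4 * y * z =? p).
  set (R := zints 1 (Z.to_nat p)).
  set (l := filter sol (list_prod (list_prod R R) R)).
  assert (Hl : forall x y z, In (x, y, z) l <-> (0 < x /\ 0 < y /\ 0 < z /\ x * x + 4 * y * z = p)).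
  { intros x y z. unfold l. rewrite filter_In, !in_prod_iff. unfold R. rewrite !in_zints.
    unfold sol. rewrite Z.eqb_eq. split; [lia|]. intros (? & ? & ? & ?). nia. }
  assert (Hnd : NoDup l).
  { unfold l. apply NoDup_filter.
    assert (HR : NoDup R) by apply NoDup_zints.
    apply NoDup_list_prod; auto. apply NoDup_list_prod; auto. }
  assert (Hsq : forall u, u * u <> p).
  { intros u Hu. assert (Hd : (Z.abs u | p)) by (exists (Z.abs u); nia).
    destruct (prime_divisors p Hp _ Hd) as [H|[H|[H|H]]]; nia. }
  assert (Hnp : forall d, 1 < d < p -> ~ (d | p)).
  { intros d Hd Hdv. destruct (prime_divisors p Hp _ Hdv) as [H|[H|[H|H]]]; lia. }
  assert (Hw : forall a, In a l -> In (windmill a) l /\ windmill (windmill a) = a).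
  { intros [[x y] z] Ha. apply Hl in Ha. destruct Ha as (Hx & Hy & Hz & He).
    (* The boundaries between the three cases are empty: [x = y - z] would make [p] the square of
       [y + z], and [x = 2 * y] would make it a multiple of 4. *)
    assert (x <> y - z). { intros ->. apply (Hsq (y + z)). nia. }
    assert (x <> 2 * y).
    { intros ->. pose proof (Z.div_mod p 4 ltac:(lia)). nia. }
    unfold windmill at 1 3.
    destruct (Z.ltb_spec x (y - z)); [|destruct (Z.ltb_spec x (2 * y))].
    - split; [apply Hl; nia|]. unfold windmill.
      destruct (Z.ltb_spec (x + 2 * z) (z - (y - x - z))); [lia|].
      destruct (Z.ltb_spec (x + 2 * z) (2 * z)); [lia|]. apply f_equal2; [apply f_equal2|]; lia.
    - split; [apply Hl; nia|]. unfold windmill.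
      destruct (Z.ltb_spec (2 * y - x) (y - (x - y + z))); [lia|].
      destruct (Z.ltb_spec (2 * y - x) (2 * y)); [|lia]. apply f_equal2; [apply f_equal2|]; lia.
    - split; [apply Hl; nia|]. unfold windmill.
      destruct (Z.ltb_spec (x - 2 * y) (x - y + z - y)); [|lia]. apply f_equal2; [apply f_equal2|]; lia. }
  destruct (involution_parity _ triple_dec windmill (length l) l (le_n _) Hnd Hw) as [h Hh].
  set (fl := filter _ l) in Hh.
  assert (Hfix : forall a, In a fl <-> a = (1, 1, p / 4)).
  { intros [[x y] z]. unfold fl. rewrite filter_In, Hl.
    pose proof (Z.div_mod p 4 ltac:(lia)) as Hdm. rewrite Hm in Hdm.
    split.
    - intros ((Hx & Hy & Hz & He) & Hf).
      destruct (triple_dec (windmill (x, y, z)) (x, y, z)) as [E|E]; [|discriminate].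
      unfold windmill in E.
      (* Only the middle case can fix a triple; it gives [x = y], so that [p = y * (y + 4 * z)] and
         [y = 1]. *)
      destruct (Z.ltb_spec x (y - z)); [|destruct (Z.ltb_spec x (2 * y))].
      + injection E; lia.
      + injection E; intros. assert (x = y) by lia. subst x.
        assert (Hd : (y | p)) by (exists (y + 4 * z); nia).
        destruct (Z.eq_dec y 1) as [->|]; [f_equal; lia|].
        exfalso. apply (Hnp y); auto. nia.
      + injection E; lia.
    - injection 1; intros -> -> ->. split; [lia|].
      destruct (triple_dec _ _) as [E|E]; auto. exfalso; apply E. unfold windmill.
      destruct (Z.ltb_spec 1 (1 - p / 4)); [lia|].
      destruct (Z.ltb_spec 1 (2 * 1)); [|lia]. apply f_equal2; [apply f_equal2|]; lia. }
  assert (Hfl : length fl = 1%nat).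
  { assert (Hndf : NoDup fl) by (apply NoDup_filter; auto).
    destruct fl as [|a [|b fl']] eqn:E; auto.
    - exfalso. apply (proj2 (Hfix (1, 1, p / 4)) eq_refl).
    - exfalso. assert (a = (1,1,p/4)) by (apply Hfix; simpl; auto).
      assert (b = (1,1,p/4)) by (apply Hfix; simpl; auto).
      inversion Hndf; subst. simpl in *; tauto. }
  set (sw := fun t : Z * Z * Z => let '(x, y, z) := t in (x, z, y)).
  assert (Hs : forall a, In a l -> In (sw a) l /\ sw (sw a) = a).
  { intros [[x y] z] Ha. split; auto. apply Hl in Ha. apply Hl. nia. }
  destruct (involution_parity _ triple_dec sw (length l) l (le_n _) Hnd Hs) as [h' Hh'].
  set (fs := filter _ l) in Hh'.
  destruct fs as [|[[x y] z] fs'] eqn:E; [simpl in Hh'; lia|].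
  assert (Hin : In (x, y, z) fs) by (rewrite E; simpl; auto).
  unfold fs in Hin. apply filter_In in Hin. destruct Hin as [Hi Hf].
  apply Hl in Hi. destruct (triple_dec _ _) as [E2|]; [|discriminate].
  injection E2; intros. subst z. exists x, (2 * y). lia.
Qed.

Lemma prime_divisor_exists (m : Z) : 1 < m -> exists p, prime p /\ (p | m).
Proof.
  intros Hm. assert (H0 : 0 <= m) by lia. revert Hm. pattern m. apply Z_lt_induction; [|exact H0].
  clear m H0. intros m IH Hm.
  destruct (prime_dec m) as [Hp|Hp]; [exists m; split; auto; apply Z.divide_refl|].
  destruct (not_prime_divide m Hm Hp) as (d & Hd & Hdv).
  destruct (IH d) as (p & Hp1 & Hp2); try lia.
  exists p; split; auto. eapply Z.divide_trans; eauto.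
Qed.

Lemma odd_prime_mod_4 p : prime p -> p <> 2 -> p mod 4 = 1 \/ p mod 4 = 3.
Proof.
  intros Hp H2. assert (H1 : 1 < p) by (destruct Hp; auto).
  assert (Hodd : p mod 2 <> 0).
  { intros H. apply Z.mod_divide in H; [|lia]. 
    destruct (prime_divisors p Hp 2 H) as [?|[?|[?|?]]]; lia. }
  pose proof (Z.mod_pos_bound p 4 ltac:(lia)).
  pose proof (Z.div_mod p 4 ltac:(lia)).
  assert (p mod 2 = (p mod 4) mod 2).
  { rewrite <- Znumtheory.Zmod_div_mod; try lia. exists 2; lia. }
  assert (C : p mod 4 = 0 \/ p mod 4 = 1 \/ p mod 4 = 2 \/ p mod 4 = 3) by lia.
  destruct C as [C|[C|[C|C]]]; auto; rewrite C in H3; simpl in H3; tauto.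
Qed.

(** Prime factors congruent to 1 modulo 4 are split off one by one, and Brahmagupta's identity
    multiplies the representations. *)
Lemma two_squares_of_no_3_mod_4 (m : Z) : 0 < m -> m mod 2 = 1 ->
  (forall p, prime p -> p mod 4 = 3 -> ~ (p | m)) -> inS m.
Proof.
  intros Hm Hodd H. split; auto.
  assert (H0 : 0 <= m) by lia. revert Hm Hodd H. pattern m. apply Z_lt_induction; [|exact H0].
  clear m H0. intros m IH Hm Hodd H.
  destruct (Z.eq_dec m 1) as [->|Hm1]; [exists 1, 0; reflexivity|].
  destruct (prime_divisor_exists m) as (p & Hp & [c Hc]); [lia|].
  assert (Hp1 : 1 < p) by (destruct Hp; auto).
  assert (Hc0 : 0 < c) by nia.
  assert (p <> 2). { intros ->. rewrite Hc, Z_mod_mult in Hodd. lia. }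
  destruct (odd_prime_mod_4 p Hp) as [H4|H4]; auto.
  - destruct (prime_1_mod_4_two_squares p Hp H4) as (a & b & Hab).
    destruct (IH c) as (u & v & Huv); try nia.
    + pose proof (Z.mod_pos_bound c 2 ltac:(lia)).
      destruct (Z.eq_dec (c mod 2) 0) as [Hz|]; [|lia].
      rewrite Hc, Z.mul_mod, Hz, Z.mul_0_l in Hodd by lia. discriminate.
    + intros q Hq Hq4 Hd. apply (H q Hq Hq4). rewrite Hc. apply Z.divide_mul_l; auto.
    + exists (a * u - b * v), (a * v + b * u). rewrite Hc, Hab, Huv. ring.
  - exfalso. apply (H p Hp H4). exists c; auto.
Qed.

(* A positive integer congruent to 1 mod 4 has an even number of prime factors congruent to 3 mod 4, so if there is one then the smallest is at most its square root. *)
Lemma inS_of_sieved (m y : Z) : 0 < m -> m mod 4 = 1 -> m < y * y -> 0 < y ->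
  (forall p, prime p -> p mod 4 = 3 -> p <= y -> ~ (p | m)) -> inS m.
Proof.
  intros Hm Hm4 Hy Hy0 H.
  assert (Hodd : forall c, c mod 4 = 1 -> c mod 2 = 1).
  { intros c Hc. rewrite (Znumtheory.Zmod_div_mod 2 4); try lia; [|exists 2; lia]. rewrite Hc; reflexivity. }
  apply two_squares_of_no_3_mod_4; auto.
  intros p Hp Hp4 [c Hc].
  destruct (Z_le_gt_dec p y) as [Hle|Hgt]; [apply (H p); auto; exists c; auto|].
  assert (Hc0 : 0 < c) by nia. assert (Hcy : c < y) by nia.
  (* Since 3 * 3 = 1 modulo 4, the cofactor of a prime [p > y] is again 3 modulo 4, and it is below
     [y]; a prime factor of it that is 3 modulo 4 then contradicts [H]. *)
  assert (Hc4 : c mod 4 = 3).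
  { rewrite Hc, Z.mul_mod, Hp4 in Hm4 by lia.
    pose proof (Z.mod_pos_bound c 4 ltac:(lia)).
    assert (C : c mod 4 = 0 \/ c mod 4 = 1 \/ c mod 4 = 2 \/ c mod 4 = 3) by lia.
    destruct C as [C|[C|[C|C]]]; auto; rewrite C in Hm4; simpl in Hm4; discriminate. }
  assert (Hall : forall m', 0 < m' -> m' mod 4 = 3 -> exists q, prime q /\ q mod 4 = 3 /\ (q | m')).
  { intros m' Hm'. assert (H0 : 0 <= m') by lia. revert Hm'. pattern m'. apply Z_lt_induction; [|exact H0].
    clear m' H0. intros m' IH Hm' H3.
    destruct (prime_divisor_exists m') as (q & Hq & [d Hd]).
    { destruct (Z.eq_dec m' 1) as [->|]; [discriminate|lia]. }
    assert (1 < q) by (destruct Hq; auto).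
    assert (q <> 2).
    { intros ->. pose proof (Z.div_mod m' 4 ltac:(lia)). lia. }
    destruct (odd_prime_mod_4 q Hq) as [H4|H4]; auto.
    - destruct (IH d) as (r & Hr & Hr4 & Hrd); try nia.
      + rewrite Hd, Z.mul_mod, H4, Z.mul_1_r, Z.mod_mod in H3 by lia. auto.
      + exists r. split; [auto|split; [auto|]]. rewrite Hd. apply Z.divide_mul_l; auto.
    - exists q. split; [auto|split; [auto|]]. exists d; auto. }
  destruct (Hall c Hc0 Hc4) as (q & Hq & Hq4 & Hqc).
  apply (H q Hq Hq4).
  - apply Z.divide_pos_le in Hqc; lia.
  - rewrite Hc. apply Z.divide_mul_l; auto.
Qed.

(** Euclid's argument with N! + 1; it supplies [p0]. *)
Lemma prime_above (N : Z) : exists p, prime p /\ N <= p.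
Proof.
  set (F := Z.of_nat (fact (Z.to_nat N))).
  assert (HF : forall j : nat, (1 <= j <= Z.to_nat N)%nat -> (Z.of_nat j | F)).
  { unfold F. generalize (Z.to_nat N). induction n as [|n IH]; intros j Hj; [lia|].
    replace (fact (S n)) with (S n * fact n)%nat by reflexivity. rewrite Nat2Z.inj_mul.
    destruct (Nat.eq_dec j (S n)) as [->|].
    - apply Z.divide_mul_l, Z.divide_refl.
    - apply Z.divide_mul_r, IH. lia. }
  assert (HF0 : 0 < F) by (unfold F; pose proof (lt_O_fact (Z.to_nat N)); lia).
  destruct (prime_divisor_exists (F + 1)) as (p & Hp & Hd); [lia|].
  exists p; split; auto.
  destruct (Z_lt_ge_dec p N) as [Hlt|]; [|lia].
  assert (1 < p) by (destruct Hp; auto).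
  assert (Hd2 : (p | F)) by (rewrite <- (Z2Nat.id p) by lia; apply HF; lia).
  assert (Hd3 : (p | 1)) by (replace 1 with (F + 1 - F) by ring; apply Z.divide_sub_r; auto).
  apply Z.divide_pos_le in Hd3; lia.
Qed.

Close Scope Z_scope.
Open Scope R_scope.

(** * Mertens' estimate for primes congruent to 3 modulo 4 *)

Fixpoint rsum {A : Type} (l : list A) (f : A -> R) : R :=
  match l with [] => 0 | a :: l' => f a + rsum l' f end.

Section Rsum.
Context {A : Type}.
Implicit Types (l : list A) (f g : A -> R).

Lemma rsum_ext l f g : (forall a, In a l -> f a = g a) -> rsum l f = rsum l g.
Proof. induction l; simpl; intros H; [auto|]. rewrite H, IHl; auto. Qed.

Lemma rsum_le l f g : (forall a, In a l -> f a <= g a) -> rsum l f <= rsum l g.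
Proof. induction l; simpl; intros H; [lra|]. apply Rplus_le_compat; auto. Qed.

Lemma rsum_app l l' f : rsum (l ++ l') f = rsum l f + rsum l' f.
Proof. induction l; simpl; lra. Qed.

Lemma rsum_plus l f g : rsum l (fun a => f a + g a) = rsum l f + rsum l g.
Proof. induction l; simpl; lra. Qed.

Lemma rsum_minus l f g : rsum l (fun a => f a - g a) = rsum l f - rsum l g.
Proof. induction l; simpl; lra. Qed.

Lemma rsum_scal l f c : rsum l (fun a => c * f a) = c * rsum l f.
Proof. induction l; simpl; lra. Qed.

Lemma rsum_const l c : rsum l (fun _ => c) = c * INR (length l).
Proof. induction l; [simpl; lra|]. simpl length. rewrite S_INR. simpl. lra. Qed.

Lemma rsum_nonneg l f : (forall a, In a l -> 0 <= f a) -> 0 <= rsum l f.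
Proof. induction l; simpl; intros H; [lra|]. apply Rplus_le_le_0_compat; auto. Qed.

Lemma rsum_abs l f : Rabs (rsum l f) <= rsum l (fun a => Rabs (f a)).
Proof. induction l; simpl; [rewrite Rabs_R0; lra|]. eapply Rle_trans; [apply Rabs_triang|lra]. Qed.

Lemma rsum_filter l f (b : A -> bool) :
  rsum (filter b l) f = rsum l (fun a => if b a then f a else 0).
Proof. induction l as [|a l IH]; simpl; auto. destruct (b a); simpl; rewrite IH; lra. Qed.

Lemma rsum_mem l f a : (forall b, In b l -> 0 <= f b) -> In a l -> f a <= rsum l f.
Proof.
  induction l as [|b l IH]; simpl; [tauto|]. intros H [->|Hi].
  - pose proof (rsum_nonneg l f). apply Rle_trans with (f a + 0); [lra|]. apply Rplus_le_compat_l; auto.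
  - apply Rle_trans with (0 + rsum l f); [rewrite Rplus_0_l; auto|]. apply Rplus_le_compat_r; auto.
Qed.
End Rsum.

Lemma rsum_map {A B} (h : A -> B) (l : list A) f : rsum (map h l) f = rsum l (fun a => f (h a)).
Proof. induction l; simpl; congruence. Qed.

Lemma rsum_swap {A B} (l : list A) (l' : list B) (f : A -> B -> R) :
  rsum l (fun a => rsum l' (fun b => f a b)) = rsum l' (fun b => rsum l (fun a => f a b)).
Proof.
  induction l as [|a l IH]; simpl.
  - induction l'; simpl; lra.
  - rewrite IH, rsum_plus. reflexivity.
Qed.

Lemma rsum_list_prod {A B} (l : list A) (l' : list B) f :
  rsum (list_prod l l') f = rsum l (fun a => rsum l' (fun b => f (a, b))).
Proof. induction l; simpl; auto. rewrite rsum_app, rsum_map. congruence. Qed.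

Lemma rsum_seq_S s n f : rsum (seq s (S n)) f = rsum (seq s n) f + f (s + n)%nat.
Proof. rewrite seq_S, rsum_app. simpl. lra. Qed.

Lemma ln_le x y : 0 < x -> x <= y -> ln x <= ln y.
Proof. intros Hx [H| ->]; [left; apply ln_increasing; auto|lra]. Qed.

Lemma ln_div x y : 0 < x -> 0 < y -> ln (x / y) = ln x - ln y.
Proof.
  intros Hx Hy. unfold Rdiv. rewrite ln_mult, ln_Rinv; auto; try lra. apply Rinv_0_lt_compat; auto.
Qed.

Lemma INR_pos n : (1 <= n)%nat -> 1 <= INR n.
Proof. intros H. apply (le_INR 1) in H. exact H. Qed.

(** * Von Mangoldt weights, Chebyshev's bound and Mertens' first estimate *)

Definition primeb (p : nat) : bool := if prime_dec (Z.of_nat p) then true else false.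

Lemma primeb_spec p : primeb p = true <-> prime (Z.of_nat p).
Proof. unfold primeb. destruct prime_dec; split; auto; discriminate. Qed.

Lemma prime_ge_2_nat p : prime (Z.of_nat p) -> (2 <= p)%nat.
Proof. intros [H _]. lia. Qed.

Definition dvdr (q n : nat) : R := if (n mod q =? 0)%nat then 1 else 0.

Lemma dvdr_iff q n : (q <> 0)%nat -> dvdr q n = if (if Zdivide_dec (Z.of_nat q) (Z.of_nat n) then true else false) then 1 else 0.
Proof.
  intros Hq. unfold dvdr. destruct (Nat.eqb_spec (n mod q) 0) as [E|E]; destruct Zdivide_dec as [D|D]; auto; exfalso.
  - apply D. apply Nat.Lcm0.mod_divide in E. destruct E as [c ->]. exists (Z.of_nat c). lia.
  - apply E. destruct D as [c Hc]. apply Nat.Lcm0.mod_divide. exists (Z.to_nat c). nia.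
Qed.

(* Pairs (p, a) stand for the prime powers p^a and carry the von Mangoldt weight [ln p]. *)
Definition prime_powers (K : nat) : list (nat * nat) :=
  list_prod (filter primeb (seq 1 K)) (seq 1 K).

Definition ppow (t : nat * nat) : nat := (fst t ^ snd t)%nat.
Definition mangoldt (t : nat * nat) : R := ln (INR (fst t)).

Lemma in_prime_powers K t : In t (prime_powers K) -> prime (Z.of_nat (fst t)) /\ (1 <= snd t)%nat.
Proof.
  destruct t as [p a]. unfold prime_powers. rewrite in_prod_iff, filter_In, in_seq, primeb_spec.
  rewrite in_seq. simpl. intuition lia.
Qed.

Lemma ppow_ge_2 K t : In t (prime_powers K) -> (2 <= ppow t)%nat.
Proof.
  intros H. apply in_prime_powers in H. destruct t as [p a]; unfold ppow; simpl in *.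
  destruct H as [Hp Ha]. apply prime_ge_2_nat in Hp.
  destruct a; [lia|]. simpl. pose proof (Nat.pow_nonzero p a). nia.
Qed.

Lemma mangoldt_nonneg K t : In t (prime_powers K) -> 0 <= mangoldt t.
Proof.
  intros H. apply in_prime_powers in H. destruct H as [Hp _]. apply prime_ge_2_nat in Hp.
  unfold mangoldt. rewrite <- ln_1. apply ln_le; [lra|]. apply INR_pos; lia.
Qed.

Lemma dvdr_pow_mul_other p q a m : prime (Z.of_nat p) -> prime (Z.of_nat q) -> p <> q ->
  dvdr (p ^ a) (q * m) = dvdr (p ^ a) m.
Proof.
  intros Hp Hq Hpq. assert (H2 := prime_ge_2_nat p Hp).
  assert (Hn : (p ^ a <> 0)%nat) by (apply Nat.pow_nonzero; lia).
  rewrite !dvdr_iff by auto.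
  assert (Hr : rel_prime (Z.of_nat (p ^ a)) (Z.of_nat q)).
  { rewrite Nat2Z.inj_pow. apply rel_prime_sym. apply Zpow_facts.rel_prime_Zpower_r; [lia|].
    apply rel_prime_sym. apply prime_rel_prime; auto.
    intros Hd. destruct (prime_divisors _ Hq _ Hd) as [?|[?|[?|?]]]; lia. }
  destruct Zdivide_dec as [D|D]; destruct Zdivide_dec as [D'|D']; auto; exfalso.
  - apply D'. rewrite Nat2Z.inj_mul in D. apply Gauss with (Z.of_nat q); auto.
  - apply D. rewrite Nat2Z.inj_mul. apply Z.divide_mul_r; auto.
Qed.

Lemma dvdr_pow_mul_same q a m : (2 <= q)%nat -> dvdr (q ^ S a) (q * m) = dvdr (q ^ a) m.
Proof.
  intros H2. assert (Hn : (q ^ a <> 0)%nat) by (apply Nat.pow_nonzero; lia).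
  unfold dvdr. simpl. rewrite Nat.Div0.mul_mod_distr_l.
  destruct (Nat.eqb_spec (m mod q ^ a) 0); destruct (Nat.eqb_spec (q * (m mod q ^ a)) 0); auto; nia.
Qed.

(** Remove one prime factor [q]: the positive exponents a with q^a dividing [q * m] are the
    exponents for [m], 0 included, shifted by one. This adds a single ln q, and the other primes are
    not affected. *)
Lemma ln_eq_sum_mangoldt K n : (1 <= n <= K)%nat ->
  ln (INR n) = rsum (prime_powers K) (fun t => mangoldt t * dvdr (ppow t) n).
Proof.
  induction n as [n IH] using lt_wf_ind. intros Hn.
  unfold prime_powers. rewrite rsum_list_prod. unfold mangoldt, ppow. simpl.
  destruct (Nat.eq_dec n 1) as [->|Hn1].
  - simpl. rewrite ln_1. symmetry.
    rewrite rsum_ext with (g := fun _ => 0); [rewrite rsum_const; lra|].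
    intros p Hp. apply filter_In in Hp. destruct Hp as [_ Hp]. apply primeb_spec, prime_ge_2_nat in Hp.
    rewrite rsum_ext with (g := fun _ => 0); [rewrite rsum_const; lra|].
    intros a Ha. apply in_seq in Ha. unfold dvdr.
    rewrite Nat.mod_small; [simpl; lra|]. destruct a; [lia|]. simpl. pose proof (Nat.pow_nonzero p a). nia.
  - destruct (prime_divisor_exists (Z.of_nat n)) as (qz & Hq & [c Hc]); [lia|].
    assert (1 < qz)%Z by (destruct Hq; auto).
    remember (Z.to_nat qz) as q eqn:Eq. assert (Hqz : qz = Z.of_nat q) by lia. subst qz. clear Eq.
    remember (Z.to_nat c) as m eqn:Em. assert (Hcm : c = Z.of_nat m) by nia. subst c. clear Em.
    assert (Hnm : n = (q * m)%nat) by nia. clear Hc.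
    assert (Hm : (1 <= m)%nat) by nia. assert (Hmn : (m < n)%nat) by nia.
    specialize (IH m Hmn ltac:(lia)).
    unfold prime_powers in IH. rewrite rsum_list_prod in IH. unfold mangoldt, ppow in IH. simpl in IH.
    rewrite rsum_ext with (g := fun p =>
      rsum (seq 1 K) (fun b => ln (INR p) * dvdr (p ^ b) m) + (if (p =? q)%nat then ln (INR q) else 0)).
    + rewrite rsum_plus, <- IH. rewrite Hnm, mult_INR, ln_mult; try (apply lt_0_INR; lia).
      rewrite Rplus_comm. f_equal.
      assert (Hin : In q (filter primeb (seq 1 K))).
      { apply filter_In. rewrite in_seq, primeb_spec. split; auto. nia. }
      assert (Hnd : NoDup (filter primeb (seq 1 K))) by (apply NoDup_filter, seq_NoDup).
      revert Hin Hnd. generalize (filter primeb (seq 1 K)). clear.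
      induction l as [|p l IH]; simpl; [tauto|]. intros Hin Hnd. inversion Hnd; subst.
      destruct (Nat.eqb_spec p q) as [->|E].
      * rewrite rsum_ext with (g := fun _ => 0); [rewrite rsum_const; lra|].
        intros a Ha. destruct (Nat.eqb_spec a q); auto. subst; tauto.
      * rewrite <- IH; auto; [lra|]. destruct Hin; auto; tauto.
    + intros p Hp. apply filter_In in Hp. destruct Hp as [_ Hp]. apply primeb_spec in Hp.
      rewrite !rsum_scal. destruct (Nat.eqb_spec p q) as [->|E].
      * assert (H2 := prime_ge_2_nat q Hp).
        enough (rsum (seq 1 K) (fun a => dvdr (q ^ a) n) = rsum (seq 1 K) (fun a => dvdr (q ^ a) m) + 1) as ->
          by lra.
        destruct K as [|K]; [lia|].
        rewrite <- seq_shift, rsum_map.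
        rewrite rsum_ext with (g := fun a => dvdr (q ^ a) m)
          by (intros a _; rewrite Hnm; apply dvdr_pow_mul_same; auto).
        rewrite seq_shift, (rsum_seq_S 1 K). change (seq 0 (S K)) with (0%nat :: seq 1 K). cbn [rsum].
        replace (dvdr (q ^ 0) m) with 1 by (unfold dvdr; rewrite Nat.pow_0_r, Nat.mod_1_r; reflexivity).
        (* The top exponent contributes nothing, since [q ^ (1 + K)] exceeds [m]. *)
        enough (dvdr (q ^ (1 + K)) m = 0) as -> by lra.
        unfold dvdr. rewrite Nat.mod_small.
        { destruct (Nat.eqb_spec m 0); [lia|auto]. }
        apply Nat.lt_le_trans with (2 ^ (1 + K))%nat; [|apply Nat.pow_le_mono_l; auto].
        pose proof (Nat.pow_gt_lin_r 2 (1 + K)). lia.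
      * rewrite Rplus_0_r. f_equal. apply rsum_ext. intros a _. rewrite Hnm. apply dvdr_pow_mul_other; auto.
Qed.

Lemma rsum_dvdr q N (h : nat -> R) : (1 <= q)%nat ->
  rsum (seq 1 N) (fun n => dvdr q n * h n) = rsum (seq 1 (N / q)) (fun m => h (q * m)%nat).
Proof.
  intros Hq. induction N as [|N IH].
  - rewrite Nat.Div0.div_0_l. reflexivity.
  - rewrite rsum_seq_S, IH. unfold dvdr. replace (1 + N)%nat with (S N) by lia.
    pose proof (Nat.div_mod_eq (S N) q). pose proof (Nat.mod_upper_bound (S N) q ltac:(lia)).
    destruct (Nat.eqb_spec (S N mod q) 0) as [E|E].
    + assert (H1 : (S N / q = S (N / q))%nat).
      { symmetry. rewrite E in H. destruct (S N / q)%nat as [|c] eqn:Ec; [lia|].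
        f_equal. symmetry. apply Nat.div_unique with (q - 1)%nat; nia. }
      rewrite H1, rsum_seq_S. replace (1 + N / q)%nat with (S N / q)%nat by lia.
      replace (q * (S N / q))%nat with (S N) by lia. lra.
    + assert (H1 : (N / q = S N / q)%nat).
      { symmetry. apply Nat.div_unique with (S N mod q - 1)%nat; nia. }
      rewrite H1. lra.
Qed.

(** This is ln N!. *)
Definition lfact (N : nat) : R := rsum (seq 1 N) (fun n => ln (INR n)).

Definition upto (N : nat) (t : nat * nat) : R := if (ppow t <=? N)%nat then 1 else 0.

(** Chebyshev's function at [N]. The parameter [K] only fixes a finite list of prime powers,
    complete as soon as [N <= K]. *)
Definition psi (K N : nat) : R := rsum (prime_powers K) (fun t => mangoldt t * upto N t).

(** Legendre's formula for ln N!. *)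
Lemma lfact_mangoldt K N : (N <= K)%nat ->
  lfact N = rsum (prime_powers K) (fun t => mangoldt t * INR (N / ppow t)).
Proof.
  intros HN. unfold lfact.
  rewrite rsum_ext with (g := fun n => rsum (prime_powers K) (fun t => mangoldt t * dvdr (ppow t) n)).
  - rewrite rsum_swap. apply rsum_ext. intros t Ht. rewrite rsum_scal. f_equal.
    rewrite rsum_ext with (g := fun n => dvdr (ppow t) n * 1) by (intros; lra).
    rewrite rsum_dvdr by (apply ppow_ge_2 in Ht; lia). rewrite rsum_const, length_seq. lra.
  - intros n Hn. apply in_seq in Hn. apply ln_eq_sum_mangoldt. lia.
Qed.

Lemma lfact_S N : lfact (S N) = lfact N + ln (INR (S N)).
Proof. unfold lfact. rewrite rsum_seq_S. reflexivity. Qed.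

Lemma ln_le_self x : 0 < x -> ln x <= x - 1.
Proof. intros H. pose proof (exp_ineq1_le (ln x)). rewrite exp_ln in H0 by auto. lra. Qed.

Lemma ln_2_bounds : 0 < ln 2 <= 1.
Proof. split; [rewrite <- ln_1; apply ln_increasing; lra|]. pose proof (ln_le_self 2). lra. Qed.

Lemma ln_nonneg x : 1 <= x -> 0 <= ln x.
Proof. intros H. rewrite <- ln_1. apply ln_le; lra. Qed.

(** The left side is the logarithm of the central binomial coefficient. Passing from M to M + 1
    multiplies that coefficient by (2M+1)(2M+2)/(M+1)^2 <= 4, and ln 4 <= 2. *)
Lemma lfact_central M : lfact (2 * M) - 2 * lfact M <= INR M * 2.
Proof.
  induction M as [|M IH]; [unfold lfact; simpl; lra|].
  replace (2 * S M)%nat with (S (S (2 * M))) by lia. rewrite !lfact_S.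
  assert (E : INR (S M) * 2 = INR M * 2 + 2) by (rewrite S_INR; lra).
  assert (H1 : ln (INR (S (2 * M))) <= ln 2 + ln (INR (S M))).
  { rewrite <- ln_mult; [|lra|apply lt_0_INR; lia]. apply ln_le; [apply lt_0_INR; lia|].
    rewrite !S_INR, mult_INR. simpl. pose proof (pos_INR M). lra. }
  assert (H2 : ln (INR (S (S (2 * M)))) <= ln 2 + ln (INR (S M))).
  { rewrite <- ln_mult; [|lra|apply lt_0_INR; lia]. apply ln_le; [apply lt_0_INR; lia|].
    rewrite !S_INR, mult_INR. simpl. pose proof (pos_INR M). lra. }
  pose proof ln_2_bounds. lra.
Qed.

Lemma lfact_lower N : INR N * ln (INR N) - INR N <= lfact N.
Proof.
  induction N as [|N IH]; [unfold lfact; simpl; lra|].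
  rewrite lfact_S. destruct N as [|N].
  { unfold lfact in *. simpl. rewrite ln_1. lra. }
  set (a := INR (S N)) in *. assert (Ha : 1 <= a) by (apply INR_pos; lia).
  rewrite (S_INR (S N)). fold a.
  assert (H : ln (a + 1) - ln a <= 1 / a).
  { rewrite <- ln_div by lra. replace ((a + 1) / a) with (1 + 1 / a) by (field; lra).
    assert (0 < 1 / a) by (apply Rdiv_lt_0_compat; lra). pose proof (ln_le_self (1 + 1 / a)). lra. }
  apply (Rmult_le_compat_l a) in H; [|lra]. replace (a * (1 / a)) with 1 in H by (field; lra). lra.
Qed.

Lemma lfact_upper N : (1 <= N)%nat -> lfact N <= INR N * ln (INR N).
Proof.
  intros HN. unfold lfact. replace (INR N * ln (INR N)) with (rsum (seq 1 N) (fun _ => ln (INR N)))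
    by (rewrite rsum_const, length_seq; ring).
  apply rsum_le. intros n Hn. apply in_seq in Hn. apply ln_le; [apply lt_0_INR; lia|apply le_INR; lia].
Qed.

(** Chebyshev's halving argument. In ln N! - 2 ln M!, with M the integer part of N/2, every weight
    has a nonnegative coefficient, and for prime powers in (M, N] it is at least 1. The difference
    is at most 3N, and 3 + 3/2 + 3/4 + ... = 6. *)
Lemma psi_le K N : (N <= K)%nat -> psi K N <= 6 * INR N.
Proof.
  induction N as [N IH] using lt_wf_ind. intros HN.
  destruct (Nat.eq_dec N 0) as [->|HN0].
  { unfold psi. rewrite rsum_ext with (g := fun _ => 0); [rewrite rsum_const; simpl; lra|].
    intros t Ht. apply ppow_ge_2 in Ht. unfold upto. destruct (Nat.leb_spec (ppow t) 0); [lia|lra]. }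
  set (M := (N / 2)%nat).
  assert (HM : (2 * M <= N <= 2 * M + 1)%nat).
  { unfold M. pose proof (Nat.div_mod_eq N 2). pose proof (Nat.mod_upper_bound N 2). lia. }
  assert (H1 : psi K N - psi K M <= lfact N - 2 * lfact M).
  { rewrite (lfact_mangoldt K N), (lfact_mangoldt K M) by lia.
    unfold psi. rewrite <- rsum_minus, <- rsum_scal, <- rsum_minus. apply rsum_le.
    intros t Ht. pose proof (mangoldt_nonneg K t Ht). apply ppow_ge_2 in Ht.
    set (q := ppow t) in *.
    assert (upto N t - upto M t <= INR (N / q) - 2 * INR (M / q)); [|nra].
    unfold upto. fold q.
    assert (Hc : (2 * (M / q) <= N / q)%nat).
    { apply Nat.div_le_lower_bound; [lia|]. pose proof (Nat.Div0.mul_div_le M q). nia. }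
    assert (Hc' := le_INR _ _ Hc). rewrite mult_INR in Hc'. simpl (INR 2) in Hc'.
    destruct (Nat.leb_spec q N); destruct (Nat.leb_spec q M); try lra; try lia.
    rewrite (Nat.div_small M q) by lia. change (INR 0) with 0.
    assert (Hn1 : (1 <= N / q)%nat) by (apply Nat.div_le_lower_bound; lia).
    apply INR_pos in Hn1. lra. }
  assert (H2 : lfact N - 2 * lfact M <= 3 * INR N).
  { pose proof (lfact_central M) as HC. pose proof (pos_INR M).
    assert (E : N = (2 * M)%nat \/ N = S (2 * M)) by lia. destruct E as [E|E]; rewrite E.
    - rewrite mult_INR. simpl (INR 2). lra.
    - rewrite lfact_S, S_INR, mult_INR. change (INR 2) with 2.
      pose proof (ln_le_self (2 * INR M + 1) ltac:(lra)). lra. }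
  assert (H3 : psi K M <= 6 * INR M) by (apply IH; lia).
  assert (H4 : 2 * INR M <= INR N) by (apply (Rle_trans _ (INR (2 * M))); [rewrite mult_INR; simpl; lra|apply le_INR; lia]).
  lra.
Qed.

Definition mertens1 (K N : nat) : R :=
  rsum (prime_powers K) (fun t => mangoldt t / INR (ppow t) * upto N t).

Lemma INR_div_bounds N q : (1 <= q)%nat ->
  INR (N / q) <= INR N / INR q < INR (N / q) + 1.
Proof.
  intros Hq. assert (0 < INR q) by (apply lt_0_INR; lia).
  pose proof (Nat.div_mod_eq N q) as E. pose proof (Nat.mod_upper_bound N q ltac:(lia)) as B.
  apply (f_equal INR) in E. rewrite plus_INR, mult_INR in E. apply lt_INR in B.
  pose proof (pos_INR (N mod q)). split.
  - apply Rmult_le_reg_r with (INR q); auto. unfold Rdiv. rewrite Rmult_assoc, Rinv_l by lra. lra.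
  - apply Rmult_lt_reg_r with (INR q); auto. unfold Rdiv. rewrite Rmult_assoc, Rinv_l by lra. lra.
Qed.

(** Legendre's formula with the quotient N/q in place of its integer part: the change is at most
    psi(N) <= 6N, and ln N! lies between N ln N - N and N ln N. *)
Lemma mertens1_bounds K N : (1 <= N <= K)%nat ->
  ln (INR N) - 1 <= mertens1 K N <= ln (INR N) + 6.
Proof.
  intros HN. assert (H0 : 0 < INR N) by (apply lt_0_INR; lia).
  assert (HA : lfact N <= INR N * mertens1 K N).
  { rewrite (lfact_mangoldt K N) by lia. unfold mertens1. rewrite <- rsum_scal. apply rsum_le.
    intros t Ht. pose proof (mangoldt_nonneg K t Ht). apply ppow_ge_2 in Ht.
    set (q := ppow t) in *. unfold upto. fold q.
    destruct (INR_div_bounds N q) as [B _]; [lia|].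
    destruct (Nat.leb_spec q N).
    - replace (INR N * (mangoldt t / INR q * 1)) with (mangoldt t * (INR N / INR q)).
      + apply Rmult_le_compat_l; auto.
      + field. apply not_0_INR. lia.
    - rewrite Nat.div_small by lia. simpl. lra. }
  assert (HB : INR N * mertens1 K N <= lfact N + psi K N).
  { rewrite (lfact_mangoldt K N) by lia. unfold mertens1, psi. rewrite <- rsum_scal, <- rsum_plus. apply rsum_le.
    intros t Ht. pose proof (mangoldt_nonneg K t Ht). apply ppow_ge_2 in Ht.
    set (q := ppow t) in *. unfold upto. fold q.
    destruct (INR_div_bounds N q) as [_ B]; [lia|].
    destruct (Nat.leb_spec q N).
    - replace (INR N * (mangoldt t / INR q * 1)) with (mangoldt t * (INR N / INR q)).
      + rewrite <- Rmult_plus_distr_l. apply Rmult_le_compat_l; lra.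
      + field. apply not_0_INR. lia.
    - pose proof (pos_INR (N / q)). nra. }
  pose proof (psi_le K N ltac:(lia)). pose proof (lfact_lower N). pose proof (lfact_upper N ltac:(lia)).
  split; apply Rmult_le_reg_l with (INR N); auto; lra.
Qed.

(** * The character modulo 4 and its Mertens sum *)

Definition chi (n : nat) : R :=
  match (n mod 4)%nat with 1%nat => 1 | 3%nat => -1 | _ => 0 end.

Lemma chi_mul a b : chi (a * b) = chi a * chi b.
Proof.
  unfold chi. rewrite Nat.Div0.mul_mod.
  pose proof (Nat.mod_upper_bound a 4 ltac:(lia)). pose proof (Nat.mod_upper_bound b 4 ltac:(lia)).
  destruct (a mod 4)%nat as [|[|[|[|]]]]; destruct (b mod 4)%nat as [|[|[|[|]]]]; try lia; simpl; lra.
Qed.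

Lemma chi_abs n : -1 <= chi n <= 1.
Proof. unfold chi. destruct (n mod 4)%nat as [|[|[|[|]]]]; lra. Qed.

(* Partial summation against the summatory function of [chi], which is the indicator of n = 1, 2 mod 4. *)
Lemma chi_sum_bound (f : nat -> R) M N : (forall n, (M < n)%nat -> 0 <= f n) ->
  (forall n, (M < n)%nat -> f (S n) <= f n) ->
  Rabs (rsum (seq (S M) N) (fun n => chi n * f n)) <= f (S M).
Proof.
  intros H0 Hd.
  set (X := fun n => match (n mod 4)%nat with 1%nat | 2%nat => 1 | _ => 0 end).
  assert (HX : forall n, X n = 0 \/ X n = 1).
  { intros n. unfold X. destruct (n mod 4)%nat as [|[|[|]]]; auto. }
  assert (HS : forall n, chi (S n) = X (S n) - X n).
  { intros n. unfold chi, X. replace (S n) with (n + 1)%nat by lia. rewrite Nat.Div0.add_mod.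
    pose proof (Nat.mod_upper_bound n 4 ltac:(lia)).
    destruct (n mod 4)%nat as [|[|[|[|]]]]; try lia; simpl; lra. }
  destruct N as [|N]; [simpl; rewrite Rabs_R0; apply H0; lia|].
  (* Abel summation leaves the boundary terms and the sum of [X n * (f n - f (S n))], which lies
     between 0 and the telescoped difference of [f] because [X] is 0 or 1. *)
  assert (HI : forall N, - X M * f (S M) + X (S M + N)%nat * f (S M + N)%nat
                <= rsum (seq (S M) (S N)) (fun n => chi n * f n)
                <= (1 - X M) * f (S M) - (1 - X (S M + N)%nat) * f (S M + N)%nat).
  { clear N. induction N as [|N IH].
    - simpl rsum. rewrite Nat.add_0_r, HS. lra.
    - rewrite rsum_seq_S. replace (S M + S N)%nat with (S (S M + N)) by lia. rewrite HS.
      pose proof (Hd (S M + N)%nat ltac:(lia)). pose proof (H0 (S M + N)%nat ltac:(lia)).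
      pose proof (H0 (S (S M + N)) ltac:(lia)).
      destruct (HX (S M + N)%nat) as [E|E]; rewrite E in *; destruct (HX (S (S M + N))) as [E'|E']; rewrite E' in *; lra. }
  specialize (HI N). pose proof (H0 (S M) ltac:(lia)). pose proof (H0 (S M + N)%nat ltac:(lia)).
  apply Rabs_le.
  destruct (HX M) as [E|E]; rewrite E in *; destruct (HX (S M + N)%nat) as [E'|E']; rewrite E' in *; lra.
Qed.

(** Partial sums of the Leibniz series 1 - 1/3 + 1/5 - ..., whose limit is L(1, chi). *)
Definition chi_series (N : nat) : R := rsum (seq 1 N) (fun n => chi n * / INR n).

Lemma rsum_seq_split s n m f : rsum (seq s (n + m)) f = rsum (seq s n) f + rsum (seq (s + n) m) f.
Proof. rewrite seq_app, rsum_app. reflexivity. Qed.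

Lemma chi_series_tail M N : (M <= N)%nat -> Rabs (chi_series N - chi_series M) <= / INR (S M).
Proof.
  intros H. unfold chi_series. replace N with (M + (N - M))%nat by lia. rewrite rsum_seq_split.
  replace (rsum (seq 1 M) (fun n : nat => chi n * / INR n) +
    rsum (seq (1 + M) (N - M)) (fun n : nat => chi n * / INR n) -
    rsum (seq 1 M) (fun n : nat => chi n * / INR n)) with
    (rsum (seq (S M) (N - M)) (fun n : nat => chi n * / INR n)) by (simpl; lra).
  apply (chi_sum_bound (fun n => / INR n)).
  - intros n Hn. left. apply Rinv_0_lt_compat, lt_0_INR. lia.
  - intros n Hn. apply Rinv_le_contravar; [apply lt_0_INR; lia|apply le_INR; lia].
Qed.

(** The quantitative form of the nonvanishing of L(1, chi), by which [mertens_chi_bound] divides: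
    two terms give 1, and the tail is at most 1/3. *)
Lemma chi_series_lower N : (1 <= N)%nat -> 2 / 3 <= chi_series N.
Proof.
  intros H. destruct (Nat.le_gt_cases 2 N) as [H2|H2].
  - pose proof (chi_series_tail 2 N H2) as Ht.
    assert (E : chi_series 2 = 1). { unfold chi_series, chi. simpl. lra. }
    rewrite E in Ht. simpl INR in Ht. 
    assert (- (/ (1 + 1 + 1)) <= chi_series N - 1).
    { pose proof (Rle_abs (- (chi_series N - 1))) as Ha. rewrite Rabs_Ropp in Ha. lra. }
    lra.
  - assert (N = 1%nat) by lia. subst. unfold chi_series, chi. simpl. lra.
Qed.

(** ln n / n decreases only from n = 3 on; the terms n = 1, 2 vanish because ln 1 = 0 and chi 2 =
    0. *)
Lemma chi_log_bound N : Rabs (rsum (seq 1 N) (fun n => chi n * (ln (INR n) / INR n))) <= 1.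
Proof.
  destruct (Nat.le_gt_cases 2 N) as [H2|H2].
  - replace N with (2 + (N - 2))%nat by lia. rewrite rsum_seq_split.
    replace (rsum (seq 1 2) (fun n => chi n * (ln (INR n) / INR n))) with 0
      by (unfold chi; simpl; rewrite ln_1; lra).
    rewrite Rplus_0_l. eapply Rle_trans; [apply (chi_sum_bound (fun n => ln (INR n) / INR n) 2)|].
    + intros n Hn. apply Rmult_le_pos; [apply ln_nonneg, INR_pos; lia|].
      left. apply Rinv_0_lt_compat, lt_0_INR. lia.
    + intros n Hn. set (a := INR n). assert (Ha : 3 <= a).
      { unfold a. apply (le_INR 3) in Hn. simpl in Hn. lra. }
      rewrite S_INR. fold a.
      assert (H : ln (a + 1) - ln a <= 1 / a).
      { rewrite <- ln_div by lra. replace ((a + 1) / a) with (1 + 1 / a) by (field; lra).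
        assert (0 < 1 / a) by (apply Rdiv_lt_0_compat; lra). pose proof (ln_le_self (1 + 1 / a)). lra. }
      assert (H1 : 1 <= ln a).
      { rewrite <- (ln_exp 1). apply ln_le; [apply exp_pos|]. pose proof exp_le_3. lra. }
      apply (Rmult_le_compat_l a) in H; [|lra]. replace (a * (1 / a)) with 1 in H by (field; lra).
      apply Rmult_le_reg_r with (a * (a + 1)); [nra|].
      replace (ln (a + 1) / (a + 1) * (a * (a + 1))) with (a * ln (a + 1)) by (field; lra).
      replace (ln a / a * (a * (a + 1))) with ((a + 1) * ln a) by (field; lra). lra.
    + simpl INR. pose proof (ln_le_self (1 + 1 + 1)). lra.
  - destruct N as [|[|N]]; [simpl; rewrite Rabs_R0; lra| |lia].
    simpl. rewrite ln_1. replace (chi 1 * (0 / 1) + 0) with 0 by lra. rewrite Rabs_R0; lra.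
Qed.

Definition mertens_chi (K N : nat) : R :=
  rsum (prime_powers K) (fun t => chi (ppow t) * mangoldt t / INR (ppow t) * upto N t).

(** Expanding ln n and using multiplicativity turns the bounded sum of chi(n) ln n / n into the sum
    of chi(d) Lambda(d) / d times the partial sum of the Leibniz series up to N/d. Replacing each
    partial sum by [chi_series N] changes it by at most d/N, in total psi(N)/N <= 6. Hence 2/3 of
    the absolute value is at most 1 + 6. *)
Lemma mertens_chi_bound K N : (1 <= N <= K)%nat -> Rabs (mertens_chi K N) <= 12.
Proof.
  intros HN. assert (HN0 : 0 < INR N) by (apply lt_0_INR; lia).
  assert (E : rsum (seq 1 N) (fun n => chi n * (ln (INR n) / INR n)) =
    rsum (prime_powers K) (fun t => chi (ppow t) * mangoldt t / INR (ppow t) * chi_series (N / ppow t))).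
  { rewrite rsum_ext with (g := fun n => rsum (prime_powers K)
      (fun t => mangoldt t * (dvdr (ppow t) n * (chi n / INR n)))).
    - rewrite rsum_swap. apply rsum_ext. intros t Ht. apply ppow_ge_2 in Ht.
      rewrite rsum_scal, rsum_dvdr by lia. unfold chi_series. rewrite <- !rsum_scal.
      apply rsum_ext. intros m Hm. apply in_seq in Hm. rewrite chi_mul, mult_INR. field.
      split; apply not_0_INR; lia.
    - intros n Hn. apply in_seq in Hn. rewrite (ln_eq_sum_mangoldt K n) by lia.
      unfold Rdiv. rewrite (Rmult_comm (rsum _ _)), <- Rmult_assoc, <- rsum_scal. apply rsum_ext.
      intros; lra. }
  assert (D : Rabs (rsum (prime_powers K) (fun t => chi (ppow t) * mangoldt t / INR (ppow t) * chi_series (N / ppow t))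
     - chi_series N * mertens_chi K N) <= 6).
  { unfold mertens_chi. rewrite <- rsum_scal, <- rsum_minus.
    eapply Rle_trans; [apply rsum_abs|].
    apply Rle_trans with (/ INR N * psi K N).
    - unfold psi. rewrite <- rsum_scal. apply rsum_le. intros t Ht.
      pose proof (mangoldt_nonneg K t Ht). apply ppow_ge_2 in Ht. set (q := ppow t) in *.
      unfold upto. fold q. destruct (Nat.leb_spec q N) as [Hq|Hq].
      + replace (chi q * mangoldt t / INR q * chi_series (N / q) -
          chi_series N * (chi q * mangoldt t / INR q * 1))
        with (mangoldt t * (chi q * (/ INR q * (- (chi_series N - chi_series (N / q))))))
        by (unfold Rdiv; ring).
        rewrite !Rabs_mult, Rabs_Ropp.
        rewrite (Rabs_right (mangoldt t)) by lra.
        rewrite Rmult_1_r, (Rmult_comm (/ INR N)).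
        apply Rmult_le_compat_l; auto.
        assert (H1 : Rabs (chi q) <= 1) by (apply Rabs_le; pose proof (chi_abs q); lra).
        assert (Hq0 : 0 < INR q) by (apply lt_0_INR; lia).
        assert (Hi : 0 < / INR q) by (apply Rinv_0_lt_compat; auto).
        rewrite (Rabs_right (/ INR q)) by lra.
        assert (Ht2 := chi_series_tail (N / q) N ltac:(apply Nat.Div0.div_le_upper_bound; nia)).
        destruct (INR_div_bounds N q) as [_ B]; [lia|]. rewrite <- S_INR in B.
        assert (H2 : / INR (S (N / q)) <= / (INR N / INR q)).
        { apply Rinv_le_contravar; [|lra]. apply Rdiv_lt_0_compat; lra. }
        assert (H3 : / INR q * / (INR N / INR q) = / INR N) by (field; lra).
        rewrite <- H3.
        set (d := Rabs (chi_series N - chi_series (N / q))) in *.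
        assert (0 <= d) by apply Rabs_pos.
        apply Rle_trans with (1 * (/ INR q * d)); [apply Rmult_le_compat_r; [nra|auto]|].
        rewrite Rmult_1_l. apply Rmult_le_compat_l; lra.
      + rewrite Nat.div_small by lia. unfold chi_series at 1. simpl seq. simpl rsum.
        rewrite !Rmult_0_r, Rminus_0_r, Rabs_R0. lra.
    - apply Rmult_le_reg_l with (INR N); auto. rewrite <- Rmult_assoc, Rinv_r by lra.
      pose proof (psi_le K N ltac:(lia)). lra. }
  rewrite <- E in D. pose proof (chi_log_bound N) as G. pose proof (chi_series_lower N ltac:(lia)) as L.
  set (s := chi_series N) in *. set (m := mertens_chi K N) in *.
  assert (Rabs (s * m) <= 7).
  { set (g := rsum _ _) in *. replace (s * m) with (g + - (g - s * m)) by ring.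
    eapply Rle_trans; [apply Rabs_triang|]. rewrite Rabs_Ropp. lra. }
  rewrite Rabs_mult, (Rabs_right s) in H by lra. pose proof (Rabs_pos m). nra.
Qed.

Definition log_weight_3 (p : nat) : R :=
  if (primeb p && (p mod 4 =? 3)%nat)%bool then ln (INR p) / INR p else 0.

(* The weights (1 - chi)/2 isolate p = 3 mod 4, and prime powers may be discarded since they only help an upper bound. *)
Lemma log_weight_3_sum u v : (1 <= u <= v)%nat ->
  rsum (seq (S u) (v - u)) log_weight_3 <= / 2 * (ln (INR v) - ln (INR u)) + 16.
Proof.
  intros Huv.
  set (wt := fun t => (1 - chi (ppow t)) / 2 * mangoldt t / INR (ppow t)).
  assert (H1 : rsum (prime_powers v) (fun t => wt t * (upto v t - upto u t)) =
     / 2 * (mertens1 v v - mertens1 v u) - / 2 * (mertens_chi v v - mertens_chi v u)).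
  { unfold mertens1, mertens_chi. rewrite <- !rsum_minus, <- !rsum_scal, <- rsum_minus.
    apply rsum_ext. intros t _. unfold wt. unfold Rdiv. ring. }
  assert (H2 : rsum (seq (S u) (v - u)) log_weight_3 <= rsum (prime_powers v) (fun t => wt t * (upto v t - upto u t))).
  { assert (Hnn : forall t, In t (prime_powers v) -> 0 <= wt t * (upto v t - upto u t)).
    { intros t Ht. pose proof (mangoldt_nonneg v t Ht). apply ppow_ge_2 in Ht.
      apply Rmult_le_pos.
      - unfold wt. pose proof (chi_abs (ppow t)).
        apply Rmult_le_pos; [apply Rmult_le_pos; lra|]. left. apply Rinv_0_lt_compat, lt_0_INR. lia.
      - unfold upto. destruct (Nat.leb_spec (ppow t) v); destruct (Nat.leb_spec (ppow t) u); try lra; lia. }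
    unfold prime_powers in *. rewrite rsum_list_prod.
    apply Rle_trans with (rsum (filter primeb (seq 1 v)) (fun p => wt (p, 1%nat) * (upto v (p, 1%nat) - upto u (p, 1%nat)))).
    - rewrite rsum_filter. replace (seq 1 v) with (seq 1 (u + (v - u))) by (f_equal; lia).
      rewrite rsum_seq_split. replace (1 + u)%nat with (S u) by lia.
      apply Rle_trans with (0 + rsum (seq (S u) (v - u)) log_weight_3); [lra|].
      apply Rplus_le_compat.
      + apply rsum_nonneg. intros p Hp. destruct (primeb p) eqn:Ep; [|lra].
        apply Hnn. apply in_prod_iff. rewrite filter_In. rewrite in_seq in *. repeat split; auto; try lia.
        apply in_seq; lia.
      + apply rsum_le. intros p Hp. apply in_seq in Hp. unfold log_weight_3.
        destruct (primeb p) eqn:Ep; cbn [andb]; [|lra].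
        unfold wt, upto, mangoldt, ppow, chi. simpl fst; simpl snd. rewrite Nat.pow_1_r.
        destruct (Nat.leb_spec p v); [|lia]. destruct (Nat.leb_spec p u); [lia|].
        assert (0 <= ln (INR p)) by (apply ln_nonneg, INR_pos; lia).
        assert (0 < / INR p) by (apply Rinv_0_lt_compat, lt_0_INR; lia).
        pose proof (Nat.mod_upper_bound p 4 ltac:(lia)).
        destruct (p mod 4)%nat as [|[|[|[|]]]]; simpl; unfold Rdiv; try lia;
          assert (0 <= ln (INR p) * / INR p) by nra; lra.
    - apply rsum_le. intros p Hp.
      apply (rsum_mem (seq 1 v) (fun a => wt (p, a) * (upto v (p, a) - upto u (p, a))) 1%nat).
      + intros a Ha. apply Hnn. apply in_prod_iff; auto.
      + apply in_seq; lia. }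
  (* The error is half of 6 + 1 from the sums without character and of 12 + 12 from those with it,
     which is below 16. *)
  rewrite H1 in H2.
  pose proof (mertens1_bounds v v ltac:(lia)). pose proof (mertens1_bounds v u ltac:(lia)).
  pose proof (mertens_chi_bound v v ltac:(lia)) as B1. pose proof (mertens_chi_bound v u ltac:(lia)) as B2.
 
  assert (- mertens_chi v v <= 12) by (eapply Rle_trans; [apply Rle_abs|]; rewrite Rabs_Ropp; auto).
  assert (mertens_chi v u <= 12) by (eapply Rle_trans; [apply Rle_abs|]; auto).
  lra.
Qed.

(** * Reciprocals of primes congruent to 3 modulo 4 *)

Lemma ln_diff_le a b : 0 < a -> 0 < b -> ln b - ln a <= (b - a) / a.
Proof.
  intros Ha Hb. rewrite <- ln_div by lra. pose proof (ln_le_self (b / a) ltac:(apply Rdiv_lt_0_compat; lra)).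
  replace ((b - a) / a) with (b / a - 1) by (field; lra). lra.
Qed.

(* Partial summation; the invariant compares the sum with [B v = ln(v/u)/2 + C], an upper bound for the summatory function of [a]. *)
Lemma partial_summation_log (a : nat -> R) (C : R) (u : nat) : (2 <= u)%nat ->
  (forall v, (u <= v)%nat -> rsum (seq (S u) (v - u)) a <= / 2 * (ln (INR v) - ln (INR u)) + C) ->
  forall v, (u <= v)%nat ->
  rsum (seq (S u) (v - u)) (fun n => a n / ln (INR n)) <=
    / 2 * (ln (ln (INR v)) - ln (ln (INR u))) + C / ln (INR u).
Proof.
  intros Hu HA.
  assert (Hln : forall n, (u <= n)%nat -> 0 < ln (INR n)).
  { intros n Hn. rewrite <- ln_1. apply ln_increasing; [lra|]. apply (lt_INR 1); lia. }
  assert (HI : forall d, 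
    rsum (seq (S u) d) (fun n => a n / ln (INR n)) +
      (/ 2 * (ln (INR (u + d)) - ln (INR u)) + C - rsum (seq (S u) d) a) / ln (INR (u + d))
     <= / 2 * (ln (ln (INR (u + d))) - ln (ln (INR u))) + C / ln (INR u)).
  { induction d as [|d IH].
    - simpl. rewrite Nat.add_0_r. unfold Rdiv. right. ring.
    - rewrite !rsum_seq_S. replace (S u + d)%nat with (u + S d)%nat by lia.
      specialize (HA (u + d)%nat ltac:(lia)). replace (u + d - u)%nat with d in HA by lia.
      set (P := rsum (seq (S u) d) a) in *. set (Q := rsum (seq (S u) d) (fun n => a n / ln (INR n))) in *.
      assert (L1 := Hln (u + d)%nat ltac:(lia)). assert (L2 := Hln (u + S d)%nat ltac:(lia)).
      assert (L12 : ln (INR (u + d)) <= ln (INR (u + S d))).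
      { apply ln_le; [apply lt_0_INR; lia|apply le_INR; lia]. }
      set (s := ln (INR (u + S d))) in *. set (t := ln (INR (u + d))) in *.
      set (w := a (u + S d)%nat). set (l0 := ln (INR u)) in *.
      pose proof (ln_diff_le s t L2 L1) as Hd.
      set (B := / 2 * (t - l0) + C - P) in *. assert (HB : 0 <= B) by (unfold B; lra).
      assert (HB2 : B / s <= B / t).
      { apply Rmult_le_compat_l; auto. apply Rinv_le_contravar; auto. }
      replace (Q + w / s + (/ 2 * (s - l0) + C - (P + w)) / s) with
        (Q + B / s - / 2 * ((t - s) / s)) by (unfold B; field; lra).
      lra. }
  intros v Hv. specialize (HI (v - u)%nat). specialize (HA v Hv). replace (u + (v - u))%nat with v in HI by lia.
  set (Z := (_ - rsum _ a) / ln (INR v)) in HI.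
  assert (0 <= Z).
  { unfold Z. apply Rmult_le_pos; [lra|]. left. apply Rinv_0_lt_compat, Hln; auto. }
  lra.
Qed.

Definition prime3b (u v : R) (n : nat) : bool :=
  (primeb n && (n mod 4 =? 3)%nat &&
  (if Rlt_dec u (INR n) then true else false) && (if Rle_dec (INR n) v then true else false))%bool.

Definition primes3 (u v : R) : list Z :=
  map Z.of_nat (filter (prime3b u v) (seq 1 (Z.to_nat (up v)))).

Lemma in_primes3 u v p : In p (primes3 u v) <->
  prime p /\ (p mod 4 = 3)%Z /\ u < IZR p /\ IZR p <= v.
Proof.
  unfold primes3, prime3b. rewrite in_map_iff. split.
  - intros (n & <- & H). apply filter_In in H. destruct H as [Hs H].
    apply andb_prop in H. destruct H as [H H3]. apply andb_prop in H. destruct H as [H H2].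
    apply andb_prop in H. destruct H as [H H1].
    apply primeb_spec in H. apply Nat.eqb_eq in H1.
    rewrite <- INR_IZR_INZ. destruct Rlt_dec; [|discriminate]. destruct Rle_dec; [|discriminate].
    split; [exact H|]. split; [|lra].
    change 4%Z with (Z.of_nat 4). rewrite <- Nat2Z.inj_mod, H1. reflexivity.
  - intros (Hp & Hm & H1 & H2). assert (1 < p)%Z by (destruct Hp; auto).
    exists (Z.to_nat p). rewrite Z2Nat.id by lia. split; auto.
    assert (E : INR (Z.to_nat p) = IZR p) by (rewrite INR_IZR_INZ, Z2Nat.id by lia; auto).
    apply filter_In. split.
    + apply in_seq. destruct (archimed v) as [Ha _].
      assert (p < up v)%Z by (apply lt_IZR; lra). lia.
    + rewrite E. destruct Rlt_dec; [|lra]. destruct Rle_dec; [|lra]. rewrite !Bool.andb_true_r.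
      apply andb_true_intro. split.
      * apply primeb_spec. rewrite Z2Nat.id by lia. auto.
      * apply Nat.eqb_eq. apply Nat2Z.inj. rewrite Nat2Z.inj_mod, Z2Nat.id by lia. exact Hm.
Qed.

Lemma NoDup_primes3 u v : NoDup (primes3 u v).
Proof.
  apply Injective_map_NoDup; [intros i j; lia|]. apply NoDup_filter, seq_NoDup.
Qed.

Lemma nat_floor x : 0 <= x -> exists n : nat, INR n <= x < INR n + 1.
Proof.
  intros Hx. destruct (archimed x) as [H1 H2].
  assert (0 < up x)%Z by (apply lt_IZR; lra).
  exists (Z.to_nat (up x - 1)). rewrite INR_IZR_INZ, Z2Nat.id by lia. rewrite minus_IZR. lra.
Qed.

(** Partial summation removes the factor ln p. The rest is the passage from integer parts to real
    endpoints: replacing [u'] by [u] at most doubles 16 / ln u', and the change of ln ln u costs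
    less than 1 / ln u. The constant 40 covers both. *)
Theorem mertens_primes3 u v : 4 <= u -> u <= v ->
  rsum (primes3 u v) (fun p => / IZR p) <= / 2 * (ln (ln v) - ln (ln u)) + 40 / ln u.
Proof.
  intros Hu Huv.
  destruct (nat_floor u) as [u' Hu']; [lra|]. destruct (nat_floor v) as [v' Hv']; [lra|].
  assert (Hu4 : (4 <= u')%nat).
  { assert (3 < u')%nat; [|lia]. apply INR_lt. simpl. lra. }
  assert (Huv' : (u' <= v')%nat).
  { assert (u' < S v')%nat; [|lia]. apply INR_lt. rewrite S_INR. lra. }
  set (a := fun n => log_weight_3 n / ln (INR n)).
  assert (H1 : rsum (primes3 u v) (fun p => / IZR p) <= rsum (seq (S u') (v' - u')) a).
  { unfold primes3. rewrite rsum_map.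
    assert (Hup : Z.to_nat (up v) = S v').
    { destruct (archimed v) as [A1 A2]. apply Nat2Z.inj. 
      assert (0 < up v)%Z by (apply lt_IZR; lra). rewrite Z2Nat.id by lia.
      assert (Z.of_nat v' < up v)%Z by (apply lt_IZR; rewrite <- INR_IZR_INZ; lra).
      assert (up v < Z.of_nat v' + 2)%Z by (apply lt_IZR; rewrite plus_IZR, <- INR_IZR_INZ; lra). lia. }
    rewrite Hup, rsum_filter. replace (S v') with (u' + (v' - u') + 1)%nat by lia.
    rewrite !rsum_seq_split. replace (1 + u')%nat with (S u') by lia.
    assert (E1 : rsum (seq 1 u') (fun n => if prime3b u v n then / IZR (Z.of_nat n) else 0) = 0).
    { rewrite rsum_ext with (g := fun _ => 0); [rewrite rsum_const; lra|].
      intros n Hn. apply in_seq in Hn. unfold prime3b. destruct (Rlt_dec u (INR n)).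
      - exfalso. assert (INR n <= INR u') by (apply le_INR; lia). lra.
      - rewrite Bool.andb_false_r. reflexivity. }
    assert (E2 : rsum (seq (1 + (u' + (v' - u'))) 1) (fun n => if prime3b u v n then / IZR (Z.of_nat n) else 0) = 0).
    { rewrite rsum_ext with (g := fun _ => 0); [rewrite rsum_const; lra|].
      intros n Hn. apply in_seq in Hn. unfold prime3b. destruct (Rle_dec (INR n) v).
      - exfalso. assert (INR (S v') <= INR n) by (apply le_INR; lia). rewrite S_INR in *. lra.
      - rewrite Bool.andb_false_r. reflexivity. }
    rewrite E1, E2. rewrite Rplus_0_l, Rplus_0_r. apply rsum_le.
    intros n Hn. apply in_seq in Hn. unfold a, log_weight_3, prime3b. rewrite <- INR_IZR_INZ.
    assert (0 < ln (INR n)) by (rewrite <- ln_1; apply ln_increasing; [lra|apply (lt_INR 1); lia]).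
    assert (0 < INR n) by (apply lt_0_INR; lia).
    destruct (primeb n && (n mod 4 =? 3)%nat)%bool; simpl.
    - replace (ln (INR n) / INR n / ln (INR n)) with (/ INR n) by (field; lra).
      assert (0 < / INR n) by (apply Rinv_0_lt_compat; auto).
      destruct (_ && _)%bool; lra.
    - lra. }
  assert (H2 := partial_summation_log log_weight_3 16 u' ltac:(lia)
     (fun v Hv => log_weight_3_sum u' v ltac:(lia)) v' Huv').
  fold a in H2.
  assert (HU : 4 <= INR u') by (apply (le_INR 4) in Hu4; simpl in Hu4; lra).
  assert (Hv1 : ln (ln (INR v')) <= ln (ln v)).
  { apply le_INR in Huv'. assert (0 < ln (INR v')) by (rewrite <- ln_1; apply ln_increasing; lra).
    apply ln_le; auto. apply ln_le; lra. }
  assert (Hlu : 0 < ln (INR u')) by (rewrite <- ln_1; apply ln_increasing; lra).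
  assert (Hlu2 : 0 < ln u) by (rewrite <- ln_1; apply ln_increasing; lra).
  assert (Hln : ln u - ln (INR u') <= / 4).
  { eapply Rle_trans; [apply ln_diff_le; lra|].
    apply Rmult_le_reg_r with (INR u'); [lra|]. unfold Rdiv. rewrite Rmult_assoc, Rinv_l; lra. }
  assert (H4 : 1 <= ln u).
  { rewrite <- (ln_exp 1). apply ln_le; [apply exp_pos|]. pose proof exp_le_3. lra. }
  assert (Hd := ln_diff_le (ln (INR u')) (ln u) Hlu Hlu2).
  assert (Hi : / ln (INR u') <= 2 / ln u).
  { replace (2 / ln u) with (/ (ln u / 2)) by (field; lra). apply Rinv_le_contravar; lra. }
  assert (Hd2 : ln (ln u) - ln (ln (INR u')) <= / 4 * (2 / ln u)).
  { eapply Rle_trans; [apply Hd|]. assert (0 < / ln (INR u')) by (apply Rinv_0_lt_compat; auto).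
    unfold Rdiv at 1. apply Rle_trans with (/ 4 * / ln (INR u')); nra. }
  assert (Hj : 0 < / ln u) by (apply Rinv_0_lt_compat; auto).
  unfold Rdiv in *. lra.
Qed.

(** * The Brun-Hooley sieve *)

Definition res (q r n : Z) : R := if Zdivide_dec q (n - r) then 1 else 0.

(* Quantifying over all moduli q coprime to Q makes the notion stable under imposing a condition modulo a new prime p: replace q by q p. *)
Definition equid (A : Z) (N : nat) (Q : list Z) (G : Z -> R) (M E : R) : Prop :=
  forall q r, (0 < q)%Z -> (forall p, In p Q -> rel_prime q p) ->
  Rabs (rsum (zints A N) (fun n => res q r n * G n) - INR N / IZR q * M) <= E.

Lemma zints_S A N : zints A (S N) = zints A N ++ [(A + Z.of_nat N)%Z].
Proof. unfold zints. rewrite seq_S, map_app. reflexivity. Qed.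

Lemma res_sum A N q r : (0 < q)%Z ->
  rsum (zints A N) (res q r) = IZR ((A + Z.of_nat N - 1 - r) / q - (A - 1 - r) / q).
Proof.
  intros Hq. induction N as [|N IH].
  - simpl rsum. replace (A + Z.of_nat 0 - 1 - r)%Z with (A - 1 - r)%Z by lia. rewrite Z.sub_diag. reflexivity.
  - rewrite zints_S, rsum_app, IH. simpl rsum. set (m := (A + Z.of_nat N)%Z).
    replace (A + Z.of_nat (S N) - 1 - r)%Z with (m - r)%Z by lia.
    replace (m - 1 - r)%Z with (m - r - 1)%Z by lia.
    unfold res. pose proof (Z.div_mod (m - r) q ltac:(lia)) as E.
    pose proof (Z.mod_pos_bound (m - r) q Hq) as B.
    destruct (Zdivide_dec q (m - r)) as [D|D].
    + apply Z.mod_divide in D; [|lia].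
      assert (H1 : ((m - r - 1) / q = (m - r) / q - 1)%Z) by (symmetry; apply Z.div_unique with (q - 1)%Z; lia).
      rewrite H1, !minus_IZR. lra.
    + assert ((m - r) mod q <> 0)%Z by (intros H; apply D, Z.mod_divide; lia).
      assert (H1 : ((m - r - 1) / q = (m - r) / q)%Z) by (symmetry; apply Z.div_unique with ((m - r) mod q - 1)%Z; lia).
      rewrite H1. lra.
Qed.

Lemma equid_one A N Q : equid A N Q (fun _ => 1) 1 1.
Proof.
  intros q r Hq _. rewrite rsum_ext with (g := res q r) by (intros; ring). rewrite res_sum by auto.
  set (a := (A + Z.of_nat N - 1 - r)%Z). set (b := (A - 1 - r)%Z).
  assert (HN : INR N = IZR a - IZR b).
  { rewrite INR_IZR_INZ, <- minus_IZR. f_equal. unfold a, b. lia. }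
  rewrite HN. rewrite minus_IZR.
  assert (Hq0 : 0 < IZR q) by (apply (IZR_lt 0); auto).
  assert (Hdiv : forall c, IZR c / IZR q - 1 <= IZR (c / q) <= IZR c / IZR q).
  { intros c. pose proof (Z.div_mod c q ltac:(lia)) as E. pose proof (Z.mod_pos_bound c q Hq) as B.
    apply (f_equal IZR) in E. rewrite plus_IZR, mult_IZR in E.
    destruct B as [B1 B2]. apply IZR_le in B1. apply IZR_lt in B2.
    rewrite E. replace ((IZR q * IZR (c / q) + IZR (c mod q)) / IZR q) with (IZR (c / q) + IZR (c mod q) / IZR q) by (field; lra).
    assert (0 <= IZR (c mod q) / IZR q <= 1); [|lra]. split.
    - apply Rmult_le_pos; auto. left; apply Rinv_0_lt_compat; auto.
    - apply Rmult_le_reg_r with (IZR q); auto. unfold Rdiv. rewrite Rmult_assoc, Rinv_l; lra. }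
  pose proof (Hdiv a). pose proof (Hdiv b). apply Rabs_le. unfold Rdiv in *. lra.
Qed.

Lemma equid_ext A N Q G G' M E : equid A N Q G M E -> (forall n, G n = G' n) -> equid A N Q G' M E.
Proof.
  intros H He q r Hq Hc. rewrite rsum_ext with (g := fun n => res q r n * G n) by (intros; rewrite He; auto). auto.
Qed.

Lemma equid_weaken A N Q Q' G M E E' : equid A N Q G M E -> incl Q Q' -> E <= E' -> equid A N Q' G M E'.
Proof. intros H Hi HE q r Hq Hc. eapply Rle_trans; [apply H; auto|auto]. Qed.

Lemma equid_plus A N Q G1 G2 M1 M2 E1 E2 : equid A N Q G1 M1 E1 -> equid A N Q G2 M2 E2 ->
  equid A N Q (fun n => G1 n + G2 n) (M1 + M2) (E1 + E2).
Proof.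
  intros H1 H2 q r Hq Hc. specialize (H1 q r Hq Hc). specialize (H2 q r Hq Hc).
  rewrite rsum_ext with (g := fun n => res q r n * G1 n + res q r n * G2 n) by (intros; ring).
  rewrite rsum_plus. eapply Rle_trans; [|apply Rplus_le_compat; [exact H1|exact H2]].
  eapply Rle_trans; [|apply Rabs_triang]. right. f_equal. ring.
Qed.

Lemma equid_minus A N Q G1 G2 M1 M2 E1 E2 : equid A N Q G1 M1 E1 -> equid A N Q G2 M2 E2 ->
  equid A N Q (fun n => G1 n - G2 n) (M1 - M2) (E1 + E2).
Proof.
  intros H1 H2. apply equid_ext with (fun n => G1 n + (- G2 n)); [|intros; ring].
  unfold Rminus. apply equid_plus; auto.
  intros q r Hq Hc. specialize (H2 q r Hq Hc).
  rewrite rsum_ext with (g := fun n => - 1 * (res q r n * G2 n)) by (intros; ring).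
  rewrite rsum_scal, <- Rabs_Ropp. eapply Rle_trans; [|exact H2]. right. f_equal. ring.
Qed.

Lemma equid_zero A N Q : equid A N Q (fun _ => 0) 0 0.
Proof.
  intros q r Hq Hc. rewrite rsum_ext with (g := fun _ => 0) by (intros; ring).
  rewrite rsum_const. replace (0 * INR (length (zints A N)) - INR N / IZR q * 0) with 0 by ring.
  rewrite Rabs_R0; lra.
Qed.

Lemma crt2 q p r c : rel_prime q p -> exists s, (q | s - r)%Z /\ (p | s - c)%Z.
Proof.
  intros Hr. destruct (rel_prime_bezout _ _ Hr) as [u v Huv].
  exists (r * (v * p) + c * (u * q))%Z. split.
  - exists (u * (c - r))%Z. replace (v * p)%Z with (1 - u * q)%Z by lia. ring.
  - exists (v * (r - c))%Z. replace (u * q)%Z with (1 - v * p)%Z by lia. ring.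
Qed.

Lemma res_mul q p r c : rel_prime q p -> exists s, forall n, res q r n * res p c n = res (q * p) s n.
Proof.
  intros Hr. destruct (crt2 q p r c Hr) as (s & [u Hu] & [v Hv]). exists s. intros n. unfold res.
  destruct (Zdivide_dec (q * p) (n - s)) as [[d Hd]|D].
  - destruct (Zdivide_dec q (n - r)) as [D1|D1]; [|exfalso; apply D1; exists (d * p + u)%Z; lia].
    destruct (Zdivide_dec p (n - c)) as [D2|D2]; [lra|exfalso; apply D2; exists (d * q + v)%Z; lia].
  - destruct (Zdivide_dec q (n - r)) as [[d1 Hd1]|D1]; [|lra].
    destruct (Zdivide_dec p (n - c)) as [[d2 Hd2]|D2]; [|lra].
    exfalso. apply D. assert (He : (n - s = q * (d1 - u))%Z) by lia.
    assert (Hp : (p | q * (d1 - u))%Z) by (rewrite <- He; exists (d2 - v)%Z; lia).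
    apply Gauss in Hp; [|apply rel_prime_sym; auto]. destruct Hp as [f Hf]. exists f. rewrite He, Hf. ring.
Qed.

Section Roots.
Variables (A : Z) (N : nat) (rts : Z -> list Z).

(** The sieve knows a prime only through a list of forbidden residue classes, so the zeros of all
    forms can be used at one prime and those of a single form at another. *)
Definition hits (p n : Z) : R := rsum (rts p) (fun c => res p c n).
Definition rho (p : Z) : R := INR (length (rts p)).
Definition dens (p : Z) : R := rho p / IZR p.

Lemma rho_nonneg p : 0 <= rho p.
Proof. apply pos_INR. Qed.

Lemma dens_nonneg p : prime p -> 0 <= dens p.
Proof.
  intros [Hp _]. apply Rmult_le_pos; [apply rho_nonneg|]. left. apply Rinv_0_lt_compat, (IZR_lt 0). lia.
Qed.

(** Each forbidden class modulo [p] merges with the class modulo [q] into one class modulo [q * p],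
    to which the hypothesis on [G] applies; the [rho p] classes cost one error [E] each. *)
Lemma equid_hits Q p G M E : prime p -> (forall q, In q Q -> rel_prime p q) ->
  equid A N Q G M E ->
  equid A N (p :: Q) (fun n => hits p n * G n) (dens p * M) (rho p * E).
Proof.
  intros Hp HQ H q r Hq Hc. assert (Hp0 : (1 < p)%Z) by (destruct Hp; auto).
  assert (Hqp : rel_prime q p) by (apply Hc; simpl; auto).
  unfold hits, dens, rho.
  rewrite rsum_ext with (g := fun n => rsum (rts p) (fun c => (res q r n * res p c n) * G n)).
  2:{ intros n _. transitivity ((res q r n * G n) * rsum (rts p) (fun c => res p c n)); [ring|].
      rewrite <- rsum_scal. apply rsum_ext. intros; ring. }
  rewrite rsum_swap.
  replace (INR N / IZR q * (INR (length (rts p)) / IZR p * M)) with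
    (rsum (rts p) (fun _ => INR N / IZR (q * p) * M)).
  2:{ rewrite rsum_const, mult_IZR. field. split; apply not_0_IZR; lia. }
  rewrite <- rsum_minus. eapply Rle_trans; [apply rsum_abs|].
  apply Rle_trans with (rsum (rts p) (fun _ => E)); [|rewrite rsum_const; lra].
  apply rsum_le. intros c _. destruct (res_mul q p r c Hqp) as [s Hs].
  rewrite rsum_ext with (g := fun n => res (q * p) s n * G n) by (intros; rewrite Hs; auto).
  apply H; [nia|]. intros p' Hp'. apply rel_prime_sym, rel_prime_mult; apply rel_prime_sym; auto.
  apply Hc. simpl; auto.
Qed.

(** Inclusion-exclusion cut after [b] factors: the sum of (-1)^m e_m(l) over m <= b, with e_m the
    elementary symmetric polynomials. [tieabs] is the same sum without signs, and [esym] is e_b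
    alone. *)
Fixpoint tie (l : list R) (b : nat) : R :=
  match l, b with
  | x :: l', S b' => tie l' b - x * tie l' b'
  | _, _ => 1
  end.

Fixpoint tieabs (l : list R) (b : nat) : R :=
  match l, b with
  | x :: l', S b' => tieabs l' b + x * tieabs l' b'
  | _, _ => 1
  end.

Fixpoint esym (l : list R) (b : nat) : R :=
  match l, b with
  | x :: l', S b' => esym l' b + x * esym l' b'
  | _, O => 1
  | [], S _ => 0
  end.

Definition vprod (l : list R) : R := fold_right (fun x v => (1 - x) * v) 1 l.
Definition lsum (l : list R) : R := rsum l (fun x => x).

Definition good_primes (l : list Z) : Prop := NoDup l /\ forall p, In p l -> prime p.

Lemma good_primes_rel B Q p : good_primes (p :: B ++ Q) -> forall q, In q (B ++ Q) -> rel_prime p q.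
Proof.
  intros [Hnd Hp] q Hq. inversion Hnd; subst.
  apply prime_rel_prime; [apply Hp; simpl; auto|]. intros Hd.
  assert (Pp : prime p) by (apply Hp; simpl; auto). assert (Pq : prime q) by (apply Hp; simpl; auto).
  destruct Pp as [? _]. destruct (prime_divisors q Pq p Hd) as [?|[?|[?|?]]]; try lia; [|destruct Pq; lia].
  subst. tauto.
Qed.

Lemma good_primes_cons B Q p : good_primes (p :: B ++ Q) -> good_primes (B ++ Q).
Proof. intros [Hnd Hp]. inversion Hnd; subst. split; auto. intros q Hq; apply Hp; simpl; auto. Qed.

(** The recursion of [tie] is linear in each entry. One polynomial therefore serves three times: at
    the hits it is the weight, at the densities its mean, and without signs at the numbers of roots
    its error. *)
Lemma equid_tie B : forall b Q G M E, good_primes (B ++ Q) -> 0 <= E -> equid A N Q G M E ->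
  equid A N (B ++ Q) (fun n => tie (map (fun p => hits p n) B) b * G n)
    (tie (map dens B) b * M) (tieabs (map rho B) b * E).
Proof.
  induction B as [|p B IH]; intros b Q G M E Hg HE H.
  - simpl. destruct b; rewrite !Rmult_1_l; (apply equid_ext with G; [exact H|intros; ring]).
  - destruct b as [|b].
    + simpl. rewrite !Rmult_1_l. apply equid_weaken with Q E; [|apply incl_tl, incl_appr, incl_refl|lra].
      (apply equid_ext with G; [exact H|intros; ring]).
    + simpl map. cbn [tie tieabs]. simpl app in *.
      assert (Hg' := good_primes_cons _ _ _ Hg).
      assert (H1 := IH (S b) Q G M E Hg' HE H). assert (H2 := IH b Q G M E Hg' HE H).
      apply (equid_hits _ p) in H2; [|apply Hg; simpl; auto|apply good_primes_rel; auto].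
      apply (fun H => equid_weaken _ _ _ (p :: B ++ Q) _ _ _ _ H (incl_tl _ (incl_refl _)) (Rle_refl _)) in H1.
      assert (H3 := equid_minus _ _ _ _ _ _ _ _ _ H1 H2).
      replace ((tie (map dens B) (S b) - dens p * tie (map dens B) b) * M) with
        (tie (map dens B) (S b) * M - dens p * (tie (map dens B) b * M)) by ring.
      replace ((tieabs (map rho B) (S b) + rho p * tieabs (map rho B) b) * E) with
        (tieabs (map rho B) (S b) * E + rho p * (tieabs (map rho B) b * E)) by ring.
      eapply equid_ext; [exact H3|]. intros n. cbv beta. ring.
Qed.

Lemma equid_esym B : forall b Q G M E, good_primes (B ++ Q) -> 0 <= E -> equid A N Q G M E ->
  equid A N (B ++ Q) (fun n => esym (map (fun p => hits p n) B) b * G n)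
    (esym (map dens B) b * M) (esym (map rho B) b * E).
Proof.
  induction B as [|p B IH]; intros b Q G M E Hg HE H.
  - simpl. destruct b; simpl.
    + rewrite !Rmult_1_l; (apply equid_ext with G; [exact H|intros; ring]).
    + rewrite !Rmult_0_l. apply equid_ext with (fun _ => 0); [apply equid_zero|intros; ring].
  - destruct b as [|b].
    + simpl. rewrite !Rmult_1_l. apply equid_weaken with Q E; [|apply incl_tl, incl_appr, incl_refl|lra].
      (apply equid_ext with G; [exact H|intros; ring]).
    + simpl map. cbn [esym]. simpl app in *.
      assert (Hg' := good_primes_cons _ _ _ Hg).
      assert (H1 := IH (S b) Q G M E Hg' HE H). assert (H2 := IH b Q G M E Hg' HE H).
      apply (equid_hits _ p) in H2; [|apply Hg; simpl; auto|apply good_primes_rel; auto].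
      apply (fun H => equid_weaken _ _ _ (p :: B ++ Q) _ _ _ _ H (incl_tl _ (incl_refl _)) (Rle_refl _)) in H1.
      assert (H3 := equid_plus _ _ _ _ _ _ _ _ _ H1 H2).
      replace ((esym (map dens B) (S b) + dens p * esym (map dens B) b) * M) with
        (esym (map dens B) (S b) * M + dens p * (esym (map dens B) b * M)) by ring.
      replace ((esym (map rho B) (S b) + rho p * esym (map rho B) b) * E) with
        (esym (map rho B) (S b) * E + rho p * (esym (map rho B) b * E)) by ring.
      eapply equid_ext; [exact H3|]. intros n. cbv beta. ring.
Qed.

(** * The Brun-Hooley upper and lower bounds *)

Definition block : Type := (list Z * nat)%type.

Definition upper (y : Z -> R) (bl : list block) : R :=
  fold_right (fun Bb u => tie (map y (fst Bb)) (snd Bb) * u) 1 bl.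

(** Hooley's lower bound. The even truncation of a block overshoots its product by at most the first
    dropped term e_(b+1); this excess is paid for with the upper bound for the remaining blocks. *)
Fixpoint lower (y : Z -> R) (bl : list block) : R :=
  match bl with
  | [] => 1
  | Bb :: bl' => tie (map y (fst Bb)) (snd Bb) * lower y bl' - esym (map y (fst Bb)) (S (snd Bb)) * upper y bl'
  end.

Definition upperabs (y : Z -> R) (bl : list block) : R :=
  fold_right (fun Bb u => tieabs (map y (fst Bb)) (snd Bb) * u) 1 bl.

Fixpoint lowerabs (y : Z -> R) (bl : list block) : R :=
  match bl with
  | [] => 1
  | Bb :: bl' => tieabs (map y (fst Bb)) (snd Bb) * lowerabs y bl' + esym (map y (fst Bb)) (S (snd Bb)) * upperabs y bl'
  end.

Definition support (bl : list block) : list Z := flat_map fst bl.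

Lemma tieabs_nonneg l b : (forall x, In x l -> 0 <= x) -> 0 <= tieabs l b.
Proof.
  revert b; induction l as [|x l IH]; intros b H; simpl; [destruct b; lra|]. destruct b; [lra|].
  apply Rplus_le_le_0_compat; [|apply Rmult_le_pos]; simpl in H; auto.
Qed.

Lemma esym_nonneg l b : (forall x, In x l -> 0 <= x) -> 0 <= esym l b.
Proof.
  revert b; induction l as [|x l IH]; intros b H; simpl; [destruct b; lra|]. destruct b; [lra|].
  apply Rplus_le_le_0_compat; [|apply Rmult_le_pos]; simpl in H; auto.
Qed.

Lemma map_rho_nonneg B x : In x (map rho B) -> 0 <= x.
Proof. rewrite in_map_iff. intros (p & <- & _). apply rho_nonneg. Qed.

Lemma upperabs_nonneg bl : 0 <= upperabs rho bl.
Proof.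
  induction bl as [|Bb bl IH]; simpl; [lra|]. apply Rmult_le_pos; auto.
  apply tieabs_nonneg, map_rho_nonneg.
Qed.

Lemma lowerabs_nonneg bl : 0 <= lowerabs rho bl.
Proof.
  induction bl as [|Bb bl IH]; simpl; [lra|]. apply Rplus_le_le_0_compat; apply Rmult_le_pos; auto.
  - apply tieabs_nonneg, map_rho_nonneg.
  - apply esym_nonneg, map_rho_nonneg.
  - apply upperabs_nonneg.
Qed.

Lemma good_primes_app_r B Q : good_primes (B ++ Q) -> good_primes Q.
Proof.
  intros [H1 H2]. split; [|intros; apply H2, in_or_app; auto].
  induction B; simpl in *; auto. apply IHB; [inversion H1; auto|intros; auto].
Qed.

Lemma equid_upper bl : good_primes (support bl) ->
  equid A N (support bl) (fun n => upper (fun p => hits p n) bl) (upper dens bl) (upperabs rho bl).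
Proof.
  induction bl as [|[B b] bl IH]; intros Hg; simpl; [apply equid_one|].
  apply equid_tie; auto; [apply upperabs_nonneg|]. apply IH.
  apply good_primes_app_r in Hg. exact Hg.
Qed.

Lemma equid_lower bl : good_primes (support bl) ->
  equid A N (support bl) (fun n => lower (fun p => hits p n) bl) (lower dens bl) (lowerabs rho bl).
Proof.
  induction bl as [|[B b] bl IH]; intros Hg; cbn [lower lowerabs support flat_map fst snd]; [apply equid_one|].
  assert (Hg' : good_primes (support bl)) by (apply good_primes_app_r in Hg; exact Hg).
  apply equid_minus.
  - apply equid_tie; auto. apply lowerabs_nonneg.
  - apply equid_esym; auto; [apply upperabs_nonneg|]. apply equid_upper; auto.
Qed.

(** This is the union bound over [B]: the hits are added without any inclusion-exclusion, so only
    one prime of [B] enters each modulus. *)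
Lemma equid_last B : forall Q G M E, good_primes (B ++ Q) -> 0 <= E -> equid A N Q G M E ->
  equid A N (B ++ Q) (fun n => rsum B (fun p => hits p n) * G n) (rsum B dens * M) (rsum B rho * E).
Proof.
  induction B as [|p B IH]; intros Q G M E Hg HE H; cbn [rsum app].
  - rewrite !Rmult_0_l. apply equid_ext with (fun _ => 0); [apply equid_zero|intros; ring].
  - assert (Hg' := good_primes_cons _ _ _ Hg).
    assert (H1 := IH Q G M E Hg' HE H).
    assert (H2 : equid A N (B ++ Q) G M E) by (apply equid_weaken with Q E; auto; [apply incl_appr, incl_refl|lra]).
    apply (equid_hits _ p) in H2; [|apply Hg; simpl; auto|apply good_primes_rel; auto].
    apply (fun H => equid_weaken _ _ _ (p :: B ++ Q) _ _ _ _ H (incl_tl _ (incl_refl _)) (Rle_refl _)) in H1.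
    assert (H3 := equid_plus _ _ _ _ _ _ _ _ _ H2 H1).
    rewrite !Rmult_plus_distr_r. eapply equid_ext; [exact H3|]. intros n. cbv beta. ring.
Qed.
End Roots.

(** * Bonferroni inequalities and relative errors *)

Section Bonferroni.
Implicit Types l : list R.
Definition unit_list l : Prop := forall x, In x l -> 0 <= x <= 1.

Lemma vprod_bounds l : unit_list l -> 0 <= vprod l <= 1.
Proof.
  induction l as [|x l IH]; simpl; intros H; [lra|].
  assert (0 <= vprod l <= 1) by (apply IH; intros y Hy; apply H; simpl; auto).
  assert (0 <= x <= 1) by (apply H; simpl; auto). nra.
Qed.

(** The recursion of [tie] combines levels b + 1 and b, so both parities go through one induction.
    Arbitrary entries in [0, 1] are allowed because the inequalities serve for 0-1 hits and for
    densities. *)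
Lemma bonferroni l : unit_list l -> forall b,
  if Nat.even b then vprod l <= tie l b <= vprod l + esym l (S b)
  else vprod l - esym l (S b) <= tie l b <= vprod l.
Proof.
  induction l as [|x l IH]; intros H b.
  - destruct b; simpl; [lra|]. destruct (match b with O => _ | _ => _ end); lra.
  - assert (Hl : unit_list l) by (intros y Hy; apply H; simpl; auto).
    assert (Hx : 0 <= x <= 1) by (apply H; simpl; auto).
    destruct b as [|b].
    + pose proof (vprod_bounds l Hl). assert (He := esym_nonneg l 1 (fun y Hy => proj1 (Hl y Hy))).
      pose proof (IH Hl 0%nat) as I. simpl in I. 
      simpl Nat.even. cbv iota. cbn [vprod fold_right tie esym]. change (fold_right _ 1 l) with (vprod l).
      replace (esym l 0) with 1 by (destruct l; reflexivity).
      replace (tie l 0) with 1 in I by (destruct l; reflexivity). nra.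
    + pose proof (IH Hl (S b)) as I1. pose proof (IH Hl b) as I2.
      rewrite Nat.even_succ, <- Nat.negb_even in *. destruct (Nat.even b); simpl negb in *; cbv iota in *;
      cbn [vprod fold_right tie esym] in *; change (fold_right _ 1 l) with (vprod l) in *; nra.
Qed.

(** A product of m distinct entries occurs m! times in the expansion of the m-th power of the
    sum. *)
Lemma esym_le l : (forall x, In x l -> 0 <= x) -> forall m, INR (fact m) * esym l m <= lsum l ^ m.
Proof.
  induction l as [|x l IH]; intros H m.
  - destruct m; [simpl; lra|]. cbn [esym]. simpl lsum. rewrite Rmult_0_r. unfold lsum; simpl. lra.
  - assert (Hl : forall y, In y l -> 0 <= y) by (intros; apply H; simpl; auto).
    assert (Hx : 0 <= x) by (apply H; simpl; auto).
    destruct m as [|m]; [simpl; lra|]. cbn [esym].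
    replace (fact (S m)) with (S m * fact m)%nat by reflexivity.
    pose proof (IH Hl (S m)) as I1. pose proof (IH Hl m) as I2.
    replace (fact (S m)) with (S m * fact m)%nat in I1 by reflexivity. rewrite mult_INR in *.
    assert (Hs : 0 <= lsum l) by (apply rsum_nonneg; auto).
    assert (E : lsum (x :: l) = lsum l + x) by (unfold lsum; simpl; lra). rewrite E.
    set (s := lsum l) in *.
    assert (HB : forall j, s ^ S j + INR (S j) * x * s ^ j <= (s + x) ^ S j).
    { clear - Hs Hx. induction j as [|j IHj]; [simpl; lra|].
      assert (0 <= s ^ j) by (apply pow_le; auto). rewrite S_INR. pose proof (pos_INR (S j)).
      change ((s + x) ^ S (S j)) with ((s + x) * (s + x) ^ S j).
      apply Rle_trans with ((s + x) * (s ^ S j + INR (S j) * x * s ^ j)).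
      - simpl pow. assert (0 <= INR (S j) * (x * x) * s ^ j) by (repeat apply Rmult_le_pos; auto). nra.
      - apply Rmult_le_compat_l; lra. }
    specialize (HB m). pose proof (pos_INR (S m)).
    assert (INR (S m) * x * (INR (fact m) * esym l m) <= INR (S m) * x * s ^ m).
    { apply Rmult_le_compat_l; auto. apply Rmult_le_pos; auto. }
    nra.
Qed.

Lemma esym_le_pow l b : (forall x, In x l -> 0 <= x) -> esym l b <= (1 + lsum l) ^ b.
Proof.
  revert b; induction l as [|x l IH]; intros b H.
  - unfold lsum; simpl. rewrite Rplus_0_r, pow1. destruct b; simpl; lra.
  - assert (Hl : forall y, In y l -> 0 <= y) by (intros; apply H; simpl; auto).
    assert (Hx : 0 <= x) by (apply H; simpl; auto).
    destruct b as [|b]; [simpl; lra|]. cbn [esym].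
    assert (E : lsum (x :: l) = lsum l + x) by (unfold lsum; simpl; lra). rewrite E.
    assert (Hs : 0 <= lsum l) by (apply rsum_nonneg; auto).
    pose proof (IH (S b) Hl) as I1. pose proof (IH b Hl) as I2.
    assert (0 <= (1 + lsum l) ^ b <= (1 + (lsum l + x)) ^ b) by (split; [apply pow_le; lra|apply pow_incr; lra]).
    apply Rle_trans with ((1 + (lsum l + x)) * (1 + lsum l) ^ b); [simpl in I1; nra|].
    simpl. apply Rmult_le_compat_l; lra.
Qed.

Lemma tieabs_le_pow l b : (forall x, In x l -> 0 <= x) -> tieabs l b <= (1 + lsum l) ^ b.
Proof.
  revert b; induction l as [|x l IH]; intros b H.
  - unfold lsum; simpl. rewrite Rplus_0_r, pow1. destruct b; simpl; lra.
  - assert (Hl : forall y, In y l -> 0 <= y) by (intros; apply H; simpl; auto).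
    assert (Hx : 0 <= x) by (apply H; simpl; auto).
    destruct b as [|b]; [simpl; lra|]. cbn [tieabs].
    assert (E : lsum (x :: l) = lsum l + x) by (unfold lsum; simpl; lra). rewrite E.
    assert (Hs : 0 <= lsum l) by (apply rsum_nonneg; auto).
    pose proof (IH (S b) Hl) as I1. pose proof (IH b Hl) as I2.
    assert (0 <= (1 + lsum l) ^ b <= (1 + (lsum l + x)) ^ b) by (split; [apply pow_le; lra|apply pow_incr; lra]).
    apply Rle_trans with ((1 + (lsum l + x)) * (1 + lsum l) ^ b); [simpl in I1; nra|].
    simpl. apply Rmult_le_compat_l; lra.
Qed.

(** With c = 1 + 2 th and 0 <= x <= th <= 1/2 one has (1 - x)(1 + c x) >= 1, and 1 + c x <= exp(c
    x). *)
Lemma vprod_ge_exp l th : 0 <= th <= / 2 -> (forall x, In x l -> 0 <= x <= th) ->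
  exp (- (1 + 2 * th) * lsum l) <= vprod l.
Proof.
  intros Hth. induction l as [|x l IH]; intros H.
  - unfold lsum; simpl. rewrite Rmult_0_r, exp_0. lra.
  - assert (Hx : 0 <= x <= th) by (apply H; simpl; auto).
    assert (E : lsum (x :: l) = x + lsum l) by (unfold lsum; simpl; lra).
    rewrite E, Rmult_plus_distr_l, exp_plus. simpl.
    apply Rmult_le_compat; try (left; apply exp_pos); [|apply IH; intros; apply H; simpl; auto].
    replace (- (1 + 2 * th) * x) with (- ((1 + 2 * th) * x)) by ring. rewrite exp_Ropp.
    pose proof (exp_ineq1_le ((1 + 2 * th) * x)).
    apply Rle_trans with (/ (1 + (1 + 2 * th) * x)); [apply Rinv_le_contravar; nra|].
    apply Rmult_le_reg_l with (1 + (1 + 2 * th) * x); [nra|]. rewrite Rinv_r by nra. nra.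
Qed.

End Bonferroni.

Definition vblocks (y : Z -> R) (bl : list block) : R := vprod (map y (support bl)).

Lemma vprod_app l l' : vprod (l ++ l') = vprod l * vprod l'.
Proof. induction l; simpl; [lra|]. rewrite IHl; lra. Qed.

Lemma vblocks_cons y B b bl : vblocks y ((B, b) :: bl) = vprod (map y B) * vblocks y bl.
Proof. unfold vblocks, support. simpl. rewrite map_app, vprod_app. reflexivity. Qed.

Definition even_blocks (y : Z -> R) (bl : list block) : Prop :=
  forall B b, In (B, b) bl -> Nat.even b = true /\ unit_list (map y B).

Lemma even_blocks_cons y Bb bl : even_blocks y (Bb :: bl) -> even_blocks y bl.
Proof. intros H B b Hi. apply H. simpl; auto. Qed.

Lemma vblocks_bounds y bl : even_blocks y bl -> 0 <= vblocks y bl <= 1.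
Proof.
  intros H. apply vprod_bounds. intros x Hx. apply in_map_iff in Hx. destruct Hx as (p & <- & Hp).
  apply in_flat_map in Hp. destruct Hp as ([B b] & Hb & Hp). destruct (H B b Hb) as [_ Hu].
  apply Hu, in_map, Hp.
Qed.

Lemma upper_ge_vblocks y bl : even_blocks y bl -> vblocks y bl <= upper y bl.
Proof.
  induction bl as [|[B b] bl IH]; intros H; [unfold vblocks; simpl; lra|].
  assert (H' := even_blocks_cons _ _ _ H). rewrite vblocks_cons. simpl.
  destruct (H B b (or_introl eq_refl)) as [He Hu].
  pose proof (bonferroni _ Hu b) as Hb. rewrite He in Hb.
  pose proof (vprod_bounds _ Hu). pose proof (vblocks_bounds _ _ H'). specialize (IH H').
  apply Rmult_le_compat; lra.
Qed.

(* If v <= t and t - e <= v for each block then [v1 v2 >= t1 v2 - e1 v2], and the two occurrences of v2 are bounded below and above. *)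
Lemma lower_le_vblocks y bl : even_blocks y bl -> lower y bl <= vblocks y bl.
Proof.
  induction bl as [|[B b] bl IH]; intros H; [unfold vblocks; simpl; lra|].
  assert (H' := even_blocks_cons _ _ _ H). rewrite vblocks_cons. cbn [lower fst snd].
  destruct (H B b (or_introl eq_refl)) as [He Hu].
  pose proof (bonferroni _ Hu b) as Hb. rewrite He in Hb.
  pose proof (vprod_bounds _ Hu). pose proof (vblocks_bounds _ _ H'). pose proof (upper_ge_vblocks _ _ H').
  pose proof (esym_nonneg (map y B) (S b) (fun x Hx => proj1 (Hu x Hx))). specialize (IH H').
  set (t := tie _ _) in *. set (e := esym _ _) in *. set (v := vprod _) in *.
  assert (t * lower y bl <= t * vblocks y bl) by (apply Rmult_le_compat_l; lra).
  assert (e * vblocks y bl <= e * upper y bl) by (apply Rmult_le_compat_l; lra).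
  nra.
Qed.

Definition small_errors (y : Z -> R) (bl : list block) (eps : block -> R) : Prop :=
  forall B b, In (B, b) bl -> 0 <= eps (B, b) /\ esym (map y B) (S b) <= eps (B, b) * vprod (map y B).

Lemma upper_hat y bl eps : even_blocks y bl -> small_errors y bl eps ->
  upper y bl <= vblocks y bl * exp (rsum bl eps).
Proof.
  induction bl as [|[B b] bl IH]; intros H Hs; [unfold vblocks; simpl; rewrite exp_0; lra|].
  assert (H' := even_blocks_cons _ _ _ H). rewrite vblocks_cons. simpl.
  destruct (H B b (or_introl eq_refl)) as [He Hu]. destruct (Hs B b (or_introl eq_refl)) as [Hs0 Hs1].
  assert (Hs' : small_errors y bl eps) by (intros B' b' Hi; apply Hs; simpl; auto).
  pose proof (bonferroni _ Hu b) as Hb. rewrite He in Hb.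
  pose proof (vprod_bounds _ Hu). pose proof (vblocks_bounds _ _ H'). specialize (IH H' Hs').
  pose proof (upper_ge_vblocks _ _ H').
  rewrite exp_plus. pose proof (exp_ineq1_le (eps (B, b))).
  set (v := vprod _) in *. set (w := vblocks y bl) in *. set (u := upper y bl) in *.
  replace (v * w * (exp (eps (B, b)) * exp (rsum bl eps))) with
    ((v * exp (eps (B, b))) * (w * exp (rsum bl eps))) by ring.
  apply Rmult_le_compat; try lra. nra.
Qed.

Lemma exp_half_le : exp (/ 2) <= 2.
Proof.
  assert (H : exp (/ 2) * exp (/ 2) <= 3) by (rewrite <- exp_plus; replace (/ 2 + / 2) with 1 by lra; apply exp_le_3).
  pose proof (exp_pos (/ 2)). nra.
Qed.

Lemma lower_hat y bl eps : even_blocks y bl -> small_errors y bl eps -> rsum bl eps <= / 2 ->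
  vblocks y bl * (1 - rsum bl eps * exp (rsum bl eps)) <= lower y bl.
Proof.
  induction bl as [|[B b] bl IH]; intros H Hs Hsum; [unfold vblocks; simpl; lra|].
  assert (H' := even_blocks_cons _ _ _ H). rewrite vblocks_cons. cbn [lower fst snd rsum] in *.
  destruct (H B b (or_introl eq_refl)) as [He Hu]. destruct (Hs B b (or_introl eq_refl)) as [Hs0 Hs1].
  assert (Hs' : small_errors y bl eps) by (intros B' b' Hi; apply Hs; simpl; auto).
  assert (Hsg : 0 <= rsum bl eps) by (apply rsum_nonneg; intros [B' b'] Hi; apply Hs'; auto).
  pose proof (bonferroni _ Hu b) as Hb. rewrite He in Hb.
  pose proof (vprod_bounds _ Hu). pose proof (vblocks_bounds _ _ H'). specialize (IH H' Hs' ltac:(lra)).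
  pose proof (upper_hat _ _ _ H' Hs') as HU. pose proof (upper_ge_vblocks _ _ H').
  set (v := vprod _) in *. set (w := vblocks y bl) in *. set (u := upper y bl) in *.
  set (sg := rsum bl eps) in *. set (ep := eps (B, b)) in *. set (e := esym _ _) in *. set (t := tie _ _) in *.
  assert (He1 : 1 <= exp sg) by (rewrite <- exp_0; destruct (Req_dec sg 0) as [->|]; [lra|left; apply exp_increasing; lra]).
  assert (He2 : exp sg <= exp (ep + sg)) by (destruct (Req_dec ep 0) as [->|]; [rewrite Rplus_0_l; lra|left; apply exp_increasing; lra]).
  assert (He3 : exp sg <= 2).
  { eapply Rle_trans; [|apply exp_half_le]. destruct (Req_dec sg (/ 2)) as [->|]; [lra|left; apply exp_increasing; lra]. }
  (* The total error is kept at most 1/2 for this: the factor must be nonnegative before the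
     induction hypothesis can be multiplied by [t >= v]. *)
  assert (Hc : 0 <= 1 - sg * exp sg) by nra.
  assert (G1 : v * (w * (1 - sg * exp sg)) <= t * lower y bl).
  { apply Rmult_le_compat; try lra. apply Rmult_le_pos; lra. }
  assert (G2 : e * u <= (ep * v) * (w * exp sg)).
  { apply Rmult_le_compat; try lra. }
  assert (G3 : (ep + sg) * exp sg <= (ep + sg) * exp (ep + sg)) by (apply Rmult_le_compat_l; lra).
  assert (G4 : 0 <= v * w) by (apply Rmult_le_pos; lra).
  assert (G5 : v * w * ((ep + sg) * exp sg) <= v * w * ((ep + sg) * exp (ep + sg))) by (apply Rmult_le_compat_l; auto).
  nra.
Qed.

(** In each term of [lower] a block enters by its truncated sum or by its first dropped term, both
    at most (1 + s)^(b+1); the two choices per block give the power of 2. *)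
Lemma upper_lower_abs y bl (D : block -> R) :
  (forall B b, In (B, b) bl -> (forall p, In p B -> 0 <= y p) /\ 1 <= D (B, b) /\
      (1 + lsum (map y B)) ^ S b <= D (B, b)) ->
  0 <= upperabs y bl <= fold_right (fun Bb d => D Bb * d) 1 bl /\
  0 <= lowerabs y bl <= 2 ^ length bl * fold_right (fun Bb d => D Bb * d) 1 bl.
Proof.
  induction bl as [|[B b] bl IH]; intros H; [simpl; lra|].
  destruct IH as [I1 I2]; [intros; apply H; simpl; auto|].
  destruct (H B b (or_introl eq_refl)) as (Hn & HD & HB).
  assert (Hn' : forall x, In x (map y B) -> 0 <= x).
  { intros x Hx. apply in_map_iff in Hx. destruct Hx as (p & <- & Hp); auto. }
  cbn [upperabs lowerabs fold_right fst snd length].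
  set (d := fold_right (fun Bb d => D Bb * d) 1 bl) in *.
  pose proof (tieabs_nonneg _ b Hn') as T0. pose proof (esym_nonneg _ (S b) Hn') as E0.
  pose proof (tieabs_le_pow _ b Hn') as T1. pose proof (esym_le_pow _ (S b) Hn') as E1.
  assert (Hs : 0 <= lsum (map y B)) by (apply rsum_nonneg; auto).
  assert (T2 : (1 + lsum (map y B)) ^ b <= (1 + lsum (map y B)) ^ S b).
  { simpl. assert (0 <= (1 + lsum (map y B)) ^ b) by (apply pow_le; lra). nra. }
  set (t := tieabs _ _) in *. set (e := esym _ _) in *.
  assert (Hp : 1 <= 2 ^ length bl) by (apply pow_R1_Rle; lra).
  fold (upperabs y bl).
  split; split.
  - apply Rmult_le_pos; lra.
  - apply Rmult_le_compat; lra.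
  - apply Rplus_le_le_0_compat; apply Rmult_le_pos; lra.
  - assert (t * lowerabs y bl <= D (B, b) * (2 ^ length bl * d)) by (apply Rmult_le_compat; lra).
    assert (e * upperabs y bl <= D (B, b) * (2 ^ length bl * d)).
    { apply Rmult_le_compat; try lra. nra. }
    simpl. lra.
Qed.

(** The exponent [b] instead of [S b] matters. Over all blocks it lowers the level from [Lam * 6.05]
    to [Lam * 4.55], and only the latter stays below [Lam * 10] after the union bound has added
    [Lam * 5.05]. *)
Lemma upperabs_le y bl (D : block -> R) :
  (forall B b, In (B, b) bl -> (forall p, In p B -> 0 <= y p) /\ (1 + lsum (map y B)) ^ b <= D (B, b)) ->
  0 <= upperabs y bl <= fold_right (fun Bb d => D Bb * d) 1 bl.
Proof.
  induction bl as [|[B b] bl IH]; intros H; [simpl; lra|].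
  destruct IH as [I1 I2]; [intros; apply H; simpl; auto|].
  destruct (H B b (or_introl eq_refl)) as (Hn & HB).
  assert (Hn' : forall x, In x (map y B) -> 0 <= x).
  { intros x Hx. apply in_map_iff in Hx. destruct Hx as (p & <- & Hp); auto. }
  pose proof (tieabs_nonneg _ b Hn') as T0. pose proof (tieabs_le_pow _ b Hn') as T1.
  simpl. fold (upperabs y bl). split.
  - apply Rmult_le_pos; lra.
  - apply Rmult_le_compat; lra.
Qed.

(** Rankin's trick: e_m c^m is at most the product of the 1 + c x. It serves the deep blocks, where
    the sum of the entries may be of order k. *)
Lemma esym_le_exp l c : 0 <= c -> (forall x, In x l -> 0 <= x) -> forall m, esym l m * c ^ m <= exp (c * lsum l).
Proof.
  intros Hc. induction l as [|x l IH]; intros H m.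
  - unfold lsum; simpl. rewrite Rmult_0_r, exp_0. destruct m; simpl; lra.
  - assert (E : lsum (x :: l) = x + lsum l) by (unfold lsum; simpl; lra).
    assert (Hl : forall y, In y l -> 0 <= y) by (intros; apply H; simpl; auto).
    assert (Hx : 0 <= x) by (apply H; simpl; auto).
    rewrite E, Rmult_plus_distr_l, exp_plus. pose proof (exp_ineq1_le (c * x)).
    pose proof (exp_pos (c * lsum l)). assert (0 <= c * x) by (apply Rmult_le_pos; auto).
    apply Rle_trans with ((1 + c * x) * exp (c * lsum l)); [|apply Rmult_le_compat_r; lra].
    destruct m as [|m].
    + specialize (IH Hl 0%nat). simpl in *. replace (esym l 0) with 1 in IH by (destruct l; reflexivity). nra.
    + cbn [esym]. pose proof (IH Hl (S m)). pose proof (IH Hl m).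
      replace ((esym l (S m) + x * esym l m) * c ^ S m) with (esym l (S m) * c ^ S m + c * x * (esym l m * c ^ m)) by (simpl; ring).
      assert (c * x * (esym l m * c ^ m) <= c * x * exp (c * lsum l)) by (apply Rmult_le_compat_l; auto). lra.
Qed.

Lemma rsum_incl {A} (l l' : list A) (f : A -> R) : NoDup l -> incl l l' -> (forall a, In a l' -> 0 <= f a) ->
  rsum l f <= rsum l' f.
Proof.
  revert l'. induction l as [|a l IH]; intros l' Hnd Hi Hf; simpl; [apply rsum_nonneg; auto|].
  inversion Hnd; subst. destruct (in_split a l') as (l1 & l2 & ->); [apply Hi; simpl; auto|].
  rewrite rsum_app. simpl.
  assert (rsum l f <= rsum (l1 ++ l2) f).
  { apply IH; auto.
    - intros b Hb. assert (Hb' : In b (l1 ++ a :: l2)) by (apply Hi; simpl; auto).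
      apply in_app_or in Hb'. apply in_or_app. simpl in Hb'. destruct Hb' as [?|[->|?]]; auto; tauto.
    - intros b Hb. apply Hf. apply in_app_or in Hb. apply in_or_app. simpl. tauto. }
  rewrite rsum_app in H. lra.
Qed.

(** * Zeros of linear forms modulo primes *)

Definition dvdb (p m : Z) : bool := if Zdivide_dec p m then true else false.

Lemma dvdb_spec p m : dvdb p m = true <-> (p | m)%Z.
Proof. unfold dvdb. destruct Zdivide_dec; split; auto; discriminate. Qed.

Definition hitb (Ls : list (Z * Z)) (p n : Z) : bool := existsb (fun ab => dvdb p (evalL ab n)) Ls.

Lemma hitb_spec Ls p n : hitb Ls p n = true <-> exists ab, In ab Ls /\ (p | evalL ab n)%Z.
Proof.
  unfold hitb. rewrite existsb_exists. split; intros (ab & H1 & H2); exists ab; split; auto; apply dvdb_spec; auto.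
Qed.

Definition roots_of (Ls : list (Z * Z)) (p : Z) : list Z :=
  filter (hitb Ls p) (zints 0 (Z.to_nat p)).

Lemma hitb_periodic Ls p n c : (p | n - c)%Z -> hitb Ls p c = hitb Ls p n.
Proof.
  intros [d Hd]. apply Bool.eq_true_iff_eq. rewrite !hitb_spec.
  split; intros (ab & Hi & [e He]); exists ab; split; auto; unfold evalL in *.
  - exists (e + fst ab * d)%Z. nia.
  - exists (e - fst ab * d)%Z. nia.
Qed.

(** Exactly one [c] in [0, p) is congruent to [n], so the sum over the roots is the indicator of a
    hit. *)
Lemma hits_roots_of rts Ls p n : (0 < p)%Z -> rts p = roots_of Ls p ->
  hits rts p n = if hitb Ls p n then 1 else 0.
Proof.
  intros Hp Hr. unfold hits. rewrite Hr. unfold roots_of. rewrite rsum_filter.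
  rewrite rsum_ext with (g := fun c => (if hitb Ls p n then 1 else 0) * res p n c).
  - rewrite rsum_scal, res_sum by auto. rewrite Z2Nat.id by lia.
    assert (E : ((0 + p - 1 - n) / p - (0 - 1 - n) / p = 1)%Z).
    { replace (0 + p - 1 - n)%Z with ((0 - 1 - n) + 1 * p)%Z by ring. rewrite Z.div_add; lia. }
    rewrite E. lra.
  - intros c _. unfold res.
    destruct (Zdivide_dec p (n - c)) as [D|D]; destruct (Zdivide_dec p (c - n)) as [D'|D'].
    + rewrite (hitb_periodic Ls p n c D). destruct (hitb Ls p n); lra.
    + exfalso. apply D'. replace (c - n)%Z with (- (n - c))%Z by ring. apply Z.divide_opp_r; auto.
    + exfalso. apply D. replace (n - c)%Z with (- (c - n))%Z by ring. apply Z.divide_opp_r; auto.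
    + destruct (hitb Ls p n); destruct (hitb Ls p c); lra.
Qed.

Lemma length_le_1 (l : list Z) : NoDup l -> (forall a b, In a l -> In b l -> a = b) -> (length l <= 1)%nat.
Proof.
  intros Hnd H. destruct l as [|a [|b l]]; simpl; try lia.
  exfalso. inversion Hnd; subst. apply H2. rewrite (H a b); simpl; auto.
Qed.

Lemma length_roots_of Ls p : prime p -> (forall ab, In ab Ls -> ~ (p | fst ab)%Z) ->
  (length (roots_of Ls p) <= length Ls)%nat.
Proof.
  intros Hp H. assert (Hp0 : (1 < p)%Z) by (destruct Hp; auto).
  apply Nat.le_trans with (length (flat_map (fun ab => roots_of [ab] p) Ls)).
  - apply NoDup_incl_length; [apply NoDup_filter, NoDup_zints|].
    intros c Hc. unfold roots_of in Hc. apply filter_In in Hc. destruct Hc as [Hz Hh].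
    apply hitb_spec in Hh. destruct Hh as (ab & Hab & Hd). apply in_flat_map. exists ab; split; auto.
    apply filter_In. split; auto. apply hitb_spec. exists ab. simpl; auto.
  - clear - H Hp Hp0. induction Ls as [|ab Ls IH]; [simpl; lia|]. simpl flat_map. rewrite length_app.
    assert (H1 : (length (roots_of [ab] p) <= 1)%nat).
    { apply length_le_1; [apply NoDup_filter, NoDup_zints|]. intros c d Hc Hd.
      apply filter_In in Hc. apply filter_In in Hd. destruct Hc as [Zc Hc], Hd as [Zd Hd].
      apply in_zints in Zc. apply in_zints in Zd.
      apply hitb_spec in Hc. apply hitb_spec in Hd.
      destruct Hc as (? & [<-|[]] & Dc). destruct Hd as (? & [<-|[]] & Dd).
      assert (D : (p | fst ab * (c - d))%Z).
      { replace (fst ab * (c - d))%Z with (evalL ab c - evalL ab d)%Z by (unfold evalL; ring).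
        apply Z.divide_sub_r; auto. }
      apply Gauss in D; [|apply prime_rel_prime; auto; apply H; simpl; auto].
      destruct D as [e He]. rewrite Z2Nat.id in * by lia. assert (e = 0)%Z by nia. subst e. lia. }
    simpl length. specialize (IH (fun a Ha => H a (or_intror Ha))). lia.
Qed.

(** * Geometric blocks of primes *)

Section Blocks.
Variables (Lam w : R) (J e : nat).

(* Sieving ranges z_j = z_0^(3^-j), with z_0 = exp Lam = x^(1/10) in the application. *)
Definition zz (j : nat) : R := exp (Lam / 3 ^ j).

(* Up to z_J only the truncation level 2 (j + 1) is affordable, since z_0^(sum 2 (j + 1) / 3^j) = x^0.45 must fit with the x^0.505 spent on the union bound; below z_J the sieve has dimension O(k), and e = 30 k. *)
Definition bpar (j : nat) : nat := (2 * (j + 1) + (if (j <? J)%nat then 0 else 2 * e))%nat.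

(** The maximum cuts the blocks at [w]; those entirely below [w] are empty, so the number of blocks
    may be taken generously. *)
Definition blk (j : nat) : block := (primes3 (Rmax w (zz (S j))) (zz j), bpar j).

Fixpoint mkblocks (j n : nat) : list block :=
  match n with O => [] | S n' => blk j :: mkblocks (S j) n' end.

Lemma mkblocks_add n : forall j m, mkblocks j (n + m) = mkblocks j n ++ mkblocks (j + n) m.
Proof.
  induction n as [|n IH]; intros j m; simpl; [rewrite Nat.add_0_r; auto|].
  rewrite IH. do 3 f_equal. lia.
Qed.

Lemma in_mkblocks n : forall j Bb, In Bb (mkblocks j n) -> exists i, (j <= i < j + n)%nat /\ Bb = blk i.
Proof.
  induction n as [|n IH]; intros j Bb; simpl; [tauto|]. intros [<-|H].
  - exists j. split; [lia|auto].
  - destruct (IH _ _ H) as (i & Hi & E). exists i. split; [lia|auto].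
Qed.

Lemma length_mkblocks n : forall j, length (mkblocks j n) = n.
Proof. induction n; intros; simpl; auto. Qed.

Hypothesis HLam : 0 <= Lam.

Lemma zz_antitone i j : (i <= j)%nat -> zz j <= zz i.
Proof.
  intros H. unfold zz. assert (0 < 3 ^ i <= 3 ^ j) by (split; [apply pow_lt; lra|apply Rle_pow; [lra|auto]]).
  assert (E : Lam / 3 ^ j <= Lam / 3 ^ i).
  { apply Rmult_le_compat_l; auto. apply Rinv_le_contravar; lra. }
  destruct E as [E|E]; [left; apply exp_increasing; auto|right; rewrite E; auto].
Qed.

Lemma zz_ge_1 j : 1 <= zz j.
Proof.
  unfold zz. rewrite <- exp_0. assert (H : 0 <= Lam / 3 ^ j).
  { apply Rmult_le_pos; auto. left. apply Rinv_0_lt_compat, pow_lt; lra. }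
  destruct H as [H|H]; [left; apply exp_increasing; auto|right; rewrite <- H; auto].
Qed.

Lemma in_support_mkblocks n : forall j p, In p (support (mkblocks j n)) ->
  prime p /\ (p mod 4 = 3)%Z /\ w < IZR p /\ zz (j + n) < IZR p <= zz j.
Proof.
  induction n as [|n IH]; intros j p; simpl; [tauto|]. intros H. apply in_app_or in H. destruct H as [H|H].
  - apply in_primes3 in H. destruct H as (Hp & Hm & H1 & H2).
    pose proof (Rmax_l w (zz (S j))). pose proof (Rmax_r w (zz (S j))).
    pose proof (zz_antitone (S j) (j + S n) ltac:(lia)). intuition lra.
  - apply IH in H. destruct H as (Hp & Hm & H1 & H2). replace (j + S n)%nat with (S j + n)%nat by lia.
    pose proof (zz_antitone j (S j) ltac:(lia)). intuition lra.
Qed.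

Lemma NoDup_support_mkblocks n : forall j, NoDup (support (mkblocks j n)).
Proof.
  induction n as [|n IH]; intros j; simpl; [constructor|].
  apply NoDup_app; [apply NoDup_primes3|apply IH|].
  intros p H1 H2. apply in_primes3 in H1. apply in_support_mkblocks in H2.
  pose proof (Rmax_r w (zz (S j))). lra.
Qed.

Lemma support_mkblocks_complete n : forall j p, prime p -> (p mod 4 = 3)%Z -> w < IZR p -> 
  zz (j + n) <= w -> IZR p <= zz j -> In p (support (mkblocks j n)).
Proof.
  induction n as [|n IH]; intros j p Hp Hm Hw Hz Hj.
  - rewrite Nat.add_0_r in Hz. lra.
  - simpl. apply in_or_app. destruct (Rle_dec (IZR p) (zz (S j))) as [H|H].
    + right. apply IH; auto. replace (S j + n)%nat with (j + S n)%nat by lia. auto.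
    + left. apply in_primes3. split; [auto|]. split; [auto|]. split; [apply Rmax_lub_lt; lra|auto].
Qed.

Lemma support_app (b1 b2 : list block) : support (b1 ++ b2) = support b1 ++ support b2.
Proof. apply flat_map_app. Qed.

End Blocks.

(** * Numerical estimates for the block structure *)

Lemma exp_le x y : x <= y -> exp x <= exp y.
Proof. intros [H| ->]; [left; apply exp_increasing; auto|lra]. Qed.

Lemma exp_pow x n : exp x ^ n = exp (INR n * x).
Proof.
  induction n as [|n IH]; [simpl; rewrite Rmult_0_l, exp_0; auto|].
  rewrite S_INR. simpl pow. rewrite IH, <- exp_plus. f_equal. ring.
Qed.

(** Source of the three numerical constants that follow; 64 is a power of 2, so the left side can be
    evaluated by repeated squaring. *)
Lemma exp_ge_pow_64 x : 0 <= 1 + x / 64 -> (1 + x / 64) ^ 64 <= exp x.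
Proof.
  intros H. replace x with (INR 64 * (x / 64)) at 2 by (simpl; field).
  rewrite <- exp_pow. apply pow_incr. split; auto. apply exp_ineq1_le.
Qed.

Lemma ln_3_le : ln 3 <= 1.115.
Proof.
  rewrite <- (ln_exp 1.115). apply ln_le; [lra|].
  eapply Rle_trans; [|apply exp_ge_pow_64; lra].
  replace 64%nat with (2 * (2 * (2 * (2 * (2 * 2)))))%nat by reflexivity. rewrite !pow_mult.
  simpl. lra.
Qed.

Lemma ln_505_le : ln 5.05 <= 1.65.
Proof.
  rewrite <- (ln_exp 1.65). apply ln_le; [lra|].
  eapply Rle_trans; [|apply exp_ge_pow_64; lra].
  replace 64%nat with (2 * (2 * (2 * (2 * (2 * 2)))))%nat by reflexivity. rewrite !pow_mult.
  simpl. lra.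
Qed.

Lemma exp_m58_ge : 0.5556 <= exp (- 0.58).
Proof.
  eapply Rle_trans; [|apply exp_ge_pow_64; lra].
  replace 64%nat with (2 * (2 * (2 * (2 * (2 * 2)))))%nat by reflexivity. rewrite !pow_mult.
  simpl. lra.
Qed.

Lemma fact_ge j : 6 * 16 ^ j <= INR (fact (2 * j + 3)).
Proof.
  induction j as [|j IH]; [simpl; lra|].
  replace (2 * S j + 3)%nat with (S (S (2 * j + 3))) by lia.
  change (fact (S (S (2 * j + 3)))) with (S (S (2 * j + 3)) * (S (2 * j + 3) * fact (2 * j + 3)))%nat.
  rewrite !mult_INR. set (f := INR (fact (2 * j + 3))) in *.
  assert (H1 : 4 <= INR (S (2 * j + 3))) by (replace 4 with (INR 4) by (simpl; lra); apply le_INR; lia).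
  assert (H2 : 4 <= INR (S (S (2 * j + 3)))) by (replace 4 with (INR 4) by (simpl; lra); apply le_INR; lia).
  assert (0 < 16 ^ j) by (apply pow_lt; lra).
  simpl pow. assert (16 <= INR (S (S (2 * j + 3))) * INR (S (2 * j + 3))) by nra. nra.
Qed.

Lemma primes3_empty u v : v <= u -> primes3 u v = [].
Proof.
  intros H. destruct (primes3 u v) as [|p l] eqn:E; auto.
  assert (Hi : In p (primes3 u v)) by (rewrite E; simpl; auto). apply in_primes3 in Hi. lra.
Qed.

(** The spare 1, due to 1 not being prime, absorbs the 1 in the factors 1 + s that bound the sieve
    error. *)
Lemma length_primes3 u v : 1 <= v -> INR (length (primes3 u v)) + 1 <= v.
Proof.
  intros Hv. destruct (nat_floor v) as [n Hn]; [lra|].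
  assert (Hn1 : (1 <= n)%nat). { assert (0 < n)%nat; [|lia]. apply INR_lt. simpl. lra. }
  assert (H : (length (primes3 u v) <= n - 1)%nat).
  { replace (n - 1)%nat with (length (zints 2 (n - 1))) by (unfold zints; rewrite length_map, length_seq; auto).
    apply NoDup_incl_length; [apply NoDup_primes3|]. intros p Hp. apply in_primes3 in Hp.
    destruct Hp as (Hp & _ & _ & Hpv). apply in_zints. destruct Hp as [Hp _].
    assert (p < Z.of_nat n + 1)%Z; [|lia]. apply lt_IZR. rewrite plus_IZR, <- INR_IZR_INZ. lra. }
  apply le_INR in H. rewrite minus_INR in H by lia. simpl in H. lra.
Qed.

Section Estimates.
Variables (Lam w : R) (J k : nat) (rts : Z -> list Z).
Let e := (30 * k)%nat.
Hypothesis HLam : 0 < Lam.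
Hypothesis Hk : (1 <= k)%nat.
Hypothesis Hkw : 100 * INR k <= w.
Hypothesis Hw : 40 / ln w <= 0.0005.
Hypothesis HJ1 : 10000 * INR k <= 3 ^ J.
Hypothesis Hr1 : forall p, prime p -> w < IZR p -> rho rts p <= INR k.
Hypothesis Hr2 : forall p, prime p -> w < IZR p -> zz Lam J < IZR p -> rho rts p <= 1.

Notation B j := (fst (blk Lam w J e j)).
Notation b j := (snd (blk Lam w J e j)).
Notation bl j n := (mkblocks Lam w J e j n).
Notation g := (dens rts).

Lemma w_ge : 100 <= w.
Proof. apply INR_pos in Hk. lra. Qed.

Lemma dens_small p : prime p -> w < IZR p -> 0 <= g p <= 0.01.
Proof.
  intros Hp Hpw. pose proof w_ge. split; [apply dens_nonneg; auto|].
  unfold dens. apply Rmult_le_reg_r with (IZR p); [lra|]. unfold Rdiv. rewrite Rmult_assoc, Rinv_l by lra.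
  pose proof (Hr1 p Hp Hpw). lra.
Qed.

Lemma dens_le_k p : prime p -> w < IZR p -> g p <= INR k * / IZR p.
Proof.
  intros Hp Hpw. pose proof w_ge. unfold dens. apply Rmult_le_compat_r; auto.
  left; apply Rinv_0_lt_compat; lra.
Qed.

Lemma dens_le_1 p : prime p -> w < IZR p -> zz Lam J < IZR p -> g p <= / IZR p.
Proof.
  intros Hp Hpw Hz. pose proof w_ge. unfold dens. pose proof (Hr2 p Hp Hpw Hz).
  assert (0 < / IZR p) by (apply Rinv_0_lt_compat; lra). unfold Rdiv. nra.
Qed.

(** A block spans a factor of at most 3 in ln p, so Mertens gives ln 3 / 2 <= 0.5575, plus 0.0005
    for the error term. *)
Lemma block_prime_sum j : rsum (B j) (fun p => / IZR p) <= 0.558.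
Proof.
  unfold blk; simpl fst. set (u := Rmax w (zz Lam (S j))). set (v := zz Lam j).
  pose proof w_ge. assert (Hu1 : w <= u) by apply Rmax_l. assert (Hu2 : zz Lam (S j) <= u) by apply Rmax_r.
  destruct (Rle_dec u v) as [Huv|Huv]; [|rewrite primes3_empty by lra; simpl; lra].
  eapply Rle_trans; [apply mertens_primes3; lra|].
  assert (Hlw : 0 < ln w) by (rewrite <- ln_1; apply ln_increasing; lra).
  assert (Hlu : ln w <= ln u) by (apply ln_le; lra).
  assert (H40 : 40 / ln u <= 40 / ln w).
  { unfold Rdiv. apply Rmult_le_compat_l; [lra|]. apply Rinv_le_contravar; auto. }
  assert (H3 : 0 < 3 ^ j) by (apply pow_lt; lra).
  assert (HL : Lam / 3 ^ S j <= ln u).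
  { rewrite <- (ln_exp (Lam / 3 ^ S j)). apply ln_le; [apply exp_pos|exact Hu2]. }
  assert (HL0 : 0 < Lam / 3 ^ S j) by (apply Rdiv_lt_0_compat; auto; apply pow_lt; lra).
  assert (Hv : ln v = 3 * (Lam / 3 ^ S j)).
  { unfold v, zz. rewrite ln_exp. simpl. field. lra. }
  rewrite Hv, ln_mult by lra.
  assert (ln (Lam / 3 ^ S j) <= ln (ln u)) by (apply ln_le; auto).
  pose proof ln_3_le. lra.
Qed.

Lemma block_prime p j : In p (B j) -> prime p /\ w < IZR p /\ zz Lam (S j) < IZR p.
Proof.
  intros H. apply in_primes3 in H. destruct H as (Hp & _ & H & _).
  pose proof (Rmax_l w (zz Lam (S j))). pose proof (Rmax_r w (zz Lam (S j))). split; auto. lra.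
Qed.

Lemma lsum_dens j : 0 <= lsum (map g (B j)) <= (if (j <? J)%nat then 0.56 else 0.56 * INR k).
Proof.
  unfold lsum. rewrite rsum_map. split.
  { apply rsum_nonneg. intros p Hp. apply block_prime in Hp. apply dens_nonneg, Hp. }
  pose proof (block_prime_sum j) as Hs. pose proof (INR_pos k Hk) as Hk1.
  destruct (Nat.ltb_spec j J) as [Hj|Hj].
  - eapply Rle_trans; [|eapply Rle_trans; [exact Hs|lra]]. apply rsum_le. intros p Hp.
    apply block_prime in Hp. destruct Hp as (Hp & H1 & H2). apply dens_le_1; auto.
    pose proof (zz_antitone Lam ltac:(lra) (S j) J ltac:(lia)). lra.
  - apply Rle_trans with (INR k * rsum (B j) (fun p => / IZR p)).
    + rewrite <- rsum_scal. apply rsum_le. intros p Hp.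
      apply block_prime in Hp. destruct Hp as (Hp & H1 & H2). apply dens_le_k; auto.
    + nra.
Qed.

Lemma dens_block_small j x : In x (map g (B j)) -> 0 <= x <= 0.01.
Proof.
  intros H. apply in_map_iff in H. destruct H as (p & <- & Hp). apply block_prime in Hp.
  apply dens_small; apply Hp.
Qed.

(* Relative error of block j; the exponent recovers j (or j + e) from the truncation level. *)
Definition eps (Bb : block) : R := 0.053 / 50 ^ (Nat.div2 (snd Bb) - 1).

Lemma vprod_block_ge j : exp (- 1.02 * lsum (map g (B j))) <= vprod (map g (B j)).
Proof.
  eapply Rle_trans; [|apply (vprod_ge_exp _ 0.01); [lra|apply dens_block_small]].
  right. f_equal. lra.
Qed.

Lemma div2_bpar j : (Nat.div2 (b j) - 1 = j + if j <? J then 0 else e)%nat.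
Proof.
  assert (E : b j = (2 * (j + 1 + (if (j <? J)%nat then 0 else e)))%nat).
  { unfold blk, bpar. cbn [snd]. destruct (j <? J)%nat; lia. }
  rewrite E, Nat.div2_double. destruct (j <? J)%nat; lia.
Qed.

Lemma eps_nonneg Bb : 0 <= eps Bb.
Proof. unfold eps. apply Rmult_le_pos; [lra|]. left. apply Rinv_0_lt_compat, pow_lt; lra. Qed.

(** Shallow blocks have s <= 0.56 and use s^m / m!. In deep blocks s may grow with k; Rankin's trick
    together with the extra [2 * e] truncation steps takes over. *)
Lemma block_error j : esym (map g (B j)) (S (b j)) <= eps (blk Lam w J e j) * vprod (map g (B j)).
Proof.
  pose proof (vprod_block_ge j) as HV. pose proof (lsum_dens j) as Hs.
  assert (Hnn : forall x, In x (map g (B j)) -> 0 <= x) by (intros x Hx; apply dens_block_small in Hx; lra).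
  set (s := lsum (map g (B j))) in *. set (V := vprod (map g (B j))) in *.
  unfold eps. rewrite div2_bpar.
  assert (Hb : b j = (2 * (j + 1) + (if (j <? J)%nat then 0 else 2 * e))%nat) by reflexivity.
  rewrite Hb. destruct (Nat.ltb_spec j J) as [Hj|Hj].
  - rewrite !Nat.add_0_r. replace (S (2 * (j + 1))) with (2 * j + 3)%nat by lia.
    pose proof (esym_le _ Hnn (2 * j + 3)) as H1. fold s in H1.
    pose proof (fact_ge j) as H2. pose proof (esym_nonneg _ (2 * j + 3) Hnn) as H3.
    set (E := esym _ _) in *.
    assert (H4 : s ^ (2 * j + 3) <= 0.56 ^ (2 * j + 3)) by (apply pow_incr; lra).
    assert (H5 : 0.56 ^ (2 * j + 3) = 0.3136 ^ j * 0.175616).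
    { rewrite pow_add, pow_mult. f_equal; [f_equal; lra|lra]. }
    assert (H6 : 0 < 16 ^ j) by (apply pow_lt; lra).
    assert (H7 : 6 * 16 ^ j * E <= 0.3136 ^ j * 0.175616).
    { rewrite <- H5. eapply Rle_trans; [|exact H4]. eapply Rle_trans; [|exact H1]. apply Rmult_le_compat_r; lra. }
    assert (H8 : 0.3136 ^ j = 16 ^ j * 0.0196 ^ j) by (rewrite <- Rpow_mult_distr; f_equal; lra).
    assert (H9 : 0.0196 ^ j <= / 50 ^ j).
    { rewrite <- pow_inv. apply pow_incr. lra. }
    assert (H10 : 0.5556 <= V).
    { eapply Rle_trans; [apply exp_m58_ge|]. eapply Rle_trans; [|exact HV]. apply exp_le. lra. }
    assert (H11 : 6 * E <= 0.0196 ^ j * 0.175616).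
    { apply Rmult_le_reg_l with (16 ^ j); auto. rewrite H8 in H7. lra. }
    assert (0 < / 50 ^ j) by (apply Rinv_0_lt_compat, pow_lt; lra).
    unfold Rdiv. apply Rle_trans with (0.053 * / 50 ^ j * 0.5556); [lra|].
    apply Rmult_le_compat_l; lra.
  - set (m := S (2 * (j + 1) + 2 * e)).
    pose proof (esym_le_exp _ 8 ltac:(lra) Hnn m) as H1. fold s in H1.
    set (E := esym _ _) in *.
    assert (Hm : 8 ^ m = 8 * 64 * (64 ^ (j + e))).
    { unfold m. replace (S (2 * (j + 1) + 2 * e)) with (2 * (j + e) + 3)%nat by lia.
      rewrite pow_add, pow_mult. replace (8 ^ 2) with 64 by (simpl; lra). simpl (8 ^ 3). lra. }
    (* In 64 = 50 * 1.28 the factor 50 yields the error wanted. The factor 1.28 pays for exp (9.02 *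
       s) <= exp (6 k), because 1.28^30 >= 3^6; hence e = 30 k. *)
    assert (H64 : 64 ^ (j + e) = 50 ^ (j + e) * 1.28 ^ (j + e)) by (rewrite <- Rpow_mult_distr; f_equal; lra).
    assert (H128 : exp (9.02 * s) <= 1.28 ^ (j + e)).
    { apply Rle_trans with (exp (INR k * 6)); [apply exp_le; pose proof (INR_pos k Hk); lra|].
      rewrite <- exp_pow. 
      apply Rle_trans with ((1.28 ^ 30) ^ k).
      - apply pow_incr. split; [left; apply exp_pos|].
        apply Rle_trans with (3 ^ 6).
        + replace 6 with (INR 6 * 1) by (simpl; lra). rewrite <- exp_pow. apply pow_incr.
          split; [left; apply exp_pos|apply exp_le_3].
        + simpl. lra.
      - rewrite <- pow_mult. apply Rle_pow; [lra|]. unfold e. lia. }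
    assert (H50 : 0 < 50 ^ (j + e)) by (apply pow_lt; lra).
    assert (Hexp : exp (9.02 * s) = exp (8 * s) * exp (1.02 * s)) by (rewrite <- exp_plus; f_equal; lra).
    assert (HV2 : exp (- 1.02 * s) * exp (1.02 * s) = 1) by (rewrite <- exp_plus, <- exp_0; f_equal; lra).
    pose proof (exp_pos (1.02 * s)) as Hp1. pose proof (exp_pos (8 * s)) as Hp8.
    assert (HV3 : 1 <= V * exp (1.02 * s)) by (rewrite <- HV2; apply Rmult_le_compat_r; lra).
    apply Rmult_le_reg_r with (8 ^ m * exp (1.02 * s)).
    { apply Rmult_lt_0_compat; auto. apply pow_lt; lra. }
    apply Rle_trans with (exp (8 * s) * exp (1.02 * s)).
    { rewrite <- Rmult_assoc. apply Rmult_le_compat_r; lra. }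
    rewrite <- Hexp. 
    replace (0.053 / 50 ^ (j + e) * V * (8 ^ m * exp (1.02 * s))) with
      (27.136 * (1.28 ^ (j + e)) * (V * exp (1.02 * s))).
    2:{ rewrite Hm, H64. set (P := 50 ^ (j + e)) in *. set (Q := 1.28 ^ (j + e)) in *. set (X := exp (1.02 * s)) in *. transitivity (27.136 * Q * (V * X) * (P * / P)); [rewrite Rinv_r by lra; lra|unfold Rdiv; lra]. }
    pose proof (exp_pos (9.02 * s)).
    apply Rle_trans with (27.136 * 1.28 ^ (j + e) * 1); [lra|]. apply Rmult_le_compat_l; lra.
Qed.

Lemma eps_sum n : forall j, rsum (bl j n) eps <= 0.0541 / 50 ^ j.
Proof.
  induction n as [|n IH]; intros j.
  - simpl. apply Rmult_le_pos; [lra|]. left. apply Rinv_0_lt_compat, pow_lt; lra.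
  - simpl mkblocks. cbn [rsum]. specialize (IH (S j)).
    assert (H : eps (blk Lam w J e j) <= 0.053 / 50 ^ j).
    { unfold eps. rewrite div2_bpar. apply Rmult_le_compat_l; [lra|].
      apply Rinv_le_contravar; [apply pow_lt; lra|]. apply Rle_pow; [lra|lia]. }
    assert (H50 : 0 < / 50 ^ j) by (apply Rinv_0_lt_compat, pow_lt; lra).
    assert (E : 0.0541 / 50 ^ S j = 0.001082 * / 50 ^ j) by (simpl; unfold Rdiv; rewrite Rinv_mult; lra).
    rewrite E in IH. unfold Rdiv in *. lra.
Qed.

Lemma eps_sum_le n j : 0 <= rsum (bl j n) eps <= 0.06.
Proof.
  split; [apply rsum_nonneg; intros; apply eps_nonneg|].
  eapply Rle_trans; [apply eps_sum|]. 
  assert (H : 1 <= 50 ^ j) by (apply pow_R1_Rle; lra). apply Rinv_le_contravar in H; [|lra].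
  rewrite Rinv_1 in H. unfold Rdiv. lra.
Qed.

Lemma even_mkblocks n j : even_blocks g (bl j n).
Proof.
  intros B' b' H. apply in_mkblocks in H. destruct H as (i & _ & E).
  assert (EB : B' = B i) by (rewrite <- E; auto). assert (Eb : b' = b i) by (rewrite <- E; auto). subst.
  split.
  - assert (Eb : b i = (2 * (i + 1 + (if (i <? J)%nat then 0 else e)))%nat).
    { unfold blk, bpar. cbn [snd]. destruct (i <? J)%nat; lia. }
    rewrite Eb, Nat.even_mul. reflexivity.
  - intros x Hx. apply dens_block_small in Hx. lra.
Qed.

Lemma small_mkblocks n j : small_errors g (bl j n) eps.
Proof.
  intros B' b' H. split; [apply eps_nonneg|]. apply in_mkblocks in H. destruct H as (i & _ & E).
  assert (EB : B' = B i) by (rewrite <- E; auto). assert (Eb : b' = b i) by (rewrite <- E; auto). 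
  rewrite E, EB, Eb. apply block_error.
Qed.

Lemma exp_006_le : exp 0.06 <= 1.064.
Proof.
  pose proof (exp_ineq1_le (- 0.06)) as H. replace 0.06 with (- - 0.06) by lra. rewrite exp_Ropp.
  apply Rle_trans with (/ (1 + - 0.06)); [apply Rinv_le_contravar; lra|lra].
Qed.

Lemma upper_mkblocks n j : upper g (bl j n) <= 1.064 * vblocks g (bl j n).
Proof.
  eapply Rle_trans; [apply upper_hat with (eps := eps)|]; [apply even_mkblocks|apply small_mkblocks|].
  pose proof (vblocks_bounds _ _ (even_mkblocks n j)).
  assert (exp (rsum (bl j n) eps) <= 1.064).
  { eapply Rle_trans; [apply exp_le, eps_sum_le|apply exp_006_le]. }
  rewrite Rmult_comm. apply Rmult_le_compat_r; lra.
Qed.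

(** 0.936 is below 1 - 0.06 * 1.064. *)
Lemma lower_mkblocks n j : 0.936 * vblocks g (bl j n) <= lower g (bl j n).
Proof.
  eapply Rle_trans; [|apply lower_hat with (eps := eps)]; [|apply even_mkblocks|apply small_mkblocks|pose proof (eps_sum_le n j); lra].
  pose proof (vblocks_bounds _ _ (even_mkblocks n j)). pose proof (eps_sum_le n j) as Hs.
  assert (exp (rsum (bl j n) eps) <= 1.064).
  { eapply Rle_trans; [apply exp_le, eps_sum_le|apply exp_006_le]. }
  pose proof (exp_pos (rsum (bl j n) eps)).
  rewrite Rmult_comm. apply Rmult_le_compat_l; [lra|]. nra.
Qed.

(** * Size of the error terms *)

Definition lev (c : nat) (Bb : block) : R := (1 + lsum (map (rho rts) (fst Bb))) ^ (snd Bb + c).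

Lemma lsum_rho_nonneg l : 0 <= lsum (map (rho rts) l).
Proof. apply rsum_nonneg. intros x Hx. apply map_rho_nonneg in Hx; auto. Qed.

Lemma zz_pow j n : zz Lam j ^ n = exp (Lam * (INR n / 3 ^ j)).
Proof. unfold zz. rewrite exp_pow. f_equal. field. apply pow_nonzero; lra. Qed.

Lemma lev_shallow c j : (j < J)%nat -> lev c (blk Lam w J e j) <= exp (Lam * (INR (2 * j + 2 + c) / 3 ^ j)).
Proof.
  intros Hj. unfold lev. simpl fst. replace (b j + c)%nat with (2 * j + 2 + c)%nat.
  2:{ unfold blk, bpar. simpl. destruct (Nat.ltb_spec j J); lia. }
  rewrite <- zz_pow. apply pow_incr. pose proof (lsum_rho_nonneg (B j)) as H0. simpl in H0. split; [lra|].
  assert (H1 : lsum (map (rho rts) (B j)) <= INR (length (B j))).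
  { unfold lsum. rewrite rsum_map. rewrite <- (Rmult_1_l (INR _)), <- rsum_const. apply rsum_le.
    intros p Hp. apply block_prime in Hp. destruct Hp as (Hp & Hp1 & Hp2). apply Hr2; auto.
    pose proof (zz_antitone Lam ltac:(lra) (S j) J ltac:(lia)). lra. }
  pose proof (length_primes3 (Rmax w (zz Lam (S j))) (zz Lam j) (zz_ge_1 Lam ltac:(lra) j)). simpl in *. lra.
Qed.

(** With up to k roots per prime the factor 1 + s is bounded by z_j^2 instead of z_j, which doubles
    the exponent: a nonempty block contains a prime above [w], so that k <= z_j. *)
Lemma lev_deep c j : (J <= j)%nat -> lev c (blk Lam w J e j) <= exp (Lam * (INR (2 * (2 * j + 2 + 2 * e + c)) / 3 ^ j)).
Proof.
  intros Hj. unfold lev. simpl fst. replace (b j + c)%nat with (2 * j + 2 + 2 * e + c)%nat.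
  2:{ unfold blk, bpar. simpl. destruct (Nat.ltb_spec j J); lia. }
  rewrite <- zz_pow, pow_mult. apply pow_incr. pose proof (lsum_rho_nonneg (B j)) as H0. simpl in H0. split; [lra|].
  assert (H1 : lsum (map (rho rts) (B j)) <= INR k * INR (length (B j))).
  { unfold lsum. rewrite rsum_map. rewrite <- rsum_const. apply rsum_le.
    intros p Hp. apply block_prime in Hp. destruct Hp as (Hp & Hp1 & Hp2). apply Hr1; auto. }
  pose proof (length_primes3 (Rmax w (zz Lam (S j))) (zz Lam j) (zz_ge_1 Lam ltac:(lra) j)) as H2.
  pose proof (zz_ge_1 Lam ltac:(lra) j) as H3.
  change (primes3 (Rmax w (zz Lam (S j))) (zz Lam j)) with (B j) in *.
  set (l := B j) in *. change (lsum (map (rho rts) (primes3 _ _))) with (lsum (map (rho rts) l)).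
  set (v := zz Lam j) in *. simpl pow. rewrite Rmult_1_r.
  destruct l as [|p l'] eqn:El; [unfold lsum; simpl; nra|].
  assert (Hp : In p (B j)) by (fold l; rewrite El; simpl; auto).
  assert (Hv : INR k <= v).
  { apply in_primes3 in Hp. destruct Hp as (_ & _ & Hp1 & Hp2). pose proof (Rmax_l w (zz Lam (S j))).
    fold v in Hp2. pose proof w_ge. pose proof (pos_INR k). lra. }
  set (n := INR (length (p :: l'))) in *. assert (0 <= n) by apply pos_INR. 
  assert (INR k * n <= v * (v - 1)) by (apply Rmult_le_compat; try lra; apply pos_INR). lra.
Qed.

(* Telescoping potential: pot c j - pot c (j + 1) = (2 j + 2 + c) / 3^j. *)
Definition pot (c j : nat) : R := (3 * INR j + 9 / 2 + 3 / 2 * INR c) / 3 ^ j.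

Definition levs (c : nat) (l : list block) : R := fold_right (fun Bb d => lev c Bb * d) 1 l.

Lemma lev_pos c Bb : 0 < lev c Bb.
Proof. apply pow_lt. pose proof (lsum_rho_nonneg (fst Bb)). lra. Qed.

Lemma levs_pos c l : 0 < levs c l.
Proof. induction l; simpl; [lra|]. apply Rmult_lt_0_compat; [apply lev_pos|auto]. Qed.

Lemma levs_app c l l' : levs c (l ++ l') = levs c l * levs c l'.
Proof. induction l; simpl; [lra|]. rewrite IHl. ring. Qed.

Lemma levs_shallow c n : forall j, (j + n <= J)%nat -> levs c (bl j n) <= exp (Lam * (pot c j - pot c (j + n))).
Proof.
  induction n as [|n IH]; intros j Hj; simpl.
  - rewrite Nat.add_0_r, Rminus_diag, Rmult_0_r, exp_0. lra.
  - specialize (IH (S j) ltac:(lia)). replace (S j + n)%nat with (j + S n)%nat in IH by lia.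
    replace (pot c j - pot c (j + S n)) with (INR (2 * j + 2 + c) / 3 ^ j + (pot c (S j) - pot c (j + S n))).
    2:{ unfold pot at 1 3. rewrite !plus_INR, mult_INR, (S_INR j). simpl. field. apply pow_nonzero; lra. }
    rewrite Rmult_plus_distr_l, exp_plus. apply Rmult_le_compat; auto.
    + left; apply lev_pos.
    + left; apply levs_pos.
    + apply lev_shallow. lia.
Qed.

(** The doubled potential accounts for the basic truncation levels, and the extra steps 4 e / 3^i
    sum to 6 e / 3^j. *)
Lemma levs_deep c n : forall j, (J <= j)%nat -> levs c (bl j n) <= exp (Lam * (2 * pot c j + 6 * INR e / 3 ^ j)).
Proof.
  induction n as [|n IH]; intros j Hj; simpl.
  - rewrite <- exp_0. apply exp_le. apply Rmult_le_pos; [lra|].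
    assert (0 < / 3 ^ j) by (apply Rinv_0_lt_compat, pow_lt; lra).
    pose proof (pos_INR j). pose proof (pos_INR c). pose proof (pos_INR e).
    unfold pot, Rdiv. apply Rplus_le_le_0_compat; [apply Rmult_le_pos; [lra|]|]; apply Rmult_le_pos; lra.
  - specialize (IH (S j) ltac:(lia)).
    replace (2 * pot c j + 6 * INR e / 3 ^ j) with (INR (2 * (2 * j + 2 + 2 * e + c)) / 3 ^ j + (2 * pot c (S j) + 6 * INR e / 3 ^ S j)).
    2:{ unfold pot. rewrite mult_INR, !plus_INR, !mult_INR, (S_INR j). simpl. field. apply pow_nonzero; lra. }
    rewrite Rmult_plus_distr_l, exp_plus. apply Rmult_le_compat; auto.
    + left; apply lev_pos.
    + left; apply levs_pos.
    + apply lev_deep. lia.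
Qed.

Lemma J_ge_9 : (9 <= J)%nat.
Proof.
  destruct (Nat.le_gt_cases 9 J) as [H|H]; auto. exfalso.
  assert (3 ^ J <= 3 ^ 8) by (apply Rle_pow; [lra|lia]). simpl in H0. pose proof (INR_pos k Hk). lra.
Qed.

Lemma pot_J_small c : (c <= 1)%nat -> 0 <= pot c J <= 0.01.
Proof.
  intros Hc. assert (Hc' : 0 <= INR c <= 1) by (split; [apply pos_INR|apply (le_INR c 1); auto]).
  unfold pot. assert (H0 : 0 < 3 ^ J) by (apply pow_lt; lra). pose proof (pos_INR J).
  assert (H100 : 100 * (3 * INR J + 6) <= 3 ^ J).
  { pose proof J_ge_9 as H9. clear - H9. induction H9 as [|j Hj IH]; [simpl; lra|].
    rewrite S_INR. simpl pow. pose proof (pos_INR j). lra. }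
  split; [apply Rmult_le_pos; [lra|left; apply Rinv_0_lt_compat; auto]|].
  apply Rmult_le_reg_r with (3 ^ J); auto. unfold Rdiv. rewrite Rmult_assoc, Rinv_l; lra.
Qed.

Lemma e_J_small : 0 <= 6 * INR e / 3 ^ J <= 0.018.
Proof.
  assert (H0 : 0 < 3 ^ J) by (apply pow_lt; lra). pose proof (pos_INR e).
  split; [apply Rmult_le_pos; [lra|left; apply Rinv_0_lt_compat; auto]|].
  apply Rmult_le_reg_r with (3 ^ J); auto. unfold Rdiv. rewrite Rmult_assoc, Rinv_l by lra.
  unfold e. rewrite mult_INR. simpl (INR 30). lra.
Qed.

(** The potential starts at 4.5 + 1.5 c; the deep blocks add at most 0.01 + 0.018, since 6 e = 180 k
    is small against 3^J >= 10000 k. *)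
Lemma levs_total c n : (c <= 1)%nat -> levs c (bl 0 (J + n)) <= exp (Lam * (4.55 + 1.5 * INR c)).
Proof.
  intros Hc. rewrite mkblocks_add, levs_app.
  apply Rle_trans with (exp (Lam * (pot c 0 - pot c (0 + J))) * exp (Lam * (2 * pot c J + 6 * INR e / 3 ^ J))).
  - apply Rmult_le_compat; try (left; apply levs_pos); [apply levs_shallow; lia|apply levs_deep; lia].
  - rewrite <- exp_plus. apply exp_le. rewrite <- Rmult_plus_distr_l. apply Rmult_le_compat_l; [lra|].
    simpl (0 + J)%nat. pose proof (pot_J_small c Hc). pose proof e_J_small.
    assert (pot c 0 = 9 / 2 + 3 / 2 * INR c) by (unfold pot; simpl; field). lra.
Qed.

Lemma upperabs_total n : 0 <= upperabs (rho rts) (bl 0 (J + n)) <= exp (Lam * 4.55).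
Proof.
  destruct (upperabs_le (rho rts) (bl 0 (J + n)) (lev 0)) as [H1 H2].
  - intros B' b' _. split; [intros; apply rho_nonneg|]. unfold lev. simpl. rewrite Nat.add_0_r. lra.
  - split; auto. eapply Rle_trans; [exact H2|]. eapply Rle_trans; [apply (levs_total 0 n); lia|].
    apply exp_le. simpl. lra.
Qed.

Lemma upperabs_deep n : 0 <= upperabs (rho rts) (bl J n) <= exp (Lam * 4.55).
Proof.
  destruct (upperabs_le (rho rts) (bl J n) (lev 0)) as [H1 H2].
  - intros B' b' _. split; [intros; apply rho_nonneg|]. unfold lev. simpl. rewrite Nat.add_0_r. lra.
  - split; auto. eapply Rle_trans; [exact H2|]. eapply Rle_trans; [apply (levs_deep 0 n J); lia|].
    apply exp_le. apply Rmult_le_compat_l; [lra|]. pose proof (pot_J_small 0 ltac:(lia)). pose proof e_J_small. lra.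
Qed.

Lemma lowerabs_total n : 0 <= lowerabs (rho rts) (bl 0 (J + n)) <= 2 ^ (J + n) * exp (Lam * 6.05).
Proof.
  (* [c = 1] because the dropped term e_(b+1) contains one more prime than the truncated sum. *)
  destruct (upper_lower_abs (rho rts) (bl 0 (J + n)) (lev 1)) as [_ [H1 H2]].
  - intros B' b' _. split; [intros; apply rho_nonneg|]. unfold lev. simpl fst; simpl snd. rewrite Nat.add_1_r.
    split; [|lra]. apply pow_R1_Rle. pose proof (lsum_rho_nonneg B'). lra.
  - split; auto. rewrite length_mkblocks in H2. eapply Rle_trans; [exact H2|].
    apply Rmult_le_compat_l; [apply pow_le; lra|]. eapply Rle_trans; [apply (levs_total 1 n); lia|].
    apply exp_le. simpl. lra.
Qed.

(** * Sieve densities and the positive margin *)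

Lemma vblocks_lower_gen l (S0 th : R) : 0 <= th <= / 2 ->
  (forall p, In p l -> 0 <= g p <= th) -> rsum l g <= S0 ->
  exp (- (1 + 2 * th) * S0) <= vprod (map g l).
Proof.
  intros Hth Hg HS. eapply Rle_trans; [|apply (vprod_ge_exp _ th Hth)].
  - apply exp_le. assert (E : lsum (map g l) = rsum l g) by (unfold lsum; rewrite rsum_map; reflexivity). rewrite E. nra.
  - intros x Hx. apply in_map_iff in Hx. destruct Hx as (p & <- & Hp); auto.
Qed.

Hypothesis Hz : w <= zz Lam J.

(** A crude bound is enough: k ln Lam is negligible against (ln x)^(1/2), so this loss disappears in
    the final exponential. *)
Lemma vblocks_deep n : exp (- 1.02 * (INR k * (ln (Lam + 1) + 1))) <= vblocks g (bl J n).
Proof.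
  replace (- 1.02) with (- (1 + 2 * 0.01)) by lra.
  apply vblocks_lower_gen; [lra| |].
  - intros p Hp. apply in_support_mkblocks in Hp; [|lra]. apply dens_small; apply Hp.
  - pose proof w_ge. pose proof (INR_pos k Hk).
    apply Rle_trans with (INR k * rsum (primes3 w (zz Lam J)) (fun p => / IZR p)).
    + rewrite <- rsum_scal. apply Rle_trans with (rsum (support (bl J n)) (fun p => INR k * / IZR p)).
      * apply rsum_le. intros p Hp. apply in_support_mkblocks in Hp; [|lra]. apply dens_le_k; apply Hp.
      * apply rsum_incl; [apply NoDup_support_mkblocks; lra| |].
        -- intros p Hp. apply in_support_mkblocks in Hp; [|lra]. apply in_primes3. 
           destruct Hp as (H1 & H2 & H3 & H4). repeat (split; auto). apply H4.
        -- intros p Hp. apply in_primes3 in Hp. destruct Hp as (_ & _ & Hp & _).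
           apply Rmult_le_pos; [lra|]. left. apply Rinv_0_lt_compat. lra.
    + apply Rmult_le_compat_l; [lra|]. eapply Rle_trans; [apply mertens_primes3; lra|].
      assert (Hln : ln (zz Lam J) <= Lam).
      { unfold zz. rewrite ln_exp. assert (H3 : 1 <= 3 ^ J) by (apply pow_R1_Rle; lra).
        apply Rinv_le_contravar in H3; [|lra]. rewrite Rinv_1 in H3. unfold Rdiv. nra. }
      assert (Hlw : 1 <= ln w).
      { rewrite <- (ln_exp 1). apply ln_le; [apply exp_pos|]. pose proof exp_le_3. lra. }
      assert (Hlz : ln w <= ln (zz Lam J)) by (apply ln_le; lra).
      assert (0 <= ln (ln w)) by (apply ln_nonneg; auto).
      assert (ln (ln (zz Lam J)) <= ln (Lam + 1)) by (apply ln_le; lra).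
      assert (0 <= ln (Lam + 1)) by (apply ln_nonneg; lra). lra.
Qed.

Hypothesis HJ2 : 3 ^ J <= 30000 * INR k.
Hypothesis HLk : 40 * 3 ^ J <= Lam.
Hypothesis Hkw2 : 30002 * INR k <= w.

(** At most one root per prime and half of the residue classes give dimension 1/2: the density is
    about (ln z_J / ln z_0)^(1/2) = 3^(-J/2), and 3^J <= 30000 k. *)
Lemma vblocks_shallow : exp (- 3) * / sqrt (30000 * INR k) <= vblocks g (bl 0 J).
Proof.
  pose proof (INR_pos k Hk) as Hk1. pose proof w_ge as Hw100.
  assert (H3J : 1 <= 3 ^ J) by (apply pow_R1_Rle; lra).
  set (th := / w). assert (Hth : 0 < th <= / 2).
  { unfold th. split; [apply Rinv_0_lt_compat; lra|apply Rinv_le_contravar; lra]. }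
  apply Rle_trans with (exp (- (1 + 2 * th) * (/ 2 * ln (3 ^ J) + 1))).
  - assert (HL : ln (3 ^ J) <= 3 ^ J) by (pose proof (ln_le_self (3 ^ J)); lra).
    assert (Hthw : th * w = 1) by (unfold th; rewrite Rinv_l; lra).
    assert (0 <= ln (3 ^ J)) by (apply ln_nonneg; auto).
    (* The factor 1 + 2 th costs at most 1 in the exponent, since ln (3^J) + 2 <= 30002 k <= w.
       Mertens' error costs another 1, and exp (-3) covers both. *)
    assert (H1 : 2 * th * (/ 2 * ln (3 ^ J) + 1) <= 1).
    { apply Rle_trans with (th * w); [|lra]. replace (2 * th * (/ 2 * ln (3 ^ J) + 1)) with (th * (ln (3 ^ J) + 2)) by field.
      apply Rmult_le_compat_l; lra. }
    assert (Hs : ln (sqrt (30000 * INR k)) = / 2 * ln (30000 * INR k)).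
    { assert (H2 : ln (sqrt (30000 * INR k) * sqrt (30000 * INR k)) = ln (30000 * INR k)) by (rewrite sqrt_sqrt; lra).
      rewrite ln_mult in H2 by (apply sqrt_lt_R0; lra). lra. }
    assert (H4 : ln (3 ^ J) <= ln (30000 * INR k)) by (apply ln_le; lra).
    rewrite <- (exp_ln (sqrt (30000 * INR k))) by (apply sqrt_lt_R0; lra).
    rewrite <- exp_Ropp, <- exp_plus. apply exp_le. rewrite Hs. lra.
  - apply vblocks_lower_gen; [lra| |].
    + intros p Hp. apply in_support_mkblocks in Hp; [|lra]. destruct Hp as (H1 & _ & H2 & H3 & _).
      split; [apply dens_nonneg; auto|]. eapply Rle_trans; [apply dens_le_1; auto|].
      unfold th. apply Rinv_le_contravar; lra.
    + apply Rle_trans with (rsum (primes3 (zz Lam J) (zz Lam 0)) (fun p => / IZR p)).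
      * apply Rle_trans with (rsum (support (bl 0 J)) (fun p => / IZR p)).
        -- apply rsum_le. intros p Hp. apply in_support_mkblocks in Hp; [|lra].
           destruct Hp as (H1 & _ & H2 & H3 & _). apply dens_le_1; auto.
        -- apply rsum_incl; [apply NoDup_support_mkblocks; lra| |].
           ++ intros p Hp. apply in_support_mkblocks in Hp; [|lra]. apply in_primes3. 
              destruct Hp as (H1 & H2 & H3 & H4). repeat (split; auto); apply H4.
           ++ intros p Hp. apply in_primes3 in Hp. destruct Hp as (_ & _ & Hp & _).
              left. apply Rinv_0_lt_compat. lra.
      * eapply Rle_trans; [apply mertens_primes3; [lra|apply zz_antitone; [lra|lia]]|].
        unfold zz. rewrite !ln_exp. simpl (3 ^ 0). rewrite Rdiv_1_r.
        rewrite (ln_div Lam (3 ^ J)) by lra.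
        assert (40 / (Lam / 3 ^ J) <= 1); [|lra].
        apply Rmult_le_reg_r with (Lam / 3 ^ J); [apply Rdiv_lt_0_compat; lra|].
        unfold Rdiv at 1. rewrite Rmult_assoc, Rinv_l, Rmult_1_r, Rmult_1_l.
        -- apply Rmult_le_reg_r with (3 ^ J); [lra|]. unfold Rdiv. rewrite Rmult_assoc, Rinv_l; lra.
        -- apply Rgt_not_eq, Rdiv_lt_0_compat; lra.
Qed.

Definition ytop : R := exp (5.05 * Lam).

(** 0.8255 = 1.65 / 2 + 0.0005, from ln 5.05 <= 1.65 and the Mertens error. *)
Lemma last_sum : 0 <= rsum (primes3 (zz Lam 0) ytop) g <= 0.8255.
Proof.
  pose proof w_ge as Hw100. pose proof (zz_antitone Lam ltac:(lra) 0 J ltac:(lia)) as Hz0.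
  assert (Hin : forall p, In p (primes3 (zz Lam 0) ytop) -> prime p /\ w < IZR p /\ zz Lam J < IZR p).
  { intros p Hp. apply in_primes3 in Hp. intuition lra. }
  split; [apply rsum_nonneg; intros p Hp; apply dens_nonneg, Hin, Hp|].
  apply Rle_trans with (rsum (primes3 (zz Lam 0) ytop) (fun p => / IZR p)).
  { apply rsum_le. intros p Hp. apply Hin in Hp. apply dens_le_1; apply Hp. }
  assert (Hzy : zz Lam 0 <= ytop) by (unfold zz, ytop; apply exp_le; simpl; rewrite Rdiv_1_r; lra).
  eapply Rle_trans; [apply mertens_primes3; lra|].
  assert (Hlw : 0 < ln w) by (rewrite <- ln_1; apply ln_increasing; lra).
  assert (H40 : 40 / ln (zz Lam 0) <= 40 / ln w).
  { unfold Rdiv. apply Rmult_le_compat_l; [lra|]. apply Rinv_le_contravar; auto. apply ln_le; lra. }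
  assert (E : ln (ln ytop) - ln (ln (zz Lam 0)) = ln 5.05).
  { unfold ytop, zz. rewrite !ln_exp. simpl (3 ^ 0). rewrite Rdiv_1_r, ln_mult by lra. lra. }
  pose proof ln_505_le. lra.
Qed.

(** The margin is 0.936 - 0.8255 * 1.064 > 0.05. *)
Lemma main_density n : 
  0.05 * (exp (- 3) * / sqrt (30000 * INR k)) * vblocks g (bl J n) <=
  lower g (bl 0 (J + n)) - rsum (primes3 (zz Lam 0) ytop) g * upper g (bl 0 (J + n)).
Proof.
  pose proof (lower_mkblocks (J + n) 0) as H1. pose proof (upper_mkblocks (J + n) 0) as H2.
  pose proof last_sum as H3. pose proof vblocks_shallow as H4.
  pose proof (vblocks_bounds _ _ (even_mkblocks (J + n) 0)) as H5.
  pose proof (vblocks_bounds _ _ (even_mkblocks n J)) as H6.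
  assert (E : vblocks g (bl 0 (J + n)) = vblocks g (bl 0 J) * vblocks g (bl J n)).
  { unfold vblocks. rewrite mkblocks_add, support_app, map_app, vprod_app. reflexivity. }
  assert (H7 := upper_ge_vblocks _ _ (even_mkblocks (J + n) 0)).
  set (V := vblocks g (bl 0 (J + n))) in *. set (U := upper g (bl 0 (J + n))) in *.
  set (s := rsum _ g) in *.
  assert (s * U <= 0.8255 * (1.064 * V)) by (apply Rmult_le_compat; lra).
  apply Rle_trans with (0.05 * V); [|lra].
  rewrite E, Rmult_assoc. apply Rmult_le_compat_l; [lra|]. apply Rmult_le_compat_r; lra.
Qed.
End Estimates.

(** * Counting *)

Definition inSb (m : Z) : bool := if excluded_middle_informative (inS m) then true else false.

Lemma inSb_spec m : inSb m = true <-> inS m.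
Proof. unfold inSb. destruct excluded_middle_informative; split; auto; discriminate. Qed.

Definition ib (b : bool) : R := if b then 1 else 0.

Lemma ib_bounds b : 0 <= ib b <= 1.
Proof. destruct b; simpl; lra. Qed.

Lemma res_bounds q r n : 0 <= res q r n <= 1.
Proof. unfold res. destruct Zdivide_dec; lra. Qed.

Lemma vprod_hit_zero (y : Z -> R) l p : In p l -> y p = 1 -> vprod (map y l) = 0.
Proof.
  induction l as [|q l IH]; simpl; [tauto|]. intros [->|H] E; [rewrite E; ring|]. rewrite IH; auto; ring.
Qed.

Section Count.
Variables (Lam w : R) (J k t : nat) (Ls : list (Z * Z)) (A : Z) (N : nat) (W nu : Z).
Let e := (30 * k)%nat.
Hypothesis HLam : 0 < Lam.
Hypothesis Hk : (1 <= k)%nat.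
Hypothesis Hw : 40 / ln w <= 0.0005.
Hypothesis HJ1 : 10000 * INR k <= 3 ^ J.
Hypothesis HJ2 : 3 ^ J <= 30000 * INR k.
Hypothesis HLk : 40 * 3 ^ J <= Lam.
Hypothesis Hkw : 30002 * INR k <= w.
Hypothesis Hz : w <= zz Lam J.
Hypothesis Hzt : zz Lam (J + t) <= w.
Hypothesis HLs : length Ls = k.
Hypothesis Ha : forall ab, In ab Ls -> (0 < fst ab)%Z /\ IZR (fst ab) <= w.
Hypothesis HW : (0 < W)%Z.
Hypothesis HWp : forall p, prime p -> w < IZR p -> rel_prime W p.

(** Up to z_J the forbidden classes are the same for every [ab], so all the sieves share the density
    [Vdeep] and the set of survivors. *)
Definition rts_at (ab : Z * Z) (p : Z) : list Z :=
  if Rle_dec (IZR p) (zz Lam J) then roots_of Ls p else roots_of [ab] p.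

Definition deep : list block := mkblocks Lam w J e J t.
Definition full : list block := mkblocks Lam w J e 0 (J + t).
Definition Vdeep : R := vblocks (dens (roots_of Ls)) deep.

Definition surv (n : Z) : bool := forallb (fun p => negb (hitb Ls p n)) (support deep).

Lemma w_pos : 100 <= w /\ 100 * INR k <= w.
Proof. pose proof (INR_pos k Hk). lra. Qed.

Lemma not_dvd_lead ab p : In ab Ls -> prime p -> w < IZR p -> ~ (p | fst ab)%Z.
Proof.
  intros Hi Hp Hpw Hd. destruct (Ha ab Hi) as [H0 H1]. apply Z.divide_pos_le in Hd; auto.
  apply IZR_le in Hd. lra.
Qed.

Lemma rho_at_le_k ab p : In ab Ls -> prime p -> w < IZR p -> rho (rts_at ab) p <= INR k.
Proof.
  intros Hi Hp Hpw. unfold rho, rts_at. apply le_INR. destruct Rle_dec.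
  - rewrite <- HLs. apply length_roots_of; auto. intros ab' Hi'. apply not_dvd_lead; auto.
  - apply Nat.le_trans with (length [ab]); [|simpl; lia]. apply length_roots_of; auto.
    intros ab' [<-|[]]. apply not_dvd_lead; auto.
Qed.

Lemma rho_at_le_1 ab p : In ab Ls -> prime p -> w < IZR p -> zz Lam J < IZR p -> rho (rts_at ab) p <= 1.
Proof.
  intros Hi Hp Hpw Hpz. unfold rho, rts_at. destruct Rle_dec; [lra|]. apply (le_INR _ 1).
  apply (length_roots_of [ab]); auto.
  intros ab' [<-|[]]. apply not_dvd_lead; auto.
Qed.

Lemma hits_at ab p n : prime p ->
  hits (rts_at ab) p n = ib (if Rle_dec (IZR p) (zz Lam J) then hitb Ls p n else hitb [ab] p n).
Proof.
  intros [Hp _]. destruct (Rle_dec (IZR p) (zz Lam J)) as [H|H] eqn:E.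
  - apply hits_roots_of; [lia|]. unfold rts_at. rewrite E. auto.
  - apply hits_roots_of; [lia|]. unfold rts_at. rewrite E. auto.
Qed.

Lemma deep_support p : In p (support deep) -> prime p /\ (p mod 4 = 3)%Z /\ w < IZR p /\ IZR p <= zz Lam J.
Proof. intros H. apply in_support_mkblocks in H; [|lra]. intuition. Qed.

Lemma full_support p : In p (support full) -> prime p /\ (p mod 4 = 3)%Z /\ w < IZR p /\ IZR p <= zz Lam 0.
Proof. intros H. apply in_support_mkblocks in H; [|lra]. intuition. Qed.

Lemma deep_in_full p : In p (support deep) -> In p (support full).
Proof.
  intros H. unfold full. rewrite mkblocks_add, support_app. apply in_or_app. right. exact H.
Qed.

Lemma Vdeep_at ab : vblocks (dens (rts_at ab)) deep = Vdeep.
Proof.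
  unfold Vdeep, vblocks. f_equal. apply map_ext_in. intros p Hp. apply deep_support in Hp.
  unfold dens, rho, rts_at. destruct Rle_dec; [auto|lra].
Qed.

Lemma hits_unit (bl : list block) ab n : (forall p, In p (support bl) -> prime p) ->
  (forall B b, In (B, b) bl -> Nat.even b = true) -> even_blocks (fun p => hits (rts_at ab) p n) bl.
Proof.
  intros Hp He B b Hi. split; [eapply He; eauto|]. intros x Hx. apply in_map_iff in Hx.
  destruct Hx as (p & <- & Hpb). rewrite hits_at; [apply ib_bounds|].
  apply Hp. apply in_flat_map. exists (B, b). auto.
Qed.

Lemma even_full ab : In ab Ls -> forall B b, In (B, b) full -> Nat.even b = true.
Proof.
  intros Hi B b H. destruct w_pos.
  apply (even_mkblocks Lam w J k (rts_at ab) Hk ltac:(lra) (fun p => rho_at_le_k ab p Hi) _ _ _ _ H).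
Qed.

Lemma even_deep ab : In ab Ls -> forall B b, In (B, b) deep -> Nat.even b = true.
Proof.
  intros Hi B b H. apply (even_full ab Hi B). unfold full. rewrite mkblocks_add. apply in_or_app. right. exact H.
Qed.

Lemma good_full_last : good_primes (primes3 (zz Lam 0) (ytop Lam) ++ support full).
Proof.
  split.
  - apply NoDup_app; [apply NoDup_primes3|apply NoDup_support_mkblocks; lra|].
    intros p H1 H2. apply in_primes3 in H1. apply full_support in H2. lra.
  - intros p Hp. apply in_app_or in Hp. destruct Hp as [Hp|Hp].
    + apply in_primes3 in Hp. apply Hp.
    + apply full_support in Hp. apply Hp.
Qed.

(** For a survivor no prime of the deep blocks is hit and the upper weight is at least 1; elsewhere
    it is nonnegative. *)
Lemma count_upper ab : In ab Ls ->
  rsum (zints A N) (fun n => res W nu n * ib (surv n)) <= INR N / IZR W * (1.064 * Vdeep) + exp (Lam * 4.55).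
Proof.
  intros Hi. destruct w_pos as [Hw100 Hkw'].
  assert (Hg : good_primes (support deep)).
  { split; [apply NoDup_support_mkblocks; lra|]. intros p Hp. apply deep_support in Hp. apply Hp. }
  pose proof (equid_upper A N (rts_at ab) deep Hg W nu HW) as HE.
  assert (Hc : forall p, In p (support deep) -> rel_prime W p).
  { intros p Hp. apply deep_support in Hp. apply HWp; apply Hp. }
  specialize (HE Hc).
  pose proof (upper_mkblocks Lam w J k (rts_at ab) HLam Hk Hkw' Hw (fun p => rho_at_le_k ab p Hi)
    (fun p => rho_at_le_1 ab p Hi) t J) as HU.
  fold e in HU. change (mkblocks Lam w J e J t) with deep in HU. rewrite Vdeep_at in HU.
  destruct (upperabs_deep Lam w J k (rts_at ab) HLam Hk Hkw' HJ1 (fun p => rho_at_le_k ab p Hi) t) as [HA0 HA];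
    fold e in HA0, HA; change (mkblocks Lam w J e J t) with deep in HA0, HA.
  assert (HNW : 0 <= INR N / IZR W).
  { apply Rmult_le_pos; [apply pos_INR|]. left. apply Rinv_0_lt_compat, (IZR_lt 0); auto. }
  apply Rle_trans with (rsum (zints A N) (fun n => res W nu n * upper (fun p => hits (rts_at ab) p n) deep)).
  - apply rsum_le. intros n _. apply Rmult_le_compat_l; [apply res_bounds|].
    assert (Hev : even_blocks (fun p => hits (rts_at ab) p n) deep).
    { apply hits_unit; [intros p Hp; apply Hg; auto|apply (even_deep ab Hi)]. }
    pose proof (upper_ge_vblocks _ _ Hev) as H1. pose proof (vblocks_bounds _ _ Hev) as H2.
    destruct (surv n) eqn:Es; simpl; [|lra].
    assert (E : vblocks (fun p => hits (rts_at ab) p n) deep = 1); [|lra].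
    unfold surv in Es. rewrite forallb_forall in Es. unfold vblocks.
    assert (Hall : forall p, In p (support deep) -> hits (rts_at ab) p n = 0).
    { intros p Hp. specialize (Es p Hp). apply deep_support in Hp. rewrite hits_at by apply Hp.
      destruct Rle_dec; [|lra]. destruct (hitb Ls p n); [discriminate|reflexivity]. }
    revert Hall. generalize (support deep). induction l as [|p l IH]; intros Hall; simpl; auto.
    rewrite Hall by (simpl; auto). rewrite IH; [ring|]. intros; apply Hall; simpl; auto.
  - assert (HE' := Rle_trans _ _ _ (Rle_abs _) HE).
    assert (INR N / IZR W * upper (dens (rts_at ab)) deep <= INR N / IZR W * (1.064 * Vdeep)) by (apply Rmult_le_compat_l; auto).
    lra.
Qed.

Definition c1 : R := 0.05 * (exp (- 3) * / sqrt 30000).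

(** The first term is the error of the lower sieve. In the second, 9.6 = 5.05 + 4.55 combines the
    length of the union bound with the error of the upper sieve. *)
Definition Eerr : R := 2 ^ (J + t) * exp (Lam * 6.05) + exp (Lam * 9.6).

Lemma rho_last_le ab : In ab Ls -> 
  0 <= rsum (primes3 (zz Lam 0) (ytop Lam)) (rho (rts_at ab)) <= ytop Lam.
Proof.
  intros Hi. split; [apply rsum_nonneg; intros; apply rho_nonneg|].
  assert (H1 : 1 <= ytop Lam) by (unfold ytop; rewrite <- exp_0; apply exp_le; lra).
  pose proof (length_primes3 (zz Lam 0) (ytop Lam) H1) as H2.
  apply Rle_trans with (1 * INR (length (primes3 (zz Lam 0) (ytop Lam)))); [|lra].
  rewrite <- rsum_const. apply rsum_le. intros p Hp. apply in_primes3 in Hp.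
  pose proof (zz_antitone Lam ltac:(lra) 0 J ltac:(lia)). apply rho_at_le_1; auto; try apply Hp; lra.
Qed.

(** The weight [lower] minus (number of hits in [Q]) times [upper] has the mean given by
    [main_density], and pointwise it is at most the indicator of a survivor whose value at [ab] is a
    sum of two squares. *)
Lemma count_lower ab : In ab Ls ->
  (forall n, (W | n - nu)%Z -> (evalL ab n mod 4 = 1)%Z) ->
  (forall n p, (W | n - nu)%Z -> prime p -> (p mod 4 = 3)%Z -> IZR p <= w -> ~ (p | evalL ab n)%Z) ->
  (forall n, In n (zints A N) -> (0 < evalL ab n)%Z /\ IZR (evalL ab n) < (ytop Lam - 1) ^ 2) ->
  INR N / IZR W * (c1 / sqrt (INR k) * Vdeep) - Eerr <=
  rsum (zints A N) (fun n => res W nu n * (ib (surv n) * ib (inSb (evalL ab n)))).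
Proof.
  intros Hi H4 Hsmall Hsize. destruct w_pos as [Hw100 Hkw'].
  pose proof (zz_antitone Lam ltac:(lra) 0 J ltac:(lia)) as Hz0.
  set (Q := primes3 (zz Lam 0) (ytop Lam)).
  assert (Hg := good_full_last). fold Q in Hg.
  assert (Hgf : good_primes (support full)) by (apply good_primes_app_r in Hg; exact Hg).
  set (h := fun n p => hits (rts_at ab) p n).
  assert (EL := equid_lower A N (rts_at ab) full Hgf).
  assert (EU := equid_upper A N (rts_at ab) full Hgf).
  assert (EQ := equid_last A N (rts_at ab) Q _ _ _ _ Hg (upperabs_nonneg _ _) EU).
  apply (fun H => equid_weaken _ _ _ (Q ++ support full) _ _ _ _ H (incl_appr _ (incl_refl _)) (Rle_refl _)) in EL.
  assert (HE := equid_minus _ _ _ _ _ _ _ _ _ EL EQ W nu HW). cbv beta in HE.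
  assert (Hin : forall p, In p (Q ++ support full) -> prime p /\ w < IZR p).
  { intros p Hp. apply in_app_or in Hp. destruct Hp as [Hp|Hp].
    - apply in_primes3 in Hp. split; [apply Hp|lra].
    - apply full_support in Hp. split; apply Hp. }
  specialize (HE (fun p Hp => HWp p (proj1 (Hin p Hp)) (proj2 (Hin p Hp)))).
  pose proof (main_density Lam w J k (rts_at ab) HLam Hk Hkw' Hw HJ1 (fun p => rho_at_le_k ab p Hi)
    (fun p => rho_at_le_1 ab p Hi) Hz HJ2 HLk Hkw t) as HM.
  fold e in HM. fold Q in HM. change (mkblocks Lam w J e J t) with deep in HM.
  change (mkblocks Lam w J e 0 (J + t)) with full in HM. rewrite Vdeep_at in HM.
  pose proof (upperabs_total Lam w J k (rts_at ab) HLam Hk Hkw' HJ1 (fun p => rho_at_le_k ab p Hi)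
    (fun p => rho_at_le_1 ab p Hi) t) as HA.
  pose proof (lowerabs_total Lam w J k (rts_at ab) HLam Hk Hkw' HJ1 (fun p => rho_at_le_k ab p Hi)
    (fun p => rho_at_le_1 ab p Hi) t) as HB.
  fold e in HA, HB. change (mkblocks Lam w J e 0 (J + t)) with full in HA, HB.
  pose proof (rho_last_le ab Hi) as HR. fold Q in HR.
  assert (HErr : lowerabs (rho (rts_at ab)) full + rsum Q (rho (rts_at ab)) * upperabs (rho (rts_at ab)) full <= Eerr).
  { unfold Eerr. apply Rplus_le_compat; [lra|].
    replace (Lam * 9.6) with (5.05 * Lam + Lam * 4.55) by lra. rewrite exp_plus.
    fold (ytop Lam). apply Rmult_le_compat; lra. }
  assert (HNW : 0 <= INR N / IZR W).
  { apply Rmult_le_pos; [apply pos_INR|]. left. apply Rinv_0_lt_compat, (IZR_lt 0); auto. }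
  apply Rle_trans with (rsum (zints A N) (fun n => res W nu n * (lower (h n) full - rsum Q (h n) * upper (h n) full))).
  - assert (HE' : - Eerr <= rsum (zints A N) (fun n => res W nu n * (lower (h n) full - rsum Q (h n) * upper (h n) full)) -
       INR N / IZR W * (lower (dens (rts_at ab)) full - rsum Q (dens (rts_at ab)) * upper (dens (rts_at ab)) full)).
    { set (X := rsum (zints A N) _ - _) in *.
      assert (HX : Rabs X <= Eerr) by (eapply Rle_trans; [exact HE|exact HErr]).
      pose proof (Rle_abs (- X)) as Hm. rewrite Rabs_Ropp in Hm. lra. }
    assert (HC : c1 / sqrt (INR k) * Vdeep <= lower (dens (rts_at ab)) full - rsum Q (dens (rts_at ab)) * upper (dens (rts_at ab)) full).
    { eapply Rle_trans; [|exact HM]. right. unfold c1. rewrite sqrt_mult; [|lra|apply pos_INR].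
      rewrite Rinv_mult. unfold Rdiv. ring. }
    apply (Rmult_le_compat_l _ _ _ HNW) in HC. lra.
  - apply rsum_le. intros n Hn. unfold res. destruct (Zdivide_dec W (n - nu)) as [HWn|HWn]; [|lra].
    rewrite !Rmult_1_l.
    assert (Hev : even_blocks (h n) full).
    { apply hits_unit; [intros p Hp; apply Hgf; auto|apply (even_full ab Hi)]. }
    pose proof (upper_ge_vblocks _ _ Hev) as H1. pose proof (vblocks_bounds _ _ Hev) as H2.
    pose proof (lower_le_vblocks _ _ Hev) as H3.
    assert (HQ : forall p, In p Q -> 0 <= h n p).
    { intros p Hp. unfold h. rewrite hits_at; [apply ib_bounds|]. apply in_primes3 in Hp; apply Hp. }
    assert (HQ0 : 0 <= rsum Q (h n)) by (apply rsum_nonneg; auto).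
    assert (Hpos : 0 <= ib (surv n) * ib (inSb (evalL ab n))).
    { apply Rmult_le_pos; apply ib_bounds. }
    (* A hit in [Q] makes the weight at most [lower - upper <= 0]. A hit in the blocks makes the
       product vanish, so [lower <= 0]. Without hits the weight is at most 1. *)
    destruct (classic (exists p, In p (Q ++ support full) /\ h n p = 1)) as [(p & Hp & Hp1)|Hno].
    + apply Rle_trans with 0; auto. apply in_app_or in Hp. destruct Hp as [Hp|Hp].
      * pose proof (rsum_mem Q (h n) p HQ Hp). rewrite Hp1 in H. nra.
      * unfold vblocks in *. rewrite (vprod_hit_zero (h n) _ p Hp Hp1) in *. nra.
    + assert (Hzero : forall p, In p (Q ++ support full) ->
          (if Rle_dec (IZR p) (zz Lam J) then hitb Ls p n else hitb [ab] p n) = false).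
      { intros p Hp. apply Bool.not_true_iff_false. intros Hh. apply Hno. exists p. split; auto.
        unfold h. rewrite hits_at by (apply Hin; auto). rewrite Hh. reflexivity. }
      assert (Hab : forall p, In p (Q ++ support full) -> ~ (p | evalL ab n)%Z).
      { intros p Hp Hd. specialize (Hzero p Hp). destruct Rle_dec.
        - assert (Ht : hitb Ls p n = true) by (apply hitb_spec; exists ab; auto). congruence.
        - assert (Ht : hitb [ab] p n = true) by (apply hitb_spec; exists ab; simpl; auto). congruence. }
      assert (Hs : surv n = true).
      { unfold surv. apply forallb_forall. intros p Hp. specialize (Hzero p).
        assert (Hp' := deep_in_full p Hp). apply deep_support in Hp.
        destruct (Rle_dec (IZR p) (zz Lam J)); [|lra]. rewrite Hzero; auto. apply in_or_app; auto. }
      assert (HS : inSb (evalL ab n) = true).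
      { apply inSb_spec. destruct (Hsize n Hn) as [Hm0 Hm].
        assert (Hy1 : 1 < ytop Lam) by (unfold ytop; rewrite <- exp_0; apply exp_increasing; lra).
        (* The integer part of [ytop Lam] exceeds [ytop Lam - 1], which is why the size hypothesis
           is stated with that square. *)
        destruct (nat_floor (ytop Lam)) as [y Hy]; [lra|].
        apply (inS_of_sieved _ (Z.of_nat y)); auto.
        - apply lt_IZR. rewrite mult_IZR, <- INR_IZR_INZ. simpl in Hm. nra.
        - assert (0 < y)%nat; [|lia]. apply INR_lt. simpl. lra.
        - intros p Hp Hp4 Hpy. apply IZR_le in Hpy. rewrite <- INR_IZR_INZ in Hpy.
          (* Primes up to [w] are excluded by the residue class of [n], those up to z_0 by the
             blocks, and the remaining ones by [Q]. *)
          destruct (Rle_dec (IZR p) w); [apply (Hsmall n p); auto|]. apply Hab. apply in_or_app.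
          destruct (Rle_dec (IZR p) (zz Lam 0)).
          + right. apply support_mkblocks_complete; auto; try lra. 
          + left. apply in_primes3. split; [auto|]. split; [auto|]. lra. }
      rewrite Hs, HS. simpl ib. 
      assert (0 <= rsum Q (h n) * upper (h n) full) by (apply Rmult_le_pos; lra). lra.
Qed.

Lemma rsum_nth (f : Z * Z -> R) (l : list (Z * Z)) : 
  rsum l f = rsum (seq 0 (length l)) (fun i => f (nth i l (0%Z, 0%Z))).
Proof.
  induction l as [|a l IH]; auto. simpl length. simpl seq. cbn [rsum].
  rewrite <- seq_shift, rsum_map. simpl. rewrite IH. reflexivity.
Qed.

Definition cnt (n : Z) : R := rsum Ls (fun ab => ib (inSb (evalL ab n))).

Lemma cnt_at_least m n : m <= cnt n -> at_least_in_S m Ls n.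
Proof.
  intros H. exists (filter (fun i => inSb (evalL (nth i Ls (0%Z, 0%Z)) n)) (seq 0 (length Ls))).
  split; [apply NoDup_filter, seq_NoDup|]. split.
  - intros i Hi. apply filter_In in Hi. destruct Hi as [Hi Hs]. apply in_seq in Hi.
    split; [lia|]. apply inSb_spec; auto.
  - eapply Rle_trans; [exact H|]. unfold cnt. rewrite rsum_nth.
    rewrite <- (Rmult_1_l (INR _)), <- rsum_const, rsum_filter. right. reflexivity.
Qed.

(* Averaging the number of indices over the survivors: those with few indices contribute at most m0 times the number of survivors. *)
Lemma many_good (Lg : list (Z * Z)) (C : R) : 0 < C -> C * c1 = 8.512 -> 1 <= C ->
  NoDup Lg -> incl Lg Ls -> (k <= 4 * length Lg)%nat ->
  (forall ab, In ab Lg -> forall n, (W | n - nu)%Z -> (evalL ab n mod 4 = 1)%Z) ->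
  (forall ab n p, In ab Ls -> (W | n - nu)%Z -> prime p -> (p mod 4 = 3)%Z -> IZR p <= w -> ~ (p | evalL ab n)%Z) ->
  (forall ab n, In ab Ls -> In n (zints A N) -> (0 < evalL ab n)%Z /\ IZR (evalL ab n) < (ytop Lam - 1) ^ 2) ->
  exists s, NoDup s /\ (forall n, In n s -> In n (zints A N) /\ at_least_in_S (sqrt (INR k) / C) Ls n) /\
    c1 / (8 * sqrt (INR k)) * (INR N / IZR W * Vdeep) - Eerr - exp (Lam * 4.55) <= INR (length s).
Proof.
  intros HC HCc HC1 HndG Hincl Hlen H4 Hsmall Hsize.
  set (m0 := sqrt (INR k) / C).
  set (tst := fun n => ((if Zdivide_dec W (n - nu) then true else false) && surv n && (if Rle_dec m0 (cnt n) then true else false))%bool).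
  set (s := filter tst (zints A N)).
  exists s. split; [apply NoDup_filter, NoDup_zints|]. split.
  { intros n Hn. apply filter_In in Hn. destruct Hn as [Hn Ht]. split; auto. apply cnt_at_least.
    unfold tst in Ht. destruct (Rle_dec m0 (cnt n)); auto. rewrite Bool.andb_false_r in Ht. discriminate. }
  assert (Hk1 := INR_pos k Hk).
  assert (Hsk : 1 <= sqrt (INR k)) by (rewrite <- sqrt_1; apply sqrt_le_1; lra).
  assert (Hss : sqrt (INR k) * sqrt (INR k) = INR k) by (apply sqrt_sqrt; lra).
  assert (Hc1 : 0 < c1).
  { destruct (Rle_dec c1 0); [nra|lra]. }
  assert (Hm0 : 0 <= m0) by (apply Rmult_le_pos; [lra|left; apply Rinv_0_lt_compat; auto]).
  set (X := INR N / IZR W) in *.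
  assert (HT1 : rsum (zints A N) (fun n => res W nu n * (ib (surv n) * cnt n)) <=
     m0 * rsum (zints A N) (fun n => res W nu n * ib (surv n)) + INR k * INR (length s)).
  { rewrite <- rsum_scal. rewrite <- (rsum_const s (INR k)). unfold s. rewrite rsum_filter, <- rsum_plus.
    apply rsum_le. intros n _. 
    assert (Hcnt : 0 <= cnt n <= INR k).
    { split; [apply rsum_nonneg; intros; apply ib_bounds|]. rewrite <- HLs, <- (Rmult_1_l (INR _)).
      unfold cnt. rewrite <- rsum_const. apply rsum_le. intros; apply ib_bounds. }
    unfold tst, res. destruct Zdivide_dec; simpl; [|lra]. destruct (surv n); simpl; [|lra].
    destruct (Rle_dec m0 (cnt n)); lra. }
  assert (HT2 : INR (length Lg) * (X * (c1 / sqrt (INR k) * Vdeep) - Eerr) <=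
     rsum (zints A N) (fun n => res W nu n * (ib (surv n) * cnt n))).
  { apply Rle_trans with (rsum Lg (fun ab => rsum (zints A N) (fun n => res W nu n * (ib (surv n) * ib (inSb (evalL ab n)))))).
    - rewrite Rmult_comm, <- rsum_const. apply rsum_le. intros ab Hab. apply count_lower; auto.
    - rewrite rsum_swap. apply rsum_le. intros n _. unfold cnt.
      rewrite rsum_scal. apply Rmult_le_compat_l; [apply res_bounds|].
      rewrite rsum_scal. apply Rmult_le_compat_l; [apply ib_bounds|].
      apply rsum_incl; auto. intros; apply ib_bounds. }
  assert (HlenR : INR k / 4 <= INR (length Lg) <= INR k).
  { split.
    - apply le_INR in Hlen. rewrite mult_INR in Hlen. simpl (INR 4) in Hlen. lra.
    - apply le_INR. rewrite <- HLs. apply NoDup_incl_length; auto. }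
  assert (HabL : exists ab, In ab Ls).
  { destruct Ls as [|ab l]; [simpl in HLs; lia|]. exists ab; simpl; auto. }
  destruct HabL as [ab0 Hab0].
  pose proof (count_upper ab0 Hab0) as HU. fold X in HU.
  assert (HX : 0 <= X).
  { apply Rmult_le_pos; [apply pos_INR|]. left. apply Rinv_0_lt_compat, (IZR_lt 0); auto. }
  assert (HV : 0 <= Vdeep).
  { rewrite <- (Vdeep_at ab0). destruct w_pos.
    apply vblocks_bounds. apply (even_mkblocks Lam w J k (rts_at ab0) Hk ltac:(lra) (fun p => rho_at_le_k ab0 p Hab0)). }
  set (Y := X * Vdeep) in *. assert (HY : 0 <= Y) by (apply Rmult_le_pos; auto).
  replace (X * (c1 / sqrt (INR k) * Vdeep)) with (c1 / sqrt (INR k) * Y) in HT2 by (unfold Y; ring).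
  replace (X * (1.064 * Vdeep)) with (1.064 * Y) in HU by (unfold Y; ring).
  set (q := sqrt (INR k)) in *.
  assert (HE0 : 0 <= Eerr).
  { unfold Eerr. apply Rplus_le_le_0_compat; [|left; apply exp_pos].
    apply Rmult_le_pos; [apply pow_le; lra|left; apply exp_pos]. }
  assert (Hi1 : INR k / 4 * (c1 / q * Y) <= INR (length Lg) * (c1 / q * Y)).
  { apply Rmult_le_compat_r; [|lra]. apply Rmult_le_pos; auto. apply Rmult_le_pos; [lra|].
    left; apply Rinv_0_lt_compat; lra. }
  assert (Hi2 : INR (length Lg) * Eerr <= INR k * Eerr) by (apply Rmult_le_compat_r; lra).
  assert (Hi3 : m0 * rsum (zints A N) (fun n => res W nu n * ib (surv n)) <= m0 * (1.064 * Y + exp (Lam * 4.55))).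
  { apply Rmult_le_compat_l; auto. }
  assert (Hi4 : INR k / 4 * (c1 / q * Y) = q * c1 / 4 * Y).
  { rewrite <- Hss. field. lra. }
  (* 8.512 = 8 * 1.064 is chosen so that survivors with few indices account for at most half of the
     main term [q * c1 / 4 * Y]; the 4 comes from the proportion of forms in [Lg]. *)
  assert (Hi5 : m0 * 1.064 = q * c1 / 8).
  { unfold m0. assert (E : / C = c1 / 8.512).
    { apply Rmult_eq_reg_l with C; [|lra]. rewrite Rinv_r by lra. unfold Rdiv. rewrite <- Rmult_assoc, HCc. lra. }
    unfold Rdiv at 1. rewrite E. lra. }
  assert (Hi6 : m0 <= INR k).
  { unfold m0. apply Rle_trans with q; [|nra].
    apply Rmult_le_reg_r with C; auto. unfold Rdiv. rewrite Rmult_assoc, Rinv_l by lra. nra. }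
  pose proof (exp_pos (Lam * 4.55)) as Hep.
  assert (Hi7 : m0 * exp (Lam * 4.55) <= INR k * exp (Lam * 4.55)) by (apply Rmult_le_compat_r; lra).
  assert (Hfin : q * c1 / 8 * Y <= INR k * (INR (length s) + Eerr + exp (Lam * 4.55))).
  { assert (m0 * (1.064 * Y) = q * c1 / 8 * Y) by (rewrite <- Hi5; ring). nra. }
  assert (Hq8 : q * c1 / 8 * Y = INR k * (c1 / (8 * q) * Y)).
  { rewrite <- Hss. field. lra. }
  rewrite Hq8 in Hfin. apply Rmult_le_reg_l in Hfin; lra.
Qed.
End Count.

(** * The residue class modulo 4 and modulo the small primes *)

Definition modulus (l : list Z) : Z := fold_right Z.mul 4%Z l.

Lemma modulus_pos l : (forall p, In p l -> prime p) -> (0 < modulus l)%Z.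
Proof.
  induction l as [|p l IH]; simpl; intros H; [lia|].
  assert (prime p) by auto. destruct H0 as [H0 _]. apply Z.mul_pos_pos; [lia|auto].
Qed.

Lemma modulus_4 l : (4 | modulus l)%Z.
Proof. induction l; simpl; [apply Z.divide_refl|apply Z.divide_mul_r; auto]. Qed.

Lemma modulus_in l p : In p l -> (p | modulus l)%Z.
Proof.
  induction l as [|q l IH]; simpl; [tauto|]. intros [->|H].
  - apply Z.divide_mul_l, Z.divide_refl.
  - apply Z.divide_mul_r; auto.
Qed.

Lemma modulus_rel_prime l p : (forall q, In q l -> prime q) -> prime p -> p <> 2%Z -> ~ In p l ->
  rel_prime (modulus l) p.
Proof.
  intros Hl Hp H2 Hn. apply rel_prime_sym. apply prime_rel_prime; auto.
  induction l as [|q l IH]; simpl; intros Hd.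
  - change 4%Z with (2 * 2)%Z in Hd. destruct (prime_mult p Hp _ _ Hd) as [D|D];
    (destruct Hp as [Hp _]; apply Z.divide_pos_le in D; lia).
  - destruct (prime_mult p Hp _ _ Hd) as [D|D].
    + assert (Hq : prime q) by (apply Hl; simpl; auto). apply Hn. simpl. left.
      destruct Hp as [Hp _]. destruct (prime_divisors q Hq p D) as [?|[?|[?|?]]]; try lia; destruct Hq; lia.
    + apply IH; auto; [intros; apply Hl; simpl; auto|simpl in Hn; tauto].
Qed.

Lemma modulus_bound l w : 1 <= w -> (forall p, In p l -> prime p /\ IZR p <= w) ->
  IZR (modulus l) <= 4 * w ^ length l.
Proof.
  intros Hw. induction l as [|p l IH]; intros H; simpl modulus; simpl length; [simpl; lra|].
  rewrite mult_IZR. destruct (H p (or_introl eq_refl)) as [[Hp _] Hpw].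
  assert (0 <= IZR p) by (apply (IZR_le 0); lia).
  assert (Hl : forall q, In q l -> prime q /\ IZR q <= w) by (intros; apply H; simpl; auto).
  specialize (IH Hl).
  assert (0 < IZR (modulus l)) by (apply (IZR_lt 0), modulus_pos; intros q Hq; apply Hl; auto).
  simpl pow. replace (4 * (w * w ^ length l)) with (w * (4 * w ^ length l)) by ring.
  apply Rmult_le_compat; lra.
Qed.

(** Admissibility only asserts that a suitable residue exists; the relation [Q] carries its property
    through the Chinese remainder theorem without a choice function. *)
Lemma crt_list (l : list Z) (r : Z) (Q : Z -> Z -> Prop) : NoDup l ->
  (forall p, In p l -> prime p /\ p <> 2%Z /\ exists c, Q p c) ->
  exists nu, (4 | nu - r)%Z /\ forall p, In p l -> exists c, Q p c /\ (p | nu - c)%Z.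
Proof.
  induction l as [|p l IH]; intros Hnd H.
  - exists r. split; [rewrite Z.sub_diag; apply Z.divide_0_r|simpl; tauto].
  - inversion Hnd; subst. destruct IH as (nu & H4 & Hl); auto; [intros; apply H; simpl; auto|].
    destruct (H p (or_introl eq_refl)) as (Hp & Hp2 & c & Hc).
    destruct (crt2 (modulus l) p nu c) as (s & Hs1 & Hs2).
    { apply modulus_rel_prime; auto. intros q Hq. apply H; simpl; auto. }
    exists s. split.
    + replace (s - r)%Z with ((s - nu) + (nu - r))%Z by ring. apply Z.divide_add_r; auto.
      eapply Z.divide_trans; [apply modulus_4|exact Hs1].
    + intros q [<-|Hq]; [exists c; auto|]. destruct (Hl q Hq) as (d & Hd & Hdq). exists d. split; auto.
      replace (s - d)%Z with ((s - nu) + (nu - d))%Z by ring. apply Z.divide_add_r; auto.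
      eapply Z.divide_trans; [apply modulus_in; eauto|exact Hs1].
Qed.

Lemma pow3_between a : 1 <= a -> exists J, a <= 3 ^ J <= 3 * a.
Proof.
  intros Ha. destruct (nat_floor a) as [n0 Hn0]; [lra|].
  assert (H0 : a <= 3 ^ S n0).
  { apply Rle_trans with (INR (S n0)); [rewrite S_INR; lra|]. clear. induction n0 as [|n IH]; [simpl; lra|].
    rewrite (S_INR (S n)). change (3 ^ S (S n)) with (3 * 3 ^ S n). pose proof (pos_INR (S n)).
    assert (1 <= 3 ^ S n) by (apply pow_R1_Rle; lra). lra. }
  revert H0. generalize (S n0). induction n as [|n IH]; intros H.
  - exists 0%nat. simpl in *. lra.
  - destruct (Rle_dec a (3 ^ n)) as [H1|H1]; auto. exists (S n). simpl in *. lra.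
Qed.

Definition good_at (r : Z) (ab : Z * Z) : bool := (evalL ab r mod 4 =? 1)%Z.

(** Pigeonhole: a form with odd leading coefficient takes a value 1 modulo 4 at some r among 0, 1,
    2, 3, so the four counts add up to at least the number of forms. *)
Lemma good_residue (Ls : list (Z * Z)) : (forall ab, In ab Ls -> Z.gcd 2 (fst ab) = 1%Z) ->
  exists r, (length Ls <= 4 * length (filter (good_at r) Ls))%nat.
Proof.
  intros H.
  assert (Hsum : (length Ls <= length (filter (good_at 0) Ls) + length (filter (good_at 1) Ls) +
     length (filter (good_at 2) Ls) + length (filter (good_at 3) Ls))%nat).
  { induction Ls as [|[a b] Ls IH]; simpl; [lia|].
    assert (IH' := IH (fun ab Hi => H ab (or_intror Hi))).
    assert (Hodd : (a mod 4 = 1 \/ a mod 4 = 3)%Z).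
    { specialize (H (a, b) (or_introl eq_refl)). cbn [fst] in H.
      pose proof (Z.mod_pos_bound a 4 ltac:(lia)). pose proof (Z.div_mod a 4 ltac:(lia)).
      assert (Hn : ~ (2 | a)%Z).
      { intros D. assert (D2 : (2 | Z.gcd 2 a)%Z) by (apply Z.gcd_greatest; auto; apply Z.divide_refl).
        rewrite H in D2. apply Z.divide_pos_le in D2; lia. }
      assert (C : (a mod 4 = 0 \/ a mod 4 = 1 \/ a mod 4 = 2 \/ a mod 4 = 3)%Z) by lia.
      destruct C as [C|[C|[C|C]]]; auto; exfalso; apply Hn; [exists (2 * (a / 4))%Z|exists (2 * (a / 4) + 1)%Z]; lia. }
    assert (Hg : good_at 0 (a, b) = true \/ good_at 1 (a, b) = true \/ good_at 2 (a, b) = true \/ good_at 3 (a, b) = true).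
    { unfold good_at, evalL. simpl fst; simpl snd. rewrite !Z.eqb_eq.
      pose proof (Z.mod_pos_bound b 4 ltac:(lia)).
      rewrite !(Z.add_mod _ b), !(Z.mul_mod a) by lia.
      assert (C : (b mod 4 = 0 \/ b mod 4 = 1 \/ b mod 4 = 2 \/ b mod 4 = 3)%Z) by lia.
      destruct Hodd as [->| ->]; destruct C as [->|[->|[->| ->]]]; simpl; tauto. }
    destruct Hg as [E|[E|[E|E]]]; rewrite E; simpl;
    repeat match goal with |- context [if ?c then _ else _] => destruct c; simpl end; lia. }
  destruct (Nat.le_gt_cases (length Ls) (4 * length (filter (good_at 0) Ls))); [exists 0%Z; auto|].
  destruct (Nat.le_gt_cases (length Ls) (4 * length (filter (good_at 1) Ls))); [exists 1%Z; auto|].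
  destruct (Nat.le_gt_cases (length Ls) (4 * length (filter (good_at 2) Ls))); [exists 2%Z; auto|].
  exists 3%Z. lia.
Qed.

Lemma prodL_divide Ls ab n : In ab Ls -> (evalL ab n | prodL Ls n)%Z.
Proof.
  induction Ls as [|cd Ls IH]; simpl; [tauto|]. intros [->|H].
  - apply Z.divide_mul_l, Z.divide_refl.
  - apply Z.divide_mul_r; auto.
Qed.

Lemma evalL_congr ab n m q : (q | n - m)%Z -> (q | evalL ab n - evalL ab m)%Z.
Proof. intros [d Hd]. exists (fst ab * d)%Z. unfold evalL. nia. Qed.

Lemma c1_pos : 0 < c1 <= 0.05.
Proof.
  unfold c1. pose proof (exp_pos (- 3)).
  assert (H1 : exp (- 3) <= 1) by (rewrite <- exp_0; apply exp_le; lra).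
  assert (H2 : 1 <= sqrt 30000) by (rewrite <- sqrt_1; apply sqrt_le_1; lra).
  assert (H3 : 0 < / sqrt 30000 <= 1).
  { split; [apply Rinv_0_lt_compat; lra|]. rewrite <- Rinv_1. apply Rinv_le_contravar; lra. }
  assert (0 < exp (- 3) * / sqrt 30000) by (apply Rmult_lt_0_compat; lra). split; [lra|]. nra.
Qed.

(** Threshold for l = (ln x)^(1/10). The term exp 20000 gives ln w = 4 ln l >= 80000, hence 40 / ln
    w <= 0.0005; the second serves the polynomial inequalities, and the third absorbs the constant
    [c1]. *)
Definition lam0 : R := exp 20000 + 1000000000 + Rabs (ln (1000 / c1)).

(** * Choice of parameters for large x *)

Section Large.
Variables (l : R) (k : nat).
Hypothesis Hl : lam0 <= l.
Hypothesis Hk : (1 <= k)%nat.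
Hypothesis Hkl : INR k <= l ^ 2.

Lemma l_big : exp 20000 <= l /\ 1000000000 <= l /\ ln (1000 / c1) <= l.
Proof.
  unfold lam0 in Hl. pose proof (Rabs_pos (ln (1000 / c1))). pose proof (Rle_abs (ln (1000 / c1))).
  pose proof (exp_pos 20000). lra.
Qed.

Lemma ln_l : 20000 <= ln l <= l / 1000.
Proof.
  destruct l_big as (H1 & H2 & _). split.
  - rewrite <- (ln_exp 20000). apply ln_le; [apply exp_pos|auto].
  - assert (Hs : 31000 <= sqrt l) by (apply Rsqr_incr_0_var; [rewrite Rsqr_sqrt; unfold Rsqr; lra|apply sqrt_pos]).
    assert (E : sqrt l * sqrt l = l) by (apply sqrt_sqrt; lra).
    assert (El : ln l = 2 * ln (sqrt l)) by (rewrite <- E at 1; rewrite ln_mult; lra).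
    pose proof (ln_le_self (sqrt l) ltac:(lra)). nra.
Qed.

Lemma pow_facts : 1000000000 <= l /\ l ^ 2 = l * l /\ l ^ 4 = l * l * (l * l) /\ l ^ 10 = l ^ 5 * l ^ 5 /\
  l ^ 5 = l * l ^ 4 /\ 1000000000 * l ^ 4 <= l ^ 5 /\ 1000000000 * l ^ 2 <= l ^ 4 /\ 1000000000 * l <= l ^ 2.
Proof.
  destruct l_big as (_ & H & _). assert (0 < l) by lra.
  assert (0 < l ^ 4) by (apply pow_lt; auto). assert (0 < l ^ 2) by (apply pow_lt; auto).
  repeat split; auto; try (simpl; ring).
  - replace (l ^ 5) with (l * l ^ 4) by ring. nra.
  - replace (l ^ 4) with (l ^ 2 * l ^ 2) by ring. assert (1000000000 <= l ^ 2) by (simpl; nra). nra.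
  - replace (l ^ 2) with (l * l) by ring. nra.
Qed.

(** w = (ln x)^(2/5) exceeds the leading coefficients and the multiples of k required, yet the
    modulus, at most 4 w^w, is still far below exp ((ln x)^(1/2)). *)
Let w : R := l ^ 4.
Let Lam : R := l ^ 10 / 10.

Lemma large_params : exists J t, 
  40 / ln w <= 0.0005 /\ 10000 * INR k <= 3 ^ J /\ 3 ^ J <= 30000 * INR k /\ 40 * 3 ^ J <= Lam /\
  30002 * INR k <= w /\ w <= zz Lam J /\ zz Lam (J + t) <= w /\ 2 ^ (J + t) <= exp (2 * l).
Proof.
  destruct pow_facts as (H1 & H2 & H4 & H10 & H5 & H54 & H42 & H21). destruct ln_l as [L1 L2].
  pose proof (INR_pos k Hk) as Hk1.
  destruct (pow3_between (10000 * INR k)) as (J & HJ1 & HJ2); [lra|].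
  (* With 3^t >= l^10 >= Lam the last cut point is at most e, below [w], while 2^(J+t) remains
     polynomial in [l]. *)
  destruct (pow3_between (l ^ 10)) as (t & Ht1 & Ht2); [nra|].
  assert (Hlw : ln w = 4 * ln l).
  { unfold w. rewrite H4, !ln_mult; try lra; apply Rmult_lt_0_compat; lra. }
  exists J, t. 
  assert (HJ0 : 0 < 3 ^ J) by (apply pow_lt; lra).
  assert (HLJ : l <= Lam / 3 ^ J).
  { apply Rmult_le_reg_r with (3 ^ J); auto. unfold Rdiv. rewrite Rmult_assoc, Rinv_l by lra.
    apply Rle_trans with (l * (30000 * l ^ 2)); [apply Rmult_le_compat_l; lra|].
    unfold Lam. rewrite H10. set (m := l ^ 5) in *. assert (30000 * (l * l ^ 2) <= m) by nra. 
    assert (1000000000 <= m) by nra. nra. }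
  assert (Hw9 : 3 <= w) by (unfold w; nra).
  split.
  { apply Rmult_le_reg_r with (ln w); [lra|]. unfold Rdiv. rewrite Rmult_assoc, Rinv_l by lra. lra. }
  split; [auto|]. split; [lra|]. split.
  { apply Rle_trans with (40 * (30000 * l ^ 2)); [lra|]. unfold Lam. rewrite H10.
    set (m := l ^ 5) in *. assert (l ^ 2 <= m) by nra. assert (1000000000 <= m) by nra. nra. }
  split; [unfold w; lra|]. split.
  { rewrite <- (exp_ln w) by lra. unfold zz. apply exp_le. lra. }
  split.
  { apply Rle_trans with (exp 1); [|pose proof exp_le_3; lra]. unfold zz. apply exp_le.
    assert (0 < 3 ^ (J + t)) by (apply pow_lt; lra).
    apply Rmult_le_reg_r with (3 ^ (J + t)); auto. unfold Rdiv. rewrite Rmult_assoc, Rinv_l by lra.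
    rewrite pow_add. unfold Lam.
    assert (1 <= 3 ^ J) by lra. assert (0 < l ^ 10) by nra. nra. }
  apply Rle_trans with (3 ^ (J + t)); [apply pow_incr; lra|]. rewrite pow_add.
  apply Rle_trans with (30000 * l ^ 2 * (3 * l ^ 10)); [apply Rmult_le_compat; try lra; apply pow_le; lra|].
  replace (30000 * l ^ 2 * (3 * l ^ 10)) with (90000 * l ^ 12) by ring.
  replace (2 * l) with (l + l) by ring. rewrite exp_plus. apply Rmult_le_compat; try lra.
  - apply pow_le; lra.
  - pose proof (exp_ineq1_le l). lra.
  - rewrite <- (exp_ln l) at 1 by lra. rewrite exp_pow. apply exp_le. simpl. lra.
Qed.

(** The budget in units of m = l^5 = (ln x)^(1/2): the modulus costs 0.004 m, the density 0.001 m
    and the factor c1 / (8 q) only 2 l, so the main term is far larger than x exp (-m). *)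
Lemma final_bound x N W V q err1 err2 : x = exp (l ^ 10) -> x < INR N + 1 ->
  0 < IZR W <= 4 * w ^ (length (primes3 0 w)) ->
  exp (- 1.02 * (INR k * (ln (Lam + 1) + 1))) <= V -> 0 < q <= l ->
  err1 <= exp (2 * l) * exp (Lam * 6.05) + exp (Lam * 9.6) -> err2 <= exp (Lam * 4.55) ->
  x * exp (- l ^ 5) <= c1 / (8 * q) * (INR N / IZR W * V) - err1 - err2.
Proof.
  intros Hx HN [HW0 HW] HV Hq He1 He2.
  destruct pow_facts as (H1 & H2 & H4 & H10 & H5 & H54 & H42 & H21). destruct ln_l as [L1 L2].
  destruct l_big as (_ & _ & Lc). pose proof (INR_pos k Hk) as Hk1. destruct c1_pos as [Hc Hc2].
  set (m := l ^ 5) in *.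
  assert (Hm0 : 1000000000 <= m) by nra.
  assert (Hm1 : 1000000000 * l <= m) by nra.
  assert (Hw1 : 1 <= w) by (unfold w; nra).
  assert (Hx2 : 2 <= x).
  { rewrite Hx. pose proof (exp_ineq1_le (l ^ 10)). rewrite H10 in *. nra. }
  assert (HN2 : x / 2 <= INR N) by lra.
  assert (HW2 : IZR W <= exp (2 + 0.004 * m)).
  { eapply Rle_trans; [exact HW|]. rewrite exp_plus. apply Rmult_le_compat; try lra.
    - replace 2 with (1 + 1) by lra. rewrite exp_plus. pose proof (exp_ineq1_le 1). nra.
    - rewrite <- (exp_ln w) at 1 by lra. rewrite exp_pow. apply exp_le.
      assert (Hlw : ln w = 4 * ln l).
      { unfold w. rewrite H4, !ln_mult; try lra; apply Rmult_lt_0_compat; lra. }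
      rewrite Hlw. pose proof (length_primes3 0 w Hw1).
      apply Rle_trans with (w * (4 * (l / 1000))); [apply Rmult_le_compat; try lra; apply pos_INR|].
      unfold w. rewrite H5. lra. }
  assert (HV2 : exp (- (0.001 * m)) <= V).
  { eapply Rle_trans; [|exact HV]. apply exp_le.
    assert (HLam : Lam + 1 <= l ^ 10) by (unfold Lam; rewrite H10; nra).
    assert (HLam0 : 0 < Lam + 1) by (unfold Lam; rewrite H10; nra).
    assert (HlL : ln (Lam + 1) <= 10 * ln l).
    { apply Rle_trans with (ln (l ^ 10)); [apply ln_le; auto|]. rewrite ln_pow by lra. simpl. lra. }
    assert (INR k * (ln (Lam + 1) + 1) <= l ^ 2 * l).
    { apply Rle_trans with (INR k * l); [apply Rmult_le_compat_l; lra|apply Rmult_le_compat_r; lra]. }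
    assert (l ^ 2 * l <= 0.0001 * m); [|lra]. rewrite H5. nra. }
  assert (HXW : x / 2 * exp (- (2 + 0.004 * m)) <= INR N / IZR W).
  { unfold Rdiv at 2. apply Rmult_le_compat; try lra; [left; apply exp_pos|].
    rewrite exp_Ropp. apply Rinv_le_contravar; auto. }
  set (E := exp (- (3 + 0.005 * m))).
  assert (HM : x * E <= INR N / IZR W * V).
  { apply Rle_trans with (x / 2 * exp (- (2 + 0.004 * m)) * exp (- (0.001 * m))).
    - rewrite Rmult_assoc, <- exp_plus. unfold E. 
      replace (- (3 + 0.005 * m)) with (Ropp 1 + (- (2 + 0.004 * m) + - (0.001 * m))) by lra.
      rewrite (exp_plus (Ropp 1)). set (F := exp (- (2 + 0.004 * m) + - (0.001 * m))).
      assert (HF : 0 < F) by apply exp_pos.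
      assert (exp (Ropp 1) <= / 2).
      { rewrite exp_Ropp. apply Rinv_le_contravar; [lra|]. pose proof (exp_ineq1_le 1). lra. }
      replace (x / 2 * F) with (x * (/ 2 * F)) by field.
      apply Rmult_le_compat_l; [lra|]. apply Rmult_le_compat_r; lra.
    - apply Rmult_le_compat; auto; try (left; apply exp_pos).
      apply Rmult_le_pos; [lra|left; apply exp_pos]. }
  assert (Hcq : exp (- (2 * l)) <= c1 / (8 * q)).
  { apply Rle_trans with (c1 / (1000 * l)).
    - rewrite exp_Ropp. replace (c1 / (1000 * l)) with (/ (1000 / c1 * l)) by (field; lra).
      apply Rinv_le_contravar.
      + apply Rmult_lt_0_compat; [apply Rdiv_lt_0_compat; lra|lra].
      + replace (2 * l) with (l + l) by ring. rewrite exp_plus. apply Rmult_le_compat; try lra.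
        * left. apply Rdiv_lt_0_compat; lra.
        * rewrite <- (exp_ln (1000 / c1)) by (apply Rdiv_lt_0_compat; lra). apply exp_le; auto.
        * pose proof (exp_ineq1_le l). lra.
    - unfold Rdiv. apply Rmult_le_compat_l; [lra|]. apply Rinv_le_contravar; lra. }
  assert (Hmain : x * exp (- (3 + 2 * l + 0.005 * m)) <= c1 / (8 * q) * (INR N / IZR W * V)).
  { replace (x * exp (- (3 + 2 * l + 0.005 * m))) with (exp (- (2 * l)) * (x * E)).
    - apply Rmult_le_compat; auto; [left; apply exp_pos|]. apply Rmult_le_pos; [lra|left; apply exp_pos].
    - unfold E. replace (- (3 + 2 * l + 0.005 * m)) with (- (2 * l) + - (3 + 0.005 * m)) by lra.
      rewrite exp_plus. ring. }
  (* The factor 4 accounts for three error terms and the target, each at most x exp (-m). *)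
  assert (H4m : 4 * exp (- m) <= exp (- (3 + 2 * l + 0.005 * m))).
  { apply Rle_trans with (exp 3 * exp (- m)).
    - apply Rmult_le_compat_r; [left; apply exp_pos|]. pose proof (exp_ineq1_le 3). lra.
    - rewrite <- exp_plus. apply exp_le. lra. }
  assert (Hbig : 0.96 * l ^ 10 + 2 * l <= l ^ 10 - m).
  { rewrite H10. nra. }
  assert (Hxm : exp (l ^ 10 - m) = x * exp (- m)) by (rewrite Hx, <- exp_plus; f_equal).
  assert (HLpos : 0 < l ^ 10) by (rewrite H10; nra).
  assert (Ha : exp (2 * l) * exp (Lam * 6.05) <= x * exp (- m)).
  { rewrite <- Hxm, <- exp_plus. apply exp_le. unfold Lam. lra. }
  assert (Hb : exp (Lam * 9.6) <= x * exp (- m)) by (rewrite <- Hxm; apply exp_le; unfold Lam; lra).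
  assert (Hd : exp (Lam * 4.55) <= x * exp (- m)) by (rewrite <- Hxm; apply exp_le; unfold Lam; lra).
  assert (x * (4 * exp (- m)) <= x * exp (- (3 + 2 * l + 0.005 * m))) by (apply Rmult_le_compat_l; lra).
  lra.
Qed.

(** A value is below 3 w x. The square of y = [ytop Lam] is x^1.01 >= 12 w x, and y - 1 >= y / 2. *)
Lemma size_bound x ab n : x = exp (l ^ 10) -> (0 < fst ab)%Z -> IZR (fst ab) <= w -> (0 < snd ab)%Z -> IZR (snd ab) < x ->
  0 < IZR n <= 2 * x -> (0 < evalL ab n)%Z /\ IZR (evalL ab n) < (ytop Lam - 1) ^ 2.
Proof.
  intros Hx Ha Haw Hb Hbx Hn.
  destruct pow_facts as (H1 & H2 & H4 & H10 & H5 & H54 & H42 & H21).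
  assert (Hn0 : (0 < n)%Z) by (apply lt_IZR; lra). split; [unfold evalL; nia|].
  set (m := l ^ 5) in *. assert (Hm0 : 1000000000 <= m) by nra.
  unfold evalL. rewrite plus_IZR, mult_IZR.
  assert (Hw1 : 1 <= w) by (unfold w; nra).
  assert (Hx1 : 1 <= x) by (rewrite Hx; pose proof (exp_ineq1_le (l ^ 10)); rewrite H10 in *; nra).
  assert (Ha0 : 0 <= IZR (fst ab)) by (apply (IZR_le 0); lia).
  apply Rlt_le_trans with (3 * w * x).
  { assert (IZR (fst ab) * IZR n <= w * (2 * x)) by (apply Rmult_le_compat; lra). nra. }
  set (y := ytop Lam).
  assert (Hyy : y * y = x * exp (0.01 * l ^ 10)).
  { unfold y, ytop. rewrite Hx, <- !exp_plus. f_equal. unfold Lam. lra. }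
  assert (He := exp_ineq1_le (0.01 * l ^ 10)).
  assert (Hew : 12 * w <= exp (0.01 * l ^ 10)).
  { eapply Rle_trans; [|exact He]. unfold w. rewrite H10. nra. }
  assert (Hy2 : 12 * w * x <= y * y) by (rewrite Hyy; nra).
  assert (Hy0 : 0 < y) by apply exp_pos. assert (Hy3 : 2 <= y) by nra.
  simpl pow. nra.
Qed.

Lemma large_theorem x (Ls : list (Z * Z)) : x = exp (l ^ 10) -> length Ls = k -> P3_admissible Ls ->
  (forall ab, In ab Ls -> (0 < fst ab)%Z /\ IZR (fst ab) <= w /\ Z.gcd 2 (fst ab) = 1%Z /\
     (0 < snd ab)%Z /\ IZR (snd ab) < x) ->
  exists s : list Z, NoDup s /\
    (forall n, In n s -> x <= IZR n <= 2 * x /\ at_least_in_S (sqrt (INR k) / (8.512 / c1)) Ls n) /\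
    x * exp (- l ^ 5) <= INR (length s).
Proof.
  intros Hx HLs (HndL & _ & Hadm) HL.
  destruct pow_facts as (H1 & H2 & H4 & H10 & H5 & H54 & H42 & H21).
  destruct large_params as (J & t & P1 & P2 & P3 & P4 & P5 & P6 & P7 & P8).
  destruct c1_pos as [Hc Hc2]. pose proof (INR_pos k Hk) as Hk1.
  assert (Hw1 : 100 <= w) by (unfold w; nra).
  assert (HLam : 0 < Lam) by (unfold Lam; rewrite H10; nra).
  assert (Hx1 : 1 <= x) by (rewrite Hx; pose proof (exp_ineq1_le (l ^ 10)); rewrite H10 in *; nra).
  set (Pw := primes3 0 w).
  assert (HPw : forall p, In p Pw -> prime p /\ (p mod 4 = 3)%Z /\ IZR p <= w).
  { intros p Hp. apply in_primes3 in Hp. tauto. }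
  destruct (good_residue Ls) as [r Hr].
  { intros ab Hab. apply HL; auto. }
  (* [nu] is [r] modulo 4, for the forms counted by [good_residue], and an admissible residue modulo
     each small prime. *)
  destruct (crt_list Pw r (fun p c => Z.gcd (prodL Ls c) p = 1%Z)) as (nu & Hnu4 & HnuP).
  { apply NoDup_primes3. }
  { intros p Hp. apply HPw in Hp. destruct Hp as (Hp & Hp4 & _). split; auto. split; [intros ->; discriminate|]. apply Hadm; auto. }
  set (W := modulus Pw).
  assert (HW : (0 < W)%Z) by (apply modulus_pos; intros p Hp; apply HPw; auto).
  destruct (nat_floor x) as [N HN]; [lra|].
  (* [up x] is the first integer above [x]; the integers from there, as many as the integer part of
     [x], do not exceed 2x. *)
  set (A := up x). destruct (archimed x) as [HA1 HA2]. fold A in HA1, HA2.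
  assert (Hint : forall n, In n (zints A N) -> x <= IZR n <= 2 * x).
  { intros n Hn. apply in_zints in Hn. destruct Hn as [Hn1 Hn2].
    apply IZR_le in Hn1. assert (Hn3 : (n <= A + Z.of_nat N - 1)%Z) by lia. apply IZR_le in Hn3.
    rewrite minus_IZR, plus_IZR, <- INR_IZR_INZ in Hn3. lra. }
  assert (HWp : forall p, prime p -> w < IZR p -> rel_prime W p).
  { intros p Hp Hpw. apply modulus_rel_prime; auto; [intros q Hq; apply HPw; auto| |].
    - intros ->. lra.
    - intros Hi. apply HPw in Hi. lra. }
  assert (Hbase : forall ab, In ab Ls -> (0 < fst ab)%Z /\ IZR (fst ab) <= w) by (intros ab Hab; split; apply HL; auto).
  destruct (many_good Lam w J k t Ls A N W nu HLam Hk P1 P2 P3 P4 P5 P6 P7 HLs Hbase HW HWp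
    (filter (good_at r) Ls) (8.512 / c1)) as (s & Hnd & Hs & Hcount).
  - apply Rdiv_lt_0_compat; lra.
  - unfold Rdiv. rewrite Rmult_assoc, Rinv_l by lra. lra.
  - apply Rmult_le_reg_r with c1; auto. unfold Rdiv. rewrite Rmult_assoc, Rinv_l by lra. lra.
  - apply NoDup_filter; auto.
  - intros ab Hab. apply filter_In in Hab. tauto.
  - rewrite <- HLs. exact Hr.
  - intros ab Hab n Hn. apply filter_In in Hab. destruct Hab as [_ Hg]. apply Z.eqb_eq in Hg.
    assert (D : (4 | evalL ab n - evalL ab r)%Z).
    { apply evalL_congr. replace (n - r)%Z with ((n - nu) + (nu - r))%Z by ring. apply Z.divide_add_r; auto.
      eapply Z.divide_trans; [apply modulus_4|exact Hn]. }
    destruct D as [d Hd]. replace (evalL ab n) with (evalL ab r + d * 4)%Z by lia. rewrite Z.mod_add by lia. auto.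
  - intros ab n p Hab Hn Hp Hp4 Hpw Hd.
    assert (Hi : In p Pw).
    { apply in_primes3. split; auto. split; auto. split; auto. apply (IZR_lt 0). destruct Hp; lia. }
    destruct (HnuP p Hi) as (c & Hgcd & Hc').
    assert (D : (p | evalL ab n - evalL ab c)%Z).
    { apply evalL_congr. replace (n - c)%Z with ((n - nu) + (nu - c))%Z by ring. apply Z.divide_add_r; auto.
      eapply Z.divide_trans; [apply modulus_in; exact Hi|exact Hn]. }
    assert (D2 : (p | evalL ab c)%Z).
    { replace (evalL ab c) with (evalL ab n - (evalL ab n - evalL ab c))%Z by ring. apply Z.divide_sub_r; auto. }
    assert (D3 : (p | 1)%Z).
    { rewrite <- Hgcd. apply Z.gcd_greatest; [|apply Z.divide_refl].
      eapply Z.divide_trans; [exact D2|apply prodL_divide; auto]. }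
    apply Z.divide_pos_le in D3; [destruct Hp; lia|lia].
  - intros ab n Hab Hn. apply Hint in Hn. destruct (HL ab Hab) as (G1 & G2 & G3 & G4 & G5).
    apply (size_bound x); auto. lra.
  - exists s. split; auto. split.
    + intros n Hn. apply Hs in Hn. split; [apply Hint; apply Hn|apply Hn].
    + eapply Rle_trans; [|exact Hcount].
      assert (Hab0 : exists ab, In ab Ls).
      { destruct Ls as [|ab l']; [simpl in HLs; lia|exists ab; simpl; auto]. }
      destruct Hab0 as [ab0 Hab0].
      apply final_bound; auto.
      * apply HN.
      * split; [apply (IZR_lt 0); auto|]. apply modulus_bound; [lra|]. intros p Hp. apply HPw in Hp. tauto.
      * rewrite <- (Vdeep_at Lam w J k t Ls HLam ab0).
        apply (vblocks_deep Lam w J k); auto; try lra; intros; eapply rho_at_le_k; eauto.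
      * split; [apply sqrt_lt_R0; lra|]. rewrite <- (sqrt_pow2 l) by lra. apply sqrt_le_1; [lra|apply pow_le; lra|lra].
      * unfold Eerr. apply Rplus_le_compat_r. apply Rmult_le_compat_r; [left; apply exp_pos|exact P8].
      * lra.
Qed.
End Large.

(** * The theorem in terms of x *)

Theorem theorem3 :
  exists c C X0 : R, 0 < c /\ 0 < C /\
  forall x : R, X0 <= x ->
  forall k : nat, INR k <= Rpower (ln x) (1/5) ->
  exists p0 : Z, prime p0 /\ c * ln (ln x) <= IZR p0 /\
  forall L : list (Z * Z), length L = k -> P3_admissible L ->
    (forall ab, In ab L ->
       (0 < fst ab)%Z /\ IZR (fst ab) <= Rpower (ln x) (1/3) /\
       Z.gcd (2 * p0) (fst ab) = 1%Z /\
       (0 < snd ab)%Z /\ IZR (snd ab) < x) ->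
    exists s : list Z, NoDup s /\
      (forall n, In n s ->
         x <= IZR n <= 2 * x /\ at_least_in_S (sqrt (INR k) / C) L n) /\
      x * exp (- Rpower (ln x) (1/2)) <= INR (length s).
Proof.
  destruct c1_pos as [Hc Hc2].
  assert (Hlam0 : 1000000000 <= lam0).
  { unfold lam0. pose proof (exp_pos 20000). pose proof (Rabs_pos (ln (1000 / c1))). lra. }
  exists 1, (8.512 / c1), (exp (lam0 ^ 10)). split; [lra|]. split; [apply Rdiv_lt_0_compat; lra|].
  intros x Hx k Hk.
  assert (Hx0 : 0 < x) by (eapply Rlt_le_trans; [apply exp_pos|exact Hx]).
  assert (Hl10 : lam0 ^ 10 <= ln x) by (rewrite <- (ln_exp (lam0 ^ 10)); apply ln_le; [apply exp_pos|auto]).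
  assert (H010 : 0 < lam0 ^ 10) by (apply pow_lt; lra).
  (* The tenth root turns the exponents 1/5, 1/2 and 2/5 into integer powers of [l]; the coefficient
     bound with 1/3 is relaxed to 2/5. *)
  set (l := Rpower (ln x) (1 / 10)).
  assert (Hl0 : 0 < l) by apply exp_pos.
  assert (Hpow : forall n : nat, l ^ n = Rpower (ln x) (INR n / 10)).
  { intros n. rewrite <- Rpower_pow by auto. unfold l. rewrite Rpower_mult. f_equal. field. }
  assert (Hl : l ^ 10 = ln x).
  { rewrite Hpow. replace (INR 10 / 10) with 1 by (simpl; field). apply Rpower_1. lra. }
  assert (Hll : lam0 <= l).
  { destruct (Rle_dec lam0 l) as [|Hn]; auto. exfalso.
    assert (l ^ 10 < lam0 ^ 10); [|lra]. apply Rnot_le_lt in Hn. 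
    assert (l ^ 10 <= lam0 * l ^ 9) by (change (l ^ 10) with (l * l ^ 9); apply Rmult_le_compat_r; [apply pow_le|]; lra).
    assert (0 < l ^ 9) by (apply pow_lt; auto).
    assert (l ^ 9 <= lam0 ^ 9) by (apply pow_incr; lra).
    change (l ^ 10) with (l * l ^ 9). change (lam0 ^ 10) with (lam0 * lam0 ^ 9). nra. }
  assert (Hxl : x = exp (l ^ 10)) by (rewrite Hl, exp_ln; auto).
  assert (Hl5 : Rpower (ln x) (1 / 2) = l ^ 5) by (rewrite Hpow; f_equal; simpl; field).
  assert (Hl2 : Rpower (ln x) (1 / 5) = l ^ 2) by (rewrite Hpow; f_equal; simpl; field).
  assert (Hl4 : Rpower (ln x) (1 / 3) <= l ^ 4).
  { rewrite Hpow. apply Rle_Rpower; [|simpl; lra]. rewrite <- Hl. apply pow_R1_Rle. lra. }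
  rewrite Hl5. rewrite Hl2 in Hk.
  destruct (prime_above (up (ln (ln x)))) as (p0 & Hp0 & Hp0').
  exists p0. split; auto. split.
  { apply IZR_le in Hp0'. destruct (archimed (ln (ln x))). lra. }
  intros L HL Hadm Hab.
  (* The sieve divides by sqrt k. For k = 0 the threshold is 0 and every integer of the interval
     qualifies, with the empty list of indices. *)
  destruct (Nat.eq_dec k 0) as [E0|E0].
  - destruct (nat_floor x) as [N HN]; [lra|]. destruct (archimed x) as [HA1 HA2].
    exists (zints (up x) N). split; [apply NoDup_zints|]. split.
    + intros n Hn. apply in_zints in Hn. destruct Hn as [Hn1 Hn2]. split.
      * apply IZR_le in Hn1. assert (Hn3 : (n <= up x + Z.of_nat N - 1)%Z) by lia. apply IZR_le in Hn3.
        rewrite minus_IZR, plus_IZR, <- INR_IZR_INZ in Hn3. lra.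
      * exists []. split; [constructor|]. split; [simpl; tauto|]. subst k. rewrite E0. simpl INR.
        rewrite sqrt_0. unfold Rdiv. rewrite Rmult_0_l. lra.
    + unfold zints. rewrite length_map, length_seq.
      assert (Hx2 : 2 <= x).
      { rewrite Hxl. pose proof (exp_ineq1_le (l ^ 10)). assert (1 <= l ^ 10) by (apply pow_R1_Rle; lra). lra. }
      assert (exp (- l ^ 5) <= / 2).
      { rewrite exp_Ropp. apply Rinv_le_contravar; [lra|]. pose proof (exp_ineq1_le (l ^ 5)).
        assert (1 <= l ^ 5) by (apply pow_R1_Rle; lra). lra. }
      nra.
  - apply (large_theorem l k); auto; try lia. 
    intros ab Hi. destruct (Hab ab Hi) as (G1 & G2 & G3 & G4 & G5).
    split; auto. split; [lra|]. split; auto.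
    apply Zgcd_1_rel_prime. apply Zgcd_1_rel_prime in G3. 
    apply rel_prime_sym. apply rel_prime_sym in G3. 

    apply Zgcd_1_rel_prime. apply Zgcd_1_rel_prime in G3.
    assert (D : (Z.gcd (fst ab) 2 | 1)%Z).
    { rewrite <- G3. apply Z.gcd_greatest; [apply Z.gcd_divide_l|].
      eapply Z.divide_trans; [apply Z.gcd_divide_r|apply Z.divide_mul_l, Z.divide_refl]. }
    apply Z.divide_1_r_nonneg in D; auto. apply Z.gcd_nonneg.
Qed.
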